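(* Assume the following. (i) The parameter $\theta$ belongs to a compact set. (ii) $m(Z,\theta)$ is a concave function of $\theta$ with a unique and finite maximum, and $E\{m^2(Z,\theta)\}<\infty$ for any $\theta$. (iii) The matrix $-E\{\ddot m(Z,\theta)\}$ is positive-definite, $E\{\ddot m_{k,l}^2(Z,\theta)\}<\infty$, and there exists a function $\psi(z)$ with $E\{\psi^2(Z)\}<\infty$ such that for every $\theta_1,\theta_2$, $|\ddot m_{k,l}(z,\theta_1)-\ddot m_{k,l}(z,\theta_2)|\le\psi(z)\|\theta_1-\theta_2\|$ for $k,l=1,\dots,d$. (iv) The matrix $\Lambda(\theta)=E\{\dot m(Z,\theta)\dot m^{T}(Z,\theta)\}$ is positive-definite, and for $\theta$ in the neighborhood of $\hat\theta_n$, $\frac1n\sum_{i=1}^n\|\dot m(Z_i,\theta)\|^4=O_P(1)$. (v) $\max_{i=1,\dots,n}(n\pi_{n,i})^{-1}=O_P(1)$. If $\Lambda_{n,R}(\theta_0)=\frac1{n^2}\sum_{i=1}^n\frac{\dot m(Z_i,\theta_0)\dot m^{T}(Z_i,\theta_0)}{\pi_{n,i}}$ converges in probability to a positive-definite matrix $\Lambda_\pi(\theta_0)$ as $s_n\to\infty$ and $n\to\infty$, then the Poisson subsampling estimator $\tilde\theta_{s_n,P}$ satisfies $$\sqrt{s_n}\,(\tilde\theta_{s_n,P}-\theta_0)\ \rightsquigarrow\ N\big\{0,\;V_P^U(\theta_0)\big\}$$ (unconditional convergence in distribution), where $V_P^U(\theta)=\ddot M^{-1}(\theta)\Lambda_\pi(\theta)\ddot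 M^{-1}(\theta)$.
   Context: The full data $\mathcal D_n=\{Z_i\}_{i=1}^n$ are independent observations from the distribution of $Z$; $\theta\in\mathbb R^d$ is a parameter; $m(Z,\theta)$ is a real-valued function; $\dot m$ and $\ddot m$ are the gradient and Hessian of $m$ with respect to $\theta$, with $\ddot m_{k,l}$ the $(k,l)$ entry. $M(\theta)=E\{m(Z,\theta)\}$ and $\ddot M$ is its Hessian; $\theta_0=\arg\max_\theta E\{m(Z,\theta)\}$ is the true parameter. The full data estimator $\hat\theta_n$ is the maximizer of $M_n(\theta)=\frac1n\sum_{i=1}^n m(Z_i,\theta)$. $\|\cdot\|$ is the Euclidean norm for vectors. A subsampling distribution for Poisson subsampling is $\{\pi_{n,i}\}_{i=1}^n$ with $\pi_{n,i}>0$, $\sum_{i=1}^n\pi_{n,i}=1$ and $\pi_{n,i}\le s_n^{-1}$; it may depend on $\mathcal D_n$. Here $s_n<n$ is the expected subsample size (but $s_n=o(n)$ is not required). Poisson subsampling: with $u_1,\dots,u_n$ independent $U(0,1)$ variables (independent of the data), $Z_i$ is included in the subsample if and only if $u_i\le s_n\pi_{n,i}$. Let $s_n^*$ be the (random) subsample size, $Z_1^*,\dots,Z_{s_n^*}^*$ the included data points and $\pi_{n,i}^*$ the corresponding probabilities. The estimator is $\tilde\theta_{s_n,P}=\arg\max_\theta\sum_{i=1}^{s_n^*}\frac{m(Z_i^*,\theta)}{n s_n^*\pi_{n,i}^*}$.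
   Formalization: The true parameter θ₀ is additionally assumed to lie in the interior of the compact parameter set; otherwise the claim fails (Θ=[0,1], Z~N(0,1), m=-(Z-θ)²/2, where θ₀=0 and the estimator is never negative). *)

(* Defs.v *)
From HB Require Import structures.
From mathcomp Require Export all_boot all_order all_algebra.
From mathcomp Require Export all_classical all_reals all_analysis.
Export Order.TTheory GRing.Theory Num.Theory numFieldNormedType.Exports.

#[export] Set Implicit Arguments.
#[export] Unset Strict Implicit.
#[export] Unset Printing Implicit Defensive.

#[global] Open Scope classical_set_scope.
#[global] Open Scope ring_scope.

(* Vectors of R^d are row vectors; as the library norm `|v| on 'rV is the
   sup norm, the Euclidean norm is defined here. *)
Definition enorm (R : realType) (d : nat) (v : 'rV[R]_d) : R :=
  Num.sqrt (\sum_(k < d) v 0 k ^+ 2).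

(* v v^T for the column vector v, written with row vectors *)
Definition outer (R : realType) (d : nat) (v : 'rV[R]_d) : 'M[R]_d :=
  v^T *m v.

Definition grad (R : realType) (d : nat) (f : 'rV[R]_d -> R) (t : 'rV[R]_d) :
    'rV[R]_d :=
  \row_(k < d) 'D_(delta_mx 0 k) f t.

Definition hess (R : realType) (d : nat) (f : 'rV[R]_d -> R) (t : 'rV[R]_d) :
    'M[R]_d :=
  \matrix_(k < d, l < d) 'D_(delta_mx 0 k) (fun u => grad f u 0 l) t.

Definition twice_differentiable (R : realType) (d : nat)
    (f : 'rV[R]_d -> R) : Prop :=
  forall t, differentiable f t /\ differentiable (grad f) t.

Definition concave (R : realType) (d : nat) (f : 'rV[R]_d -> R) : Prop :=
  convex_function ([set: 'rV[R]_d] : set (convex_lmodType 'rV[R]_d))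
    (fun t => - f t).

Definition posdefmx (R : realType) (d : nat) (A : 'M[R]_d) : Prop :=
  A^T = A /\ forall v : 'rV[R]_d, v != 0 -> 0 < (v *m A *m v^T) 0 0.

Definition is_argmax (R : realType) (U : Type) (D : set U) (f : U -> R)
    (t : U) : Prop :=
  D t /\ forall t', D t' -> f t' <= f t.

Definition random_vector (R : realType) (d : nat) (dT : measure_display)
    (T : measurableType dT) (X : T -> 'rV[R]_d) : Prop :=
  forall k, measurable_fun [set: T] (fun w => X w 0 k).

(* The law is compared on measurable sets only: measures are total functions,
   unspecified on the other sets. *)
Definition has_law (R : realType) (dT dE : measure_display)
    (T : measurableType dT) (E : measurableType dE) (P : probability T R)
    (X : T -> E) (Q : set E -> \bar R) : Prop :=
  measurable_fun [set: T] X /\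
  forall A, measurable A -> P (X @^-1` A) = Q A.

Definition sigma_of (dT dE : measure_display) (T : measurableType dT)
    (E : measurableType dE) (X : T -> E) : set (set T) :=
  preimage_set_system [set: T] X measurable.

Definition mutually_independent (R : realType) (dT : measure_display)
    (T : measurableType dT) (P : probability T R) (I : finType)
    (F : I -> set (set T)) : Prop :=
  forall (J : {set I}) (A : I -> set T), (forall i, F i (A i)) ->
    P (\bigcap_(i in [set` J]) A i) = (\prod_(i in J) P (A i))%E.

Definition bounded_in_prob (R : realType) (dT : measure_display)
    (T : measurableType dT) (P : probability T R) (X : nat -> T -> R) : Prop :=
  forall e : R, 0 < e ->
    exists K : R, \forall n \near \oo,
      (P [set w | (K < `|X n w|)%R] <= e%:E)%E.

Definition cvg_in_prob (R : realType) (dT : measure_display)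
    (T : measurableType dT) (P : probability T R) (X : nat -> T -> R)
    (c : R) : Prop :=
  forall e : R, 0 < e ->
    P [set w | (e <= `|X n w - c|)%R] @[n --> \oo] --> 0%E.

Definition cvg_in_dist (R : realType) (d : nat) (dT dT' : measure_display)
    (T : measurableType dT) (T' : measurableType dT')
    (P : probability T R) (P' : probability T' R)
    (X : nat -> T -> 'rV[R]_d) (G : T' -> 'rV[R]_d) : Prop :=
  forall f : 'rV[R]_d -> R, continuous f ->
    (exists K : R, forall x, `|f x| <= K) ->
    (\int[P]_w f (X n w)) @[n --> \oo] --> \int[P']_w f (G w).

(* N(0, V): every linear combination a.G has law N(0, a V a^T).  The case of
   zero variance is separate because normal_prob m 0 is not the point mass
   at m. *)
Definition centered_normal_vector (R : realType) (d : nat)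
    (dT : measure_display) (T : measurableType dT) (P : probability T R)
    (G : T -> 'rV[R]_d) (V : 'M[R]_d) : Prop :=
  random_vector G /\
  forall a : 'rV[R]_d,
    let v := (a *m V *m a^T) 0 0 in
    has_law P (fun w => (a *m (G w)^T) 0 0)
      (if v == 0 then dirac (0 : R) : set R -> \bar R
       else normal_prob 0 (Num.sqrt v)).

Definition cvg_in_dist_normal (R : realType) (d : nat) (dT : measure_display)
    (T : measurableType dT) (P : probability T R) (X : nat -> T -> 'rV[R]_d)
    (V : 'M[R]_d) : Prop :=
  exists (dT' : measure_display) (T' : measurableType dT')
    (P' : probability T' R) (G : T' -> 'rV[R]_d),
    centered_normal_vector P' G V /\ cvg_in_dist P P' X G.

Definition full_objective (R : realType) (d n : nat) (E : Type)
    (m : E -> 'rV[R]_d -> R) (z : 'I_n -> E) (t : 'rV[R]_d) : R :=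
  n%:R^-1 * \sum_(i < n) m (z i) t.

Definition poisson_included (R : realType) (n : nat) (s : R)
    (p u : 'I_n -> R) : pred 'I_n :=
  fun i => u i <= s * p i.

(* For an empty subsample the objective is identically 0, so that every point
   of the parameter set is a maximizer. *)
Definition poisson_objective (R : realType) (d n : nat) (E : Type)
    (m : E -> 'rV[R]_d -> R) (s : R) (z : 'I_n -> E) (p u : 'I_n -> R)
    (t : 'rV[R]_d) : R :=
  let size := #|poisson_included s p u| in
  \sum_(i < n | poisson_included s p u i) m (z i) t / (n%:R * size%:R * p i).

Definition Lambda_nR (R : realType) (d n : nat) (E : Type)
    (m : E -> 'rV[R]_d -> R) (z : 'I_n -> E) (p : 'I_n -> R)
    (t : 'rV[R]_d) : 'M[R]_d :=
  (n%:R ^+ 2)^-1 *: \sum_(i < n) (p i)^-1 *: outer (grad (m (z i)) t).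

Definition subsampling_distribution (R : realType) (n : nat) (s : R)
    (p : 'I_n -> R) : Prop :=
  [/\ forall i, 0 < p i, \sum_(i < n) p i = 1 & forall i, p i <= s^-1].

Definition data_uniforms_independent (R : realType) (dT dE : measure_display)
    (T : measurableType dT) (E : measurableType dE) (P : probability T R)
    (n : nat) (Z : 'I_n -> T -> E) (u : 'I_n -> T -> R) : Prop :=
  mutually_independent P
    (fun x : 'I_n + 'I_n =>
       match x with inl i => sigma_of (Z i) | inr i => sigma_of (u i) end).

(* Main.v *)
Require Import Defs.
From mathcomp Require Import measurable_realfun charge ring lra.

(** Up to the random factor [size / s], which does not move its maximizers, the
    subsampling criterion is the Horvitz-Thompson sum
    [F t = \sum_i w_i * m (Z_i) t], where the weight [w_i] is
    [1 / (n * s * pi_i)] for an included observation and [0] otherwise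
    ([poisson_objective_weights]).  Given the data this is a sum of independent
    terms with mean [n^-1 * \sum_i m (Z_i) t].

    Linearization.  [F] is concave.  Its second-order Taylor expansion at
    [theta0] has the gradient [score] and a Hessian that converges in
    probability to the Hessian [H] of the mean criterion, with a cubic remainder
    controlled by the Lipschitz function [psi].  As the score is of order
    [1 / sqrt s], on balls of that radius [F] is, with an error
    negligible before [1 / s], a concave quadratic whose vertex is
    [theta0 - score *m invmx H].  Concavity then forces every maximizer over the
    parameter set to lie within [o(1 / sqrt s)] of that vertex
    ([concave_argmax_near], [estimator_linearization]); no separate proof of
    consistency is needed.

    Laws of large numbers and tightness of the score come from Chebyshev's
    inequality ([ht_sum_deviation]): given the data, the variance of a
    Horvitz-Thompson sum is at most [max (n * pi_i)^-1 / s] times a mean of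
    squares, and that maximum is bounded in probability.

    Central limit theorem.  It is proved for the functions [cos (c + a.x)], which
    carry the characteristic function in real form.  Lindeberg's replacement
    argument is applied twice ([cos_lindeberg]): to the uniform variables with the
    data held fixed ([ht_sum_cos]), then to the data ([data_mean_cos]).
    For a real centered function [f] with second moment [tau], the conditional
    variance of [sqrt s] times the sum is
    [n^-2 * \sum_i f (Z_i) ^+ 2 / pi_i - (s / n) * (n^-1 * \sum_i f (Z_i) ^+ 2)],
    and the conditional mean has the asymptotic variance [(s / n) * tau].
    By the law of large numbers the two contributions of the
    sampling fraction [s / n] cancel, whether or not [s / n] converges, and the
    limit of the first term remains ([ht_sum_clt]); for the projections of the
    score this limit is a quadratic form in [Lambda_pi].

    From cosines to convergence in distribution.  Trigonometric polynomials
    approximate bounded continuous functions on large cubes without exceeding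
    their bounds ([trigpoly_approx], a Bernstein operator built on a random
    walk), and with tightness this gives the continuity theorem
    ([levy_continuity]).  The same theorem shows that cosine means determine a
    law on the line ([cos_has_law]), which, together with the cosine transform of
    the normal law ([normal_cos], from Stein's identity), yields the limiting
    Gaussian vector ([gaussian_vector_exists]). *)

(** * Elementary inequalities *)

Section Elementary.
Context {R : realType}.
Implicit Types (f g : R -> R) (x h c : R).

(** An instance of Taylor's inequality that keeps the constant: the mean value
    theorem turns a bound on the derivative into a bound of one degree more. *)
Lemma mvt_bound f g (C : R) (k : nat) : f 0 = 0 -> 0 <= C ->
  (forall x, is_derive x 1 f (g x)) ->
  (forall x, `|g x| <= C * `|x| ^+ k) ->
  forall x, `|f x| <= C * `|x| ^+ k.+1.
Proof.
move=> f0 C0 df gC x.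
have fc : continuous f.
  move=> y; apply/differentiable_continuous/derivable1_diffP.
  by have /@ex_derive := df y.
have key (a b : R) : a <= b -> exists2 z, z \in `[a, b] & f b - f a = g z * (b - a).
  move=> ab; apply: MVT_segment => //.
  by apply: continuous_subspaceT => y; exact: fc.
have bd z : `|z| <= `|x| -> `|g z * x| <= C * `|x| ^+ k.+1.
  move=> zx; rewrite normrM exprSr mulrA ler_wpM2r //.
  apply: le_trans (gC z) _; rewrite ler_wpM2l //.
  by rewrite lerXn2r // nnegrE.
have [x0|x0] := leP 0 x.
  have [z] := key _ _ x0; rewrite in_itv /= => /andP[z0 zx].
  rewrite f0 !subr0 => ->; apply: bd.
  by rewrite !ger0_norm // (le_trans z0).
have [z] := key _ _ (ltW x0); rewrite in_itv /= => /andP[zx z0].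
rewrite f0 !sub0r => /eqP; rewrite eqr_oppLR mulrN opprK => /eqP ->.
by apply: bd; rewrite (ler0_norm z0) (ltr0_norm x0) lerN2.
Qed.

Lemma sin_le x : `|sin x| <= `|x|.
Proof.
rewrite -[leRHS]mul1r -[`|x| in leRHS]expr1.
apply: (@mvt_bound _ cos) => //; first exact: sin0.
move=> z; rewrite expr0 mulr1; exact: cos_max.
Qed.

Lemma cosB1_le1 x : `|cos x - 1| <= `|x|.
Proof.
rewrite -[leRHS]mul1r -[`|x| in leRHS]expr1.
apply: (@mvt_bound (fun x => cos x - 1) (fun x => - sin x)) => //.
- by rewrite cos0 subrr.
- by move=> z; rewrite -[X in is_derive _ _ _ X]subr0; exact: is_deriveB.
- by move=> z; rewrite expr0 mulr1 normrN; exact: sin_max.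
Qed.

Lemma cosB1_le2 x : `|cos x - 1| <= x ^+ 2.
Proof.
rewrite -[leRHS]mul1r -(real_normK (num_real x)).
apply: (@mvt_bound (fun x => cos x - 1) (fun x => - sin x)) => //.
- by rewrite cos0 subrr.
- by move=> z; rewrite -[X in is_derive _ _ _ X]subr0; exact: is_deriveB.
- by move=> z; rewrite expr1 mul1r normrN; exact: sin_le.
Qed.

Lemma sinB_le2 x : `|sin x - x| <= `|x| ^+ 2.
Proof.
rewrite -[leRHS]mul1r.
apply: (@mvt_bound (fun x => sin x - x) (fun x => cos x - 1)) => //.
- by rewrite sin0 subrr.
- by move=> z; rewrite expr1 mul1r; exact: cosB1_le1.
Qed.

Lemma sinB_le3 x : `|sin x - x| <= `|x| ^+ 3.
Proof.
rewrite -[leRHS]mul1r.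
apply: (@mvt_bound (fun x => sin x - x) (fun x => cos x - 1)) => //.
- by rewrite sin0 subrr.
- by move=> z; rewrite mul1r real_normK ?num_real //; exact: cosB1_le2.
Qed.

Let d_cos2 (z : R) : is_derive z 1 (fun x => cos x - 1 + x ^+ 2 / 2) (z - sin z).
Proof.
have h : is_derive z 1 (fun x : R => x ^+ 2 / 2) z.
  by apply: is_derive_eq; rewrite /GRing.scale /=; field.
have -> : z - sin z = - sin z + z by rewrite addrC.
apply: (@is_deriveD _ _ _ (fun x : R => cos x - 1)).
by rewrite -[X in is_derive _ _ _ X]subr0; exact: is_deriveB.
Qed.

Lemma cos2_le2 x : `|cos x - 1 + x ^+ 2 / 2| <= 2 * `|x| ^+ 2.
Proof.
have := ler_normD (cos x - 1) (x ^+ 2 / 2).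
have := cosB1_le2 x.
have : `|x ^+ 2 / 2| = `|x| ^+ 2 / 2.
  by rewrite normrM normrX [X in _ * X]ger0_norm.
have : `|x| ^+ 2 = x ^+ 2 by rewrite real_normK ?num_real.
have := sqr_ge0 x; move=> *; lra.
Qed.

Lemma cos2_le3 x : `|cos x - 1 + x ^+ 2 / 2| <= `|x| ^+ 3.
Proof.
rewrite -[leRHS]mul1r.
apply: (mvt_bound _ _ d_cos2) => //.
- by rewrite cos0 subrr expr0n /= mul0r addr0.
- by move=> z; rewrite mul1r distrC; exact: sinB_le2.
Qed.

(** The two regimes of [Num.min] come from the third-order bound for small [h]
    and from the second-order bound for large [h]; this is the form that a
    Lindeberg argument needs when only second moments exist. *)
Lemma cos_taylor x h :
  `|cos (x + h) - (cos x - h * sin x - h ^+ 2 / 2 * cos x)|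
    <= 3 * (h ^+ 2 * Num.min 1 `|h|).
Proof.
have -> : cos (x + h) - (cos x - h * sin x - h ^+ 2 / 2 * cos x) =
  cos x * (cos h - 1 + h ^+ 2 / 2) - sin x * (sin h - h).
  rewrite cosD; ring.
have h2 : h ^+ 2 = `|h| ^+ 2 by rewrite real_normK ?num_real.
have A : `|cos x * (cos h - 1 + h ^+ 2 / 2) - sin x * (sin h - h)| <=
  `|cos h - 1 + h ^+ 2 / 2| + `|sin h - h|.
  apply: le_trans (ler_normB _ _) _; rewrite !normrM.
  apply: lerD; rewrite -[leRHS]mul1r ler_wpM2r //;
    [exact: cos_max|exact: sin_max].
apply: le_trans A _; rewrite [X in 3 * (X * _)]h2.
have := cos2_le2 h; have := cos2_le3 h; have := sinB_le2 h; have := sinB_le3 h.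
have := normr_ge0 h; set a := `|h| => a0.
have a3 : 0 <= a ^+ 3 by rewrite exprn_ge0.
have a2 : 0 <= a ^+ 2 by rewrite exprn_ge0.
have [a1|a1] := leP 1 a.
  rewrite mulr1 => *; lra.
rewrite -exprSr.
move=> *; lra.
Qed.

(** Also valid for large [x], where [expR (- x)] is negligible and the linear
    bound is the better one. *)
Lemma expRN_taylor x : 0 <= x -> `|expR (- x) - (1 - x)| <= Num.min x (x ^+ 2).
Proof.
move=> x0; have e1 : 1 - x <= expR (- x) by exact: expR_ge1Dx.
rewrite ger0_norm ?subr_ge0 // le_min; apply/andP; split.
  have : expR (- x) <= 1 by rewrite expR_le1 oppr_le0.
  lra.
have e2 : 1 + x <= expR x by exact: expR_ge1Dx.
have : expR (- x) <= (1 + x)^-1.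
  by rewrite expRN lef_pV2 // posrE ?expR_gt0 //; lra.
have : (1 + x)^-1 <= 1 - x + x ^+ 2.
  rewrite -[leLHS]mulr1 ler_pdivrMl; last by lra.
  have := exprn_ge0 3 x0; nra.
lra.
Qed.

Lemma expRN_lip (C x y : R) : - C <= x -> - C <= y ->
  `|expR (- x) - expR (- y)| <= expR C * `|x - y|.
Proof.
wlog xy : x y / x <= y.
  move=> W xC yC; have [xy|yx] := leP x y; first exact: W.
  by rewrite distrC [`|x - y|]distrC; apply: W => //; exact: ltW.
move=> xC yC.
have -> : expR (- y) = expR (- x) * expR (- (y - x)).
  by rewrite -expRD; congr expR; ring.
rewrite -{1}[expR (- x)]mulr1 -mulrBr normrM ger0_norm ?expR_ge0 //.
apply: ler_pM; rewrite ?expR_ge0 ?normr_ge0 //; first by rewrite ler_expR; lra.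
rewrite distrC [`|x - y|]distrC.
rewrite [`|y - x|]ger0_norm ?subr_ge0 // ler0_norm; last first.
  by rewrite subr_le0 expR_le1; lra.
have := expR_ge1Dx (- (y - x)); lra.
Qed.

End Elementary.

Lemma cos_lip (R : realType) (x y : R) : `|cos y - cos x| <= `|y - x|.
Proof.
have H : forall h, `|cos (x + h) - cos x| <= 1 * `|h| ^+ 1.
  apply: (@mvt_bound _ _ (fun h => - sin (x + h))) => //.
  - by rewrite addr0 subrr.
  - by move=> h; apply: is_derive_eq; rewrite /GRing.scale /= subr0 add0r mulr1. 
  - by move=> h; rewrite normrN expr0 mulr1 sin_max.
by have := H (y - x); rewrite mul1r expr1 addrCA subrr addr0.
Qed.

(** * Trigonometric polynomials *)

Section RowVectors.
Context {R : realType} {d : nat}.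
Implicit Types (x y a b : 'rV[R]_d).

Definition dot a x : R := (a *m x^T) 0 0.

Lemma dotE a x : dot a x = \sum_(k < d) a 0 k * x 0 k.
Proof. by rewrite /dot mxE; apply: eq_bigr => k _; rewrite mxE. Qed.

Lemma dotC a x : dot a x = dot x a.
Proof. by rewrite !dotE; apply: eq_bigr => k _; rewrite mulrC. Qed.

Lemma dotDl a b x : dot (a + b) x = dot a x + dot b x.
Proof. by rewrite /dot mulmxDl mxE. Qed.

Lemma dotBl a b x : dot (a - b) x = dot a x - dot b x.
Proof. by rewrite /dot mulmxBl !mxE. Qed.

Lemma dotDr a x y : dot a (x + y) = dot a x + dot a y.
Proof. by rewrite !(dotC a) dotDl. Qed.

Lemma dotBr a x y : dot a (x - y) = dot a x - dot a y.
Proof. by rewrite !(dotC a) dotBl. Qed.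

Lemma dotZl c a x : dot (c *: a) x = c * dot a x.
Proof. by rewrite /dot -scalemxAl mxE. Qed.

Lemma dotZr c a x : dot a (c *: x) = c * dot a x.
Proof. by rewrite !(dotC a) dotZl. Qed.

Lemma dot0l x : dot 0 x = 0.
Proof. by rewrite /dot mul0mx mxE. Qed.

Lemma dot_delta k x : dot (delta_mx 0 k) x = x 0 k.
Proof.
rewrite dotE (bigD1 k) //= mxE !eqxx mul1r big1 ?addr0 // => j jk.
by rewrite mxE eqxx (negbTE jk) mul0r.
Qed.

Lemma coord_le_norm x k : `|x 0 k| <= `|x|.
Proof.
rewrite [leRHS]mx_normrE.
by have /= := le_bigmax 0 (fun i : 'I_1 * 'I_d => `|x i.1 i.2|) (0, k).
Qed.

Lemma norm_le_coord x c : 0 <= c -> (forall k, `|x 0 k| <= c) -> `|x| <= c.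
Proof.
move=> c0 H; rewrite [leLHS]mx_normrE; apply/bigmax_leP; split=> // -[i k] _ /=.
by rewrite ord1.
Qed.

Lemma norm_dot_le a x : `|dot a x| <= d%:R * `|a| * `|x|.
Proof.
rewrite dotE; apply: le_trans (ler_norm_sum _ _ _) _.
rewrite (_ : _ * _ * _ = \sum_(k < d) `|a| * `|x|); last first.
  by rewrite sumr_const card_ord -mulrA mulr_natl.
by apply: ler_sum => k _; rewrite normrM ler_pM // coord_le_norm.
Qed.

End RowVectors.

Section TrigPolynomials.
Context {R : realType} {d : nat}.
Implicit Types (x y a b : 'rV[R]_d) (f g q : 'rV[R]_d -> R).

Inductive trigpoly : ('rV[R]_d -> R) -> Prop :=
| trigpoly_cos a c : trigpoly (fun x => cos (c + dot a x))
| trigpolyD f g : trigpoly f -> trigpoly g -> trigpoly (fun x => f x + g x)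
| trigpolyZ k f : trigpoly f -> trigpoly (fun x => k * f x).

Lemma trigpoly_cst k : trigpoly (fun=> k).
Proof.
have -> : (fun=> k) = (fun x : 'rV[R]_d => k * cos (0 + dot 0 x)).
  by apply/funext => x; rewrite dot0l addr0 cos0 mulr1.
exact/trigpolyZ/trigpoly_cos.
Qed.

Lemma trigpoly_sin a : trigpoly (fun x => sin (dot a x)).
Proof.
have -> : (fun x => sin (dot a x)) = (fun x => cos (- (pi / 2) + dot a x)).
  by apply/funext => x; rewrite addrC cosBpihalf.
exact: trigpoly_cos.
Qed.

(** The addition formulas make the span of the cosines an algebra. *)
Lemma trigpolyM f g : trigpoly f -> trigpoly g -> trigpoly (fun x => f x * g x).
Proof.
move=> tf; elim: tf g => [a c g|f1 f2 _ IH1 _ IH2 g tg|k f1 _ IH g tg].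
- elim=> [b e|g1 g2 _ IH1 _ IH2|k g1 _ IH].
  + have -> : (fun x => cos (c + dot a x) * cos (e + dot b x)) =
      (fun x => 2^-1 * cos ((c + e) + dot (a + b) x) +
                2^-1 * cos ((c - e) + dot (a - b) x)).
      apply/funext => x; rewrite dotDl dotBl.
      have -> : c + e + (dot a x + dot b x) = (c + dot a x) + (e + dot b x) by ring.
      have -> : c - e + (dot a x - dot b x) = (c + dot a x) - (e + dot b x) by ring.
      by move: (c + _) (e + _) => u v; rewrite cosB cosD; field.
    by apply: trigpolyD; apply/trigpolyZ/trigpoly_cos.
  + under eq_fun do rewrite mulrDr; exact: trigpolyD.
  + under eq_fun do rewrite mulrCA; exact: trigpolyZ.
- under eq_fun do rewrite mulrDl; apply: trigpolyD; [exact: IH1|exact: IH2].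
- under eq_fun do rewrite -mulrA; apply: trigpolyZ; exact: IH.
Qed.

(** The position, after the steps of [ks], of a walk that starts at [y] and
    whose step along coordinate [k] is [+ h] or [- h] with mean [h * t k]. *)
Fixpoint walk (t : 'I_d -> R) (h : R) (ks : seq 'I_d)
    (phi : 'rV[R]_d -> R) (y : 'rV[R]_d) : R :=
  if ks is k :: ks' then
    (1 + t k) / 2 * walk t h ks' phi (y + h *: delta_mx 0 k) +
    (1 - t k) / 2 * walk t h ks' phi (y - h *: delta_mx 0 k)
  else phi y.

(** Each step multiplies by a factor that is affine in some
    [sin (b * x 0 k)]. *)
Lemma walk_trigpoly (b : R) h ks phi y :
  trigpoly (fun x => walk (fun k => sin (b * x 0 k)) h ks phi y).
Proof.
elim: ks y => [|k ks IH] y /=; first exact: trigpoly_cst.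
have ts : trigpoly (fun x => sin (b * x 0 k)).
  have -> : (fun x => sin (b * x 0 k)) = (fun x => sin (dot (b *: delta_mx 0 k) x)).
    by apply/funext => x; rewrite dotZl dot_delta.
  exact: trigpoly_sin.
apply: trigpolyD; apply: trigpolyM => //.
  have -> : (fun x => (1 + sin (b * x 0 k)) / 2) = (fun x => 2^-1 + 2^-1 * sin (b * x 0 k)).
    by apply/funext => x; field.
  by apply: trigpolyD; [exact: trigpoly_cst|exact: trigpolyZ].
have -> : (fun x => (1 - sin (b * x 0 k)) / 2) = (fun x => 2^-1 + - 2^-1 * sin (b * x 0 k)).
  by apply/funext => x; field.
by apply: trigpolyD; [exact: trigpoly_cst|exact: trigpolyZ].
Qed.

Section WalkTheory.
Variables (t : 'I_d -> R) (h : R).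
Hypothesis t1 : forall k, `|t k| <= 1.

Let p0 k : 0 <= (1 + t k) / 2.
Proof. by have := t1 k; rewrite ler_norml => /andP[? ?]; lra. Qed.
Let m0 k : 0 <= (1 - t k) / 2.
Proof. by have := t1 k; rewrite ler_norml => /andP[? ?]; lra. Qed.

(** The coefficients of the walk are transition probabilities. *)
Lemma walk_le ks phi psi y : (forall y, phi y <= psi y) ->
  walk t h ks phi y <= walk t h ks psi y.
Proof.
by move=> le; elim: ks y => //= k ks IH y; apply: lerD; rewrite ler_wpM2l.
Qed.

Lemma walk_cst ks c y : walk t h ks (fun=> c) y = c.
Proof. by elim: ks y => //= k ks IH y; rewrite !IH; field. Qed.

Lemma walkD ks phi psi y :
  walk t h ks (fun y => phi y + psi y) y = walk t h ks phi y + walk t h ks psi y.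
Proof. by elim: ks y => //= k ks IH y; rewrite !IH; ring. Qed.

Lemma walkZ ks c phi y :
  walk t h ks (fun y => c * phi y) y = c * walk t h ks phi y.
Proof. by elim: ks y => //= k ks IH y; rewrite !IH; ring. Qed.

Lemma walk_sum ks (I : Type) (r : seq I) (phi : I -> 'rV[R]_d -> R) y :
  walk t h ks (fun y => \sum_(i <- r) phi i y) y = \sum_(i <- r) walk t h ks (phi i) y.
Proof.
elim: r => [|i r IH].
  by under [phi in walk _ _ _ phi]eq_fun do rewrite big_nil; rewrite walk_cst big_nil.
under [phi in walk _ _ _ phi]eq_fun do rewrite big_cons.
by rewrite walkD IH big_cons.
Qed.

(** Bias plus variance of one coordinate of the end point. *)
Lemma walk_sqr ks l (a : R) y :
  walk t h ks (fun z => (z 0 l - a) ^+ 2) y =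
  (count_mem l ks)%:R * (h ^+ 2 * (1 - t l ^+ 2)) +
  (y 0 l + (count_mem l ks)%:R * (h * t l) - a) ^+ 2.
Proof.
elim: ks y => [|k ks IH] y /=; first by rewrite !mul0r addr0 add0r.
rewrite !IH !mxE eqxx /= natrD.
case: (eqVneq k l) => [->|kl].
  by rewrite /=; field.
by rewrite /= ?mulr0 ?addr0 ?subr0 ?add0r; field.
Qed.

End WalkTheory.

Lemma compact_unif_continuous f (K : set 'rV[R]_d) : continuous f -> compact K ->
  forall e, 0 < e -> exists2 r : R, 0 < r &
    forall x y, K x -> `|x - y| < r -> `|f x - f y| < e.
Proof.
move=> fc /compact_near_coveringP cK e e0.
have := cK R (0^'+) (fun r x => forall y, `|x - y| < r -> `|f x - f y| < e) _.
case.
  move=> x _; have /cvgrPdist_lt /(_ (e / 2)) := fc x.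
  rewrite divr_gt0 // => /(_ isT) /nbhs_ballP[r /= r0 xr].
  exists (ball x (r / 2), [set s | 0 < s < r / 2]) => /=.
    split; first by apply: nbhsx_ballx; rewrite divr_gt0.
    near=> s; apply/andP; split; first by near: s; exact: nbhs_right_gt.
    by near: s; apply: nbhs_right_lt; rewrite divr_gt0.
  move=> [x' s] /= [xx' /andP[s0 sr]] y x'y.
  have b1 : ball x r x' by apply: le_ball xx'; lra.
  have b2 : ball x r y.
    rewrite -ball_normE /= in xx' *.
    have -> : x - y = (x - x') + (x' - y) by rewrite addrA subrK.
    by apply: le_lt_trans (ler_normD _ _) _; lra.
  have -> : f x' - f y = (f x - f y) - (f x - f x') by ring.
  apply: le_lt_trans (ler_normB _ _) _.
  have := xr _ b1; have := xr _ b2; rewrite /=; lra.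
move=> r /= r0 H; exists (r / 2); first by rewrite divr_gt0.
move=> x y Kx xy; apply: (H (r / 2) _ _ x Kx) => //=.
  by rewrite sub0r normrN ger0_norm; lra.
by rewrite divr_gt0.
Unshelve. all: by end_near.
Qed.

Lemma compact_closed_ball (L : R) : compact [set x : 'rV[R]_d | `|x| <= L].
Proof.
apply: bounded_closed_compact.
  by exists L; split; rewrite ?num_real // => M LM x /= xL; apply: le_trans xL (ltW LM).
have -> : [set x : 'rV[R]_d | `|x| <= L] = Num.norm @^-1` [set y | y <= L] by [].
by apply: closed_comp; [move=> x _; exact: norm_continuous|exact: closed_le].
Qed.

(** Weierstrass approximation by trigonometric polynomials, with the uniform
    bound kept outside of the ball: a Bernstein operator whose nodes are the
    end points of the walk above with [t k = sin (b * x 0 k)].  After [N] steps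
    of length [1/N] along each coordinate the walk is close to
    [sin (b * x 0 k)], and [sin (b * v) / b] is close to [v] for small [b]. *)
Lemma trigpoly_approx f (K L e : R) : continuous f -> (forall x, `|f x| <= K) ->
  0 < e -> exists q, [/\ trigpoly q, (forall x, `|q x| <= K) &
    forall x, `|x| <= L -> `|f x - q x| <= e].
Proof.
move=> fc fK e0.
have K0 : 0 <= K by apply: le_trans (fK 0).
have [r r0 fu] : exists2 r : R, 0 < r & forall x y, `|x| <= L ->
    `|x - y| < r -> `|f x - f y| < e / 2.
  by apply: (compact_unif_continuous fc (compact_closed_ball (L := L))); rewrite divr_gt0.
pose L1 := 1 + `|L| ^+ 3.
have L10 : 0 < L1 by rewrite ltr_pwDl // exprn_ge0.
(* the scale at which [sin (b * v) / b] is within [r / 3] of [v] on the ball *)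
pose b := Num.min 1 (r / (3 * L1)).
have b0 : 0 < b by rewrite lt_min ltr01 divr_gt0 // mulr_gt0.
have b1 : b <= 1 by rewrite ge_min lexx.
have bL : b * L1 <= r / 3.
  have : b <= r / (3 * L1) by rewrite ge_min lexx orbT.
  move=> /(ler_wpM2r (ltW L10)) /le_trans; apply.
  by rewrite le_eqVlt; apply/orP; left; apply/eqP; field; rewrite gt_eqF.
(* Chebyshev: [A * (y - t) ^+ 2] dominates [2 * K] when a coordinate is off by
   [dl] *)
pose dl := b * (r / 3).
have dl0 : 0 < dl by rewrite mulr_gt0 // divr_gt0.
pose A := 2 * K / dl ^+ 2.
have A0 : 0 <= A by rewrite mulr_ge0 ?invr_ge0 ?sqr_ge0 // mulr_ge0.
pose N := (Num.truncn (A * d%:R / (e / 2))).+1.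
have N0 : 0 < N%:R :> R by rewrite ltr0n.
have AN : A * d%:R / N%:R <= e / 2.
  have e20 : 0 < e / 2 by rewrite divr_gt0.
  by rewrite ler_pdivrMr // [leRHS]mulrC -ler_pdivrMr // ltW // truncnS_gt.
(* [N] steps along each coordinate *)
pose ks := flatten [seq nseq N k | k <- enum 'I_d].
have cks l : count_mem l ks = N.
  rewrite count_flatten -map_comp sumnE big_map big_enum /= (bigD1 l) //=.
  rewrite count_nseq /= eqxx mul1n big1 ?addn0 // => k kl.
  by rewrite count_nseq /= (negbTE kl) mul0n.
pose phi y := f (b^-1 *: y).
pose q x := walk (fun k => sin (b * x 0 k)) N%:R^-1 ks phi 0.
have s1 x k : `|sin (b * x 0 k)| <= 1 by exact: sin_max.
exists q; split; first exact: walk_trigpoly.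
  move=> x; rewrite ler_norml; apply/andP; split.
    rewrite -(walk_cst (fun k => sin (b * x 0 k)) N%:R^-1 ks (- K) 0).
    by apply: walk_le => [k|y]; [exact: s1|have := fK (b^-1 *: y); rewrite ler_norml => /andP[]].
  rewrite -[leRHS](walk_cst (fun k => sin (b * x 0 k)) N%:R^-1 ks K 0).
  by apply: walk_le => [k|y]; [exact: s1|have := fK (b^-1 *: y); rewrite ler_norml => /andP[]].
move=> x xL; set t := fun k => sin (b * x 0 k).
have pt y : `|f x - phi y| <= e / 2 + A * \sum_(l < d) (y 0 l - t l) ^+ 2.
  have S0 : 0 <= \sum_(l < d) (y 0 l - t l) ^+ 2 by apply: sumr_ge0 => l _; exact: sqr_ge0.
  have [/forallP near|/forallPn[l]] := boolP [forall l, `|y 0 l - t l| < dl].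
    apply: (@le_trans _ _ (e / 2)); last by rewrite lerDl mulr_ge0.
    apply: ltW; apply: fu => //.
    apply: (@le_lt_trans _ _ (r / 3 + r / 3)); last by lra.
    apply: norm_le_coord; first by lra.
    move=> l; rewrite !mxE.
    have -> : x 0 l - b^-1 * y 0 l =
        b^-1 * - (y 0 l - t l) - b^-1 * (sin (b * x 0 l) - b * x 0 l).
      by rewrite /t; field; rewrite gt_eqF.
    apply: le_trans (ler_normB _ _) _; rewrite !normrM normrN.
    rewrite gtr0_norm ?invr_gt0 //; apply: lerD.
      by rewrite ler_pdivrMl // ltW.
    rewrite ler_pdivrMl //; apply: le_trans (sinB_le3 _) _.
    rewrite normrM exprMn (gtr0_norm b0) exprS -mulrA ler_wpM2l ?(ltW b0) //.
    apply: le_trans bL; rewrite expr2 -mulrA ler_wpM2l ?(ltW b0) //.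
    rewrite -[L1]mul1r; apply: ler_pM => //; first by rewrite ltW.
    rewrite /L1 -[leLHS]add0r lerD // lerXn2r ?nnegrE //.
    by apply: le_trans (coord_le_norm _ _) _; apply: le_trans xL (ler_norm _).
  rewrite -leNgt => dlS.
  apply: (@le_trans _ _ (2 * K)).
    apply: le_trans (ler_normB _ _) _.
    by rewrite mulr_natl mulr2n lerD // fK.
  have : dl ^+ 2 <= \sum_(l < d) (y 0 l - t l) ^+ 2.
    rewrite (bigD1 l) //= -[leLHS]addr0 lerD //.
      rewrite -[leRHS](real_normK (num_real _)) lerXn2r ?nnegrE // ltW //.
    by apply: sumr_ge0 => k _; exact: sqr_ge0.
  move=> /(ler_wpM2l A0); rewrite /A divfK ?expf_neq0 ?gt_eqF //.
  by move=> /le_trans; apply; rewrite lerDr divr_ge0 // ltW.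
have var : walk t N%:R^-1 ks (fun y => e / 2 + A * \sum_(l < d) (y 0 l - t l) ^+ 2) 0 <= e.
  rewrite walkD walk_cst walkZ walk_sum.
  suff : A * (\sum_(l < d) walk t N%:R^-1 ks (fun y => (y 0 l - t l) ^+ 2) 0) <= A * d%:R / N%:R.
    by move: AN; lra.
  rewrite -mulrA ler_wpM2l // (_ : d%:R / N%:R = \sum_(l < d) N%:R^-1); last first.
    by rewrite sumr_const card_ord mulr_natl.
  apply: ler_sum => l _; rewrite walk_sqr cks !mxE.
  have -> : 0 + N%:R * (N%:R^-1 * t l) - t l = 0.
    by field; rewrite gt_eqF.
  rewrite expr0n /= addr0 expr2 -mulrA mulVKf ?gt_eqF //.
  by rewrite ler_piMr ?gerBl ?sqr_ge0 // invr_ge0 ltW.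
apply: le_trans var; rewrite ler_norml; apply/andP; split.
  rewrite lerNl opprB lerBlDl -[X in _ <= X + _](walk_cst t N%:R^-1 ks (f x) 0) -walkD.
  by apply: walk_le => [k|y]; [exact: s1|have := pt y; rewrite ler_norml; lra].
rewrite lerBlDl -walkD.
rewrite -[leLHS](walk_cst t N%:R^-1 ks (f x) 0).
by apply: walk_le => [k|y]; [exact: s1|have := pt y; rewrite ler_norml; lra].
Qed.

End TrigPolynomials.

(** * Quadratic forms and concave functions *)

Section QuadraticForms.
Context {R : realType} {d : nat}.
Implicit Types (x y a b : 'rV[R]_d) (A V : 'M[R]_d).

Definition quad A x : R := (x *m A *m x^T) 0 0.

Definition psd A := A^T = A /\ forall v, 0 <= quad A v.

Lemma posdef_psd A : posdefmx A -> psd A.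
Proof.
move=> [sA pA]; split=> // v; have [->|v0] := eqVneq v 0; last exact/ltW/pA.
by rewrite /quad !mul0mx mxE.
Qed.

Lemma quadE A x : quad A x = dot (x *m A) x. Proof. by []. Qed.

Lemma dot_mul_sym A x y : A^T = A -> dot (x *m A) y = dot (y *m A) x.
Proof.
by move=> sA; rewrite [RHS]dotC /dot trmx_mul sA mulmxA.
Qed.

Lemma quadD A x y : A^T = A ->
  quad A (x + y) = quad A x + 2 * dot (x *m A) y + quad A y.
Proof.
move=> sA; rewrite !quadE mulmxDl dotDl !dotDr (dot_mul_sym y x sA); ring.
Qed.

Lemma quadZ A c x : quad A (c *: x) = c ^+ 2 * quad A x.
Proof. by rewrite !quadE -scalemxAl dotZl dotZr mulrA expr2. Qed.

Lemma quadN A x : quad A (- x) = quad A x.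
Proof. by rewrite -scaleN1r quadZ sqrrN expr1n mul1r. Qed.

Lemma quadNmx A x : quad (- A) x = - quad A x.
Proof. by rewrite /quad mulmxN mulNmx mxE. Qed.

Lemma quad_entries A x : quad A x = \sum_i \sum_j x 0 i * x 0 j * A i j.
Proof.
rewrite quadE dotE exchange_big /=; apply: eq_bigr => j _.
rewrite mxE mulr_suml; apply: eq_bigr => i _; ring.
Qed.

Lemma quad_delta A k : quad A (delta_mx 0 k) = A k k.
Proof. by rewrite quadE dotC dot_delta -rowE mxE. Qed.

Lemma psd_cauchy_schwarz A x y : psd A ->
  dot (x *m A) y ^+ 2 <= quad A x * quad A y.
Proof.
move=> [sA pA]; set b := dot _ _.
have q t : 0 <= quad A x + 2 * (t * b) + t ^+ 2 * quad A y.
  by rewrite -quadZ -dotZr -quadD.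
have [y0|y0] := eqVneq (quad A y) 0.
  rewrite y0 mulr0; have [->|b0] := eqVneq b 0; first by rewrite expr0n.
  have := q (- ((quad A x + 1) / (2 * b))); rewrite y0 mulr0 addr0.
  have -> : 2 * (- ((quad A x + 1) / (2 * b)) * b) = - (quad A x + 1) by field.
  lra.
have yp : 0 < quad A y by rewrite lt_def y0 pA.
have := q (- (b / quad A y)).
have -> : quad A x + 2 * (- (b / quad A y) * b) + (- (b / quad A y)) ^+ 2 * quad A y
  = quad A x - b ^+ 2 / quad A y by field.
by rewrite subr_ge0 ler_pdivrMr.
Qed.

Lemma posdef_unit A : posdefmx A -> A \in unitmx.
Proof.
move=> [_ pA]; rewrite -row_free_unit -kermx_eq0; apply: contraT => /rowV0Pn[v].
move=> /sub_kermxP vA v0; have := pA _ v0.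
by rewrite vA mul0mx mxE ltxx.
Qed.

(** By the Cauchy-Schwarz inequality every coordinate of [x *m A] is at most
    the square root of [quad A x] times the trace of [A]; multiplying by the
    inverse matrix bounds [x].  This avoids a compactness argument on the
    sphere. *)
Lemma posdef_coercive A : posdefmx A ->
  exists2 c : R, 0 < c & forall x, c * `|x| ^+ 2 <= quad A x.
Proof.
move=> pA; have uA := posdef_unit pA; have sA := posdef_psd pA.
pose C := \sum_i \sum_j `|invmx A i j|.
pose t := \sum_i A i i.
have Aii i : 0 <= A i i.
  by have := sA.2 (delta_mx 0 i); rewrite quad_delta.
have t0 : 0 <= t by apply: sumr_ge0.
have C0 : 0 <= C by apply: sumr_ge0 => i _; apply: sumr_ge0.
have D0 : 0 < C ^+ 2 * t + 1 by rewrite ltr_wpDl // mulr_ge0 ?sqr_ge0.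
exists (C ^+ 2 * t + 1)^-1; first by rewrite invr_gt0.
move=> x; rewrite ler_pdivrMl //.
have q0 := sA.2 x.
pose y := x *m A.
have yl l : `|y 0 l| <= Num.sqrt (quad A x * t).
  rewrite -(sqrtr_sqr (y 0 l)) ler_sqrt; last by rewrite mulr_ge0.
  have := psd_cauchy_schwarz x (delta_mx 0 l) sA.
  rewrite dotC dot_delta => /le_trans; apply.
  rewrite ler_wpM2l // quad_delta /t (bigD1 l) //= lerDl.
  exact: sumr_ge0.
have xn : `|x| <= C * Num.sqrt (quad A x * t).
  apply: norm_le_coord; first by rewrite mulr_ge0 // sqrtr_ge0.
  move=> k; have -> : x 0 k = (y *m invmx A) 0 k by rewrite mulmxK.
  rewrite mxE.
  apply: le_trans (ler_norm_sum _ _ _) _; rewrite /C mulr_suml.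
  apply: ler_sum => l _; rewrite normrM mulrC ler_pM //.
  by rewrite (bigD1 k) //= lerDl; apply: sumr_ge0.
apply: (@le_trans _ _ ((C * Num.sqrt (quad A x * t)) ^+ 2)).
  by rewrite lerXn2r // nnegrE // mulr_ge0 // sqrtr_ge0.
rewrite exprMn sqr_sqrtr ?mulr_ge0 //; nra.
Qed.

(** Symmetric Gaussian elimination.  Subtracting the rank-one matrix of a row
    with positive pivot clears that row and leaves a positive semidefinite
    matrix, by the Cauchy-Schwarz inequality; a row with zero pivot vanishes. *)
Lemma psd_sum_outer V : psd V ->
  exists bs : seq 'rV[R]_d, forall a, quad V a = \sum_(b <- bs) dot a b ^+ 2.
Proof.
suff gen (ks : seq 'I_d) A : psd A -> (forall i, i \notin ks -> row i A = 0) ->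
    exists bs : seq 'rV[R]_d, forall a, quad A a = \sum_(b <- bs) dot a b ^+ 2.
  by move=> pV; apply: (gen (enum 'I_d) V pV) => i; rewrite mem_enum.
elim: ks A => [|k ks IH] A pA A0.
  exists [::] => a; rewrite big_nil.
  have -> : A = 0 by apply/row_matrixP => i; rewrite A0 // row0.
  by rewrite /quad mulmx0 mul0mx mxE.
have rk x : dot (x *m A) (delta_mx 0 k) = dot x (row k A).
  by rewrite (dot_mul_sym _ _ pA.1) dotC -rowE.
have [Ak|Ak] := eqVneq (A k k) 0.
  apply: IH => // i iks; have [->|ik] := eqVneq i k; last first.
    by apply: A0; rewrite inE negb_or ik.
  apply/rowP => j; rewrite !mxE.
  have := psd_cauchy_schwarz (delta_mx 0 j) (delta_mx 0 k) pA.
  rewrite (quad_delta A k) Ak mulr0 rk dot_delta mxE => h.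
  by apply/eqP; rewrite -sqrf_eq0 eq_le h sqr_ge0.
have Akp : 0 < A k k.
  by rewrite lt_def Ak; have := pA.2 (delta_mx 0 k); rewrite quad_delta.
pose A' := A - (A k k)^-1 *: ((row k A)^T *m row k A).
have qA' x : quad A' x = quad A x - dot x (row k A) ^+ 2 / A k k.
  rewrite !quadE mulmxBr dotBl -scalemxAr dotZl mulmxA.
  rewrite [x *m (row k A)^T]mx11_scalar mul_scalar_mx dotZl -/(dot x (row k A)).
  by rewrite [dot (row k A) x]dotC mulrC expr2.
have pA' : psd A'.
  split.
    by rewrite /A' linearB /= linearZ /= trmx_mul trmxK pA.1.
  move=> x; rewrite qA' subr_ge0 ler_pdivrMr //.
  have := psd_cauchy_schwarz x (delta_mx 0 k) pA; rewrite rk.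
  by rewrite quad_delta.
have [|bs bsE] := IH A' pA'.
  move=> i iks; apply/rowP => j; rewrite !mxE big_ord1 !mxE.
  have [->|ik] := eqVneq i k; first by field.
  have Ai j' : A i j' = 0.
    have iks' : i \notin k :: ks by rewrite inE negb_or ik.
    by have := congr1 (fun r : 'rV_d => r 0 j') (A0 i iks'); rewrite !mxE.
  have Aki : A k i = 0 by rewrite -pA.1 mxE Ai.
  by rewrite Ai Aki; ring.
exists ((Num.sqrt (A k k))^-1 *: row k A :: bs) => a.
rewrite big_cons -bsE qA' dotZr exprMn exprVn sqr_sqrtr ?ltW //; ring.
Qed.

End QuadraticForms.

Section ConcaveArgmax.
Context {R : realType} {d : nat}.
Implicit Types (x y t : 'rV[R]_d) (F : 'rV[R]_d -> R).

Lemma concaveP F : concave F -> forall x y (l : R), 0 <= l <= 1 ->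
  l * F x + (1 - l) * F y <= F (l *: x + (1 - l) *: y).
Proof.
move=> cF x y l /andP[l0 l1].
pose i := Itv01 l0 l1.
have := cF i x y; rewrite !inE => /(_ I I).
rewrite /conv /= /conv /= => H.
rewrite -lerN2; apply: le_trans H _.
rewrite /unstable.onem /GRing.scale /=; lra.
Qed.

(** Convexity argument for maximum estimators.  A function that is uniformly
    within [eta] of a concave quadratic on a ball is smaller on the sphere of
    radius [eps] around the vertex of the quadratic than at the vertex; by
    concavity it stays smaller outside of that sphere, so that every maximizer
    lies inside, including those outside of the ball where the approximation
    says nothing. *)
Lemma concave_argmax_near F (Theta : set 'rV[R]_d) (theta0 g tt : 'rV[R]_d)
    (H : 'M[R]_d) (c eta r eps : R) :
  (forall x y (l : R), 0 <= l <= 1 ->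
     l * F x + (1 - l) * F y <= F (l *: x + (1 - l) *: y)) ->
  (forall t, `|t - theta0| <= r -> Theta t) ->
  (forall t, `|t - theta0| <= r ->
     `|F t - F theta0 - dot g (t - theta0) - quad H (t - theta0) / 2| <= eta) ->
  H^T = H -> H \in unitmx ->
  (forall x, quad H x <= - (c * `|x| ^+ 2)) ->
  0 < eps -> `|g *m invmx H| + eps <= r -> 2 * eta < c * eps ^+ 2 / 2 ->
  is_argmax Theta F tt ->
  `|tt - (theta0 - g *m invmx H)| <= eps.
Proof.
move=> cF ball tay sH uH cH e0 ger eta_lt [_ ttmax].
pose x := - (g *m invmx H); pose ts := theta0 + x; rewrite -/x -/ts.
have xn : `|x| = `|g *m invmx H| by rewrite normrN.
rewrite leNgt; apply/negP => far.
have D0 : 0 < `|tt - ts| by apply: lt_trans far.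
pose l := eps / `|tt - ts|.
have l01 : 0 <= l <= 1.
  by rewrite divr_ge0 ?(ltW e0) //= ler_pdivrMr // mul1r ltW.
pose y := l *: (tt - ts).
have yn : `|y| = eps.
  rewrite normrZ ger0_norm; last by case/andP: l01.
  by rewrite divfK // gt_eqF.
have tsE : ts - theta0 = x by rewrite /ts addrAC subrr add0r.
(* the point at distance [eps] from the vertex [ts] on the way to [tt] *)
have tE : l *: tt + (1 - l) *: ts = theta0 + (x + y).
  have gen (v : 'rV[R]_d) : l *: tt + (1 - l) *: v = v + l *: (tt - v).
    by rewrite scalerBr scalerBl scale1r addrCA.
  by rewrite gen addrA.
have Bts : `|ts - theta0| <= r by rewrite tsE xn; lra.
have Bt : `|theta0 + (x + y) - theta0| <= r.
  rewrite addrAC subrr add0r; apply: le_trans (ler_normD _ _) _.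
  by rewrite xn yn.
have Fts : F ts <= F tt by apply: ttmax; exact: ball.
have := cF tt ts l l01; rewrite tE.
have := tay _ Bt; have := tay _ Bts.
rewrite tsE [theta0 + (x + y) - _]addrAC subrr add0r.
rewrite quadD // dotDr.
have -> : x *m H = - g by rewrite /x mulNmx mulmxKV.
have -> : dot (- g) y = - dot g y by rewrite -scaleN1r dotZl mulN1r.
have := cH y; rewrite yn.
have : F ts <= l * F tt + (1 - l) * F ts.
  by case/andP: l01 => l0 l1; nra.
clear sH uH; rewrite !ler_norml => ? ? /andP[? ?] /andP[? ?] ?; lra.
Qed.

End ConcaveArgmax.

(** * Expectations, probabilities and independence *)

Section Expectation.
Context {dT : measure_display} {T : measurableType dT} {R : realType}.
Variable P : probability T R.
Implicit Types (f g h : T -> R) (A : set T).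

(** Real-valued integrability, mean and probability; the lemmas on means carry
    the prefix [ER]. *)
Definition integ f := P.-integrable [set: T] (EFin \o f).

Definition pr A : R := fine (P A).

Lemma prE A : measurable A -> (pr A)%:E = P A.
Proof. by move=> mA; rewrite /pr fineK // fin_num_measure. Qed.

Lemma pr_le A B : measurable A -> measurable B -> A `<=` B -> pr A <= pr B.
Proof. by move=> mA mB AB; rewrite -lee_fin !prE // le_measure // inE. Qed.

Lemma pr_leU A B : measurable A -> measurable B -> pr (A `|` B) <= pr A + pr B.
Proof.
move=> mA mB; rewrite -lee_fin EFinD !prE //; last exact: measurableU.
exact: measureU2.
Qed.

Lemma integ_bounded f (K : R) : measurable_fun [set: T] f ->
  (forall w, `|f w| <= K) -> integ f.
Proof.
move=> mf fK; apply: measurable_bounded_integrable => //.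
  by rewrite (le_lt_trans (probability_le1 P _)) // ltry.
exists K; split; rewrite ?num_real // => M KM w _ /=.
exact: le_trans (fK w) (ltW KM).
Qed.

Lemma integ_meas f : integ f -> measurable_fun [set: T] f.
Proof. by move=> /measurable_int /measurable_EFinP. Qed.

Lemma integ_cst c : integ (fun=> c).
Proof. by apply: (@integ_bounded _ `|c|). Qed.

Lemma integD f g : integ f -> integ g -> integ (fun w => f w + g w).
Proof. by move=> F G; have := integrableD measurableT F G; apply: eq_integrable. Qed.

Lemma integB f g : integ f -> integ g -> integ (fun w => f w - g w).
Proof. by move=> F G; have := integrableB measurableT F G; apply: eq_integrable. Qed.

Lemma integZ c f : integ f -> integ (fun w => c * f w).
Proof. by move=> F; have := integrableZl measurableT c F; apply: eq_integrable. Qed.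

Lemma integ_norm f : integ f -> integ (fun w => `|f w|).
Proof. by move=> F; have := integrable_norm F; apply: eq_integrable. Qed.

Lemma integ_sum (I : Type) (r : seq I) (f : I -> T -> R) :
  (forall i, integ (f i)) -> integ (fun w => \sum_(i <- r) f i w).
Proof.
move=> F; elim: r => [|i r IH].
  by under eq_fun do rewrite big_nil; exact: integ_cst.
by under eq_fun do rewrite big_cons; exact: integD.
Qed.

Lemma integ_dom f g : measurable_fun [set: T] f -> integ g ->
  (forall w, `|f w| <= g w) -> integ f.
Proof.
move=> mf ig fg; apply: (le_integrable _ _ _ ig) => //.
  exact/measurable_EFinP.
move=> w _ /=; rewrite lee_fin; apply: le_trans (fg w) _; exact: ler_norm.
Qed.

Lemma EFin_Rintegral f : integ f ->
  (\int[P]_w f w)%:E = (\int[P]_w (f w)%:E)%E.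
Proof. by move=> F; rewrite /Rintegral fineK //; exact: integrable_fin_num. Qed.

Lemma ERD f g : integ f -> integ g ->
  \int[P]_w (f w + g w) = \int[P]_w f w + \int[P]_w g w.
Proof. by move=> F G; rewrite RintegralD. Qed.

Lemma ERB f g : integ f -> integ g ->
  \int[P]_w (f w - g w) = \int[P]_w f w - \int[P]_w g w.
Proof. by move=> F G; rewrite RintegralB. Qed.

Lemma ERZ c f : integ f -> \int[P]_w (c * f w) = c * \int[P]_w f w.
Proof. by move=> F; rewrite RintegralZl. Qed.

Lemma ERcst c : \int[P]_(_ in [set: T]) c = c.
Proof.
have h : fine (P [set: T]) = 1 by have -> : P [set: T] = 1%E by exact: probability_setT.
by rewrite Rintegral_cst // -[RHS]mulr1; congr (_ * _).
Qed.

Lemma ERsum (I : Type) (r : seq I) (f : I -> T -> R) :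
  (forall i, integ (f i)) ->
  \int[P]_w (\sum_(i <- r) f i w) = \sum_(i <- r) \int[P]_w f i w.
Proof.
move=> F; elim: r => [|i r IH].
  by under eq_Rintegral do rewrite big_nil; rewrite big_nil ERcst.
under eq_Rintegral do rewrite big_cons.
by rewrite big_cons -IH ERD //; exact: integ_sum.
Qed.

Lemma ERle f g : integ f -> integ g -> (forall w, f w <= g w) ->
  \int[P]_w f w <= \int[P]_w g w.
Proof. by move=> F G fg; apply: le_Rintegral. Qed.

Lemma ERnorm_le f g : integ f -> integ g -> (forall w, `|f w| <= g w) ->
  `|\int[P]_w f w| <= \int[P]_w g w.
Proof.
move=> F G fg; apply: le_trans (le_normr_Rintegral _ _) _ => //.
by apply: ERle => //; exact: integ_norm.
Qed.

Lemma ERge0 f : (forall w, 0 <= f w) -> 0 <= \int[P]_w f w.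
Proof. by move=> f0; apply: Rintegral_ge0. Qed.

Lemma integ_indic A : measurable A -> integ (\1_A : T -> R).
Proof.
move=> mA; apply: (@integ_bounded _ 1); first exact: measurable_indic.
by move=> w; rewrite indicE; case: (w \in A); rewrite ?normr1 ?normr0 ?ler01.
Qed.

Lemma ERindic A : measurable A -> \int[P]_w (\1_A w : R) = pr A.
Proof.
by move=> mA; rewrite /Rintegral integral_indic // setIT.
Qed.

Lemma ERsmall h A (e C : R) : measurable_fun [set: T] h -> measurable A ->
  (forall w, `|h w| <= C) -> (forall w, ~ A w -> `|h w| <= e) -> 0 <= e ->
  `|\int[P]_w h w| <= e + C * pr A.
Proof.
move=> mh mA hC he e0.
rewrite -(ERindic mA) -ERZ; last exact: integ_indic.
rewrite -(ERcst e) -ERD; [|exact: integ_cst|exact/integZ/integ_indic].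
apply: ERnorm_le; first exact: (integ_bounded mh hC).
  by apply: integD; [exact: integ_cst|exact/integZ/integ_indic].
move=> w; rewrite indicE; have [wA|/negP wA] := boolP (w \in A).
  by rewrite mulr1 (le_trans (hC w)) // lerDr.
by rewrite mulr0 addr0 he // => Aw; apply: wA; rewrite inE.
Qed.

Lemma pr_markov h A (c : R) : integ h -> measurable A -> (forall w, 0 <= h w) ->
  0 < c -> (forall w, A w -> c <= h w) -> pr A <= c^-1 * \int[P]_w h w.
Proof.
move=> ih mA h0 c0 Ah; rewrite ler_pdivlMl //.
rewrite -(ERindic mA) -ERZ; last exact: integ_indic.
apply: ERle => //; first exact/integZ/integ_indic.
move=> w; rewrite indicE; have [|_] := boolP (w \in A); last by rewrite mulr0.
by rewrite inE mulr1 => /Ah.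
Qed.

Lemma pr_bigcup_ord n (A : 'I_n -> set T) : (forall i, measurable (A i)) ->
  pr [set w | exists i, A i w] <= \sum_(i < n) pr (A i).
Proof.
elim: n A => [|n IH] A mA.
  rewrite big_ord0 (_ : [set _ | _] = set0) ?/pr ?measure0 //.
  by apply/seteqP; split => // w [[]].
have -> : [set w | exists i, A i w] =
    A ord0 `|` [set w | exists i, A (lift ord0 i) w].
  apply/seteqP; split => w /=.
    move=> [i]; case: (unliftP ord0 i) => [j ->|->]; last by left.
    by right; exists j.
  by move=> [?|[j ?]]; [exists ord0|exists (lift ord0 j)].
rewrite big_ord_recl; apply: le_trans (pr_leU _ _) _ => //.
  have -> : [set w | exists i, A (lift ord0 i) w] =
      \bigcup_(i in [set: 'I_n]) A (lift ord0 i).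
    by apply/seteqP; split => w /= [i]; [exists i|move=> _; exists i].
  by apply: fin_bigcup_measurable => //; exact: finite_finset.
by rewrite lerD2l; apply: IH.
Qed.

Lemma ER_dominated (h : nat -> T -> R) (f g : T -> R) :
  (forall n, measurable_fun [set: T] (h n)) ->
  (forall w, h n w @[n --> \oo] --> f w) -> integ g ->
  (forall n w, `|h n w| <= g w) ->
  \int[P]_w h n w @[n --> \oo] --> \int[P]_w f w.
Proof.
move=> mh hf ig hg.
have mf : measurable_fun [set: T] f.
  by apply: (measurable_fun_cvg mh) => w _; exact: hf.
have fg w : `|f w| <= g w.
  have c : `|h n w| @[n --> \oo] --> `|f w| by apply: cvg_norm; exact: hf.
  rewrite -(cvg_lim (@Rhausdorff R) c); apply: limr_le.
    by apply/cvg_ex; eexists; exact: c.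
  by near=> n; exact: hg.
have iF : integ f by exact: integ_dom fg.
have := @dominated_cvg _ _ _ P _ measurableT (fun n => EFin \o h n) (EFin \o f)
  (EFin \o g) _ _ _ ig _.
rewrite -(EFin_Rintegral iF) => H; apply: (@fine_cvg _ _ _ _ _ _ (H _ _ _ _)).
- by move=> n; exact/measurable_EFinP.
- move=> w _; apply: cvg_EFin; first by near=> n.
  exact: hf.
- by [].
- by move=> n w _ /=; rewrite lee_fin; exact: hg.
Unshelve. all: by end_near. Qed.

End Expectation.

Section MeasurableComparison.
Context {d : measure_display} {T : measurableType d} {R : realType}.
Variables f g : T -> R.
Hypotheses (mf : measurable_fun [set: T] f) (mg : measurable_fun [set: T] g).

Lemma measurable_set_lt : measurable [set w | f w < g w].
Proof.
have -> : [set w | f w < g w] = (fun w => g w - f w) @^-1` `]0, +oo[%classic.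
  by apply/seteqP; split => w /=; rewrite in_itv /= andbT subr_gt0.
by rewrite -[X in measurable X]setTI; exact: (measurable_funB mg mf).
Qed.

Lemma measurable_set_le : measurable [set w | f w <= g w].
Proof.
have -> : [set w | f w <= g w] = (fun w => g w - f w) @^-1` `[0, +oo[%classic.
  by apply/seteqP; split => w /=; rewrite in_itv /= andbT subr_ge0.
by rewrite -[X in measurable X]setTI; exact: (measurable_funB mg mf).
Qed.

End MeasurableComparison.

Lemma measurable_invr (R : realType) : measurable_fun [set: R] (@GRing.inv R).
Proof.
pose h (n : nat) (x : R) := x * (x ^+ 2 + n.+1%:R^-1)^-1.
have den n (x : R) : 0 < x ^+ 2 + n.+1%:R^-1 by rewrite ltr_wpDl ?sqr_ge0 // invr_gt0.
apply: (@measurable_fun_cvg _ _ _ _ h).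
  move=> n; apply: continuous_measurable_fun => x.
  apply: cvgM; first exact: cvg_id.
  apply: cvgV; first by rewrite gt_eqF.
  by apply: cvgD; [exact: sqr_continuous|exact: cvg_cst].
move=> x _; have [->|x0] := eqVneq x 0.
  rewrite invr0 (_ : (fun n => h n 0) = fun=> 0); first exact: cvg_cst.
  by apply/funext => n; rewrite /h mul0r.
have -> : x^-1 = x * (x ^+ 2 + 0)^-1 by rewrite addr0; field.
apply: cvgM; first exact: cvg_cst.
apply: cvgV; first by rewrite addr0 expf_neq0.
by apply: cvgD; [exact: cvg_cst|exact: cvg_harmonic].
Qed.

Lemma measurable_bigmaxr (d : measure_display) (T : measurableType d)
    (R : realType) (I : Type) (r : seq I) (f : I -> T -> R) :
  (forall i, measurable_fun [set: T] (f i)) ->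
  measurable_fun [set: T] (fun w => \big[Num.max/0]_(i <- r) f i w).
Proof.
move=> mf; elim: r => [|i r IH].
  by rewrite (_ : (fun w => _) = fun=> 0) //; apply/funext => w; rewrite big_nil.
rewrite (_ : (fun w => _) = fun w => Num.max (f i w) (\big[Num.max/0]_(i <- r) f i w)).
  exact: (measurable_maxr (mf i) IH).
by apply/funext => w; rewrite big_cons.
Qed.

Section Independence.
Context {dT : measure_display} {T : measurableType dT} {R : realType}.
Variable P : probability T R.

Definition indep2 (d1 d2 : measure_display) (C1 : measurableType d1)
    (C2 : measurableType d2) (X : T -> C1) (Y : T -> C2) : Prop :=
  forall A B, measurable A -> measurable B ->
    P (X @^-1` A `&` Y @^-1` B) = (P (X @^-1` A) * P (Y @^-1` B))%E.

Lemma indep2_comp (d1 d2 e1 e2 : measure_display) (C1 : measurableType d1)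
    (C2 : measurableType d2) (D1 : measurableType e1) (D2 : measurableType e2)
    (X : T -> C1) (Y : T -> C2) (f : C1 -> D1) (g : C2 -> D2) :
  measurable_fun [set: C1] f -> measurable_fun [set: C2] g ->
  indep2 X Y -> indep2 (f \o X) (g \o Y).
Proof.
move=> mf mg XY A B mA mB; apply: (XY (f @^-1` A) (g @^-1` B)).
  by rewrite -[X in measurable X]setTI; exact: mf.
by rewrite -[X in measurable X]setTI; exact: mg.
Qed.

Section Freezing.
Context {d1 d2 : measure_display} {C1 : measurableType d1}
  {C2 : measurableType d2}.
Variables (X : T -> C1) (Y : T -> C2).
Hypotheses (mX : measurable_fun [set: T] X) (mY : measurable_fun [set: T] Y).
Hypothesis XY : indep2 X Y.

(** Integration of one of two independent variables with the other one held
    fixed; this plays the role of a conditional expectation. *)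
Lemma freeze_ge0 (Phi : C1 * C2 -> \bar R) :
  measurable_fun [set: C1 * C2] Phi -> (forall z, 0 <= Phi z)%E ->
  (\int[P]_w Phi (X w, Y w) = \int[P]_w \int[P]_v Phi (X w, Y v))%E.
Proof.
move=> mPhi Phi0.
pose X' : {mfun T >-> C1} := mfun_Sub (mem_set mX).
pose Y' : {mfun T >-> C2} := mfun_Sub (mem_set mY).
have mXY : measurable_fun [set: T] (fun w => (X w, Y w)).
  exact: measurable_fun_pair.
pose XY' : {mfun T >-> (C1 * C2)%type} := mfun_Sub (mem_set mXY).
have law A : measurable A ->
    (distribution P X' \x distribution P Y')%E A = distribution P XY' A.
  by apply: product_measure_unique => A1 A2 mA1 mA2; exact: XY.
transitivity (\int[distribution P XY']_z Phi z)%E.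
  by rewrite ge0_integral_distribution.
transitivity (\int[(distribution P X' \x distribution P Y')%E]_z Phi z)%E.
  by apply: eq_measure_integral => A mA _; apply: esym; exact: law.
rewrite fubini_tonelli1 // ge0_integral_distribution.
- apply: eq_integral => w _; rewrite /= /fubini_F ge0_integral_distribution //.
  by apply: measurableT_comp => //; exact: measurable_pair1.
- exact: measurable_fun_fubini_tonelli_F.
- by move=> y; apply: integral_ge0.
Qed.

Lemma freeze_bounded (Phi : C1 * C2 -> R) (K : R) :
  measurable_fun [set: C1 * C2] Phi -> (forall z, `|Phi z| <= K) ->
  measurable_fun [set: T] (fun w => \int[P]_v Phi (X w, Y v)) /\
  \int[P]_w Phi (X w, Y w) = \int[P]_w \int[P]_v Phi (X w, Y v).
Proof.
move=> mPhi PhiK.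
have mPXY : measurable_fun [set: T] (fun w => Phi (X w, Y w)).
  by apply: (measurableT_comp mPhi); exact: measurable_fun_pair.
have mPw w : measurable_fun [set: T] (fun v => Phi (X w, Y v)).
  by apply: (measurableT_comp mPhi); exact: measurable_fun_pair.
have iPw w : integ P (fun v => Phi (X w, Y v)).
  by apply: (@integ_bounded _ _ _ P _ K).
have K0 w : 0 <= K + Phi (X w, Y w).
  by have := PhiK (X w, Y w); rewrite ler_norml; lra.
pose Psi z := (K + Phi z)%:E.
have mPsi : measurable_fun [set: C1 * C2] Psi.
  by apply/measurable_EFinP; exact: measurable_funD.
have Psi0 z : (0 <= Psi z)%E.
  by rewrite lee_fin; have := PhiK z; rewrite ler_norml; lra.
have inner w : (\int[P]_v Psi (X w, Y v) = (K + \int[P]_v Phi (X w, Y v))%:E)%E.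
  rewrite -[in RHS](ERcst P K) -ERD //; last exact: integ_cst.
  by rewrite EFin_Rintegral //; apply: integD => //; exact: integ_cst.
have mI : measurable_fun [set: T] (fun w => \int[P]_v Phi (X w, Y v)).
  pose Y' : {mfun T >-> C2} := mfun_Sub (mem_set mY).
  have mF := measurable_fun_fubini_tonelli_F (m2 := distribution P Y') Psi mPsi Psi0.
  have mG : measurable_fun [set: T] (fun w => (K + \int[P]_v Phi (X w, Y v))%:E).
    have := measurableT_comp mF mX; apply: eq_measurable_fun => w _ /=.
    rewrite /fubini_F ge0_integral_distribution //; first exact: inner.
    by apply: measurableT_comp => //; exact: measurable_pair1.
  move/measurable_EFinP : mG => mG.
  have -> : (fun w => \int[P]_v Phi (X w, Y v)) =
     (fun w => (K + \int[P]_v Phi (X w, Y v)) - K).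
    by apply/funext => w; rewrite addrC addKr.
  exact: measurable_funB.
split=> //.
have iI : integ P (fun w => \int[P]_v Phi (X w, Y v)).
  apply: (@integ_bounded _ _ _ P _ K) => // w.
  rewrite -[leRHS](ERcst P K); apply: ERnorm_le => //; exact: integ_cst.
have iP : integ P (fun w => Phi (X w, Y w)) by exact: (@integ_bounded _ _ _ P _ K).
have := freeze_ge0 mPsi Psi0.
under [RHS]eq_integral do rewrite inner.
rewrite -!EFin_Rintegral; last 2 first.
- by apply: integD => //; exact: integ_cst.
- by apply: integD => //; exact: integ_cst.
rewrite !ERD //; [|exact: integ_cst|exact: integ_cst].
by rewrite ERcst => -[]; apply: addrI.
Qed.

End Freezing.
End Independence.

(** * Sums of independent variables *)

Section Rectangles.
Context {dT : measure_display} {T : measurableType dT} {R : realType}.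
Variable P : probability T R.

(** The sets [A] for which the product rule holds form a Dynkin system. *)
Lemma independent_of_pi_system (d1 : measure_display) (C1 : measurableType d1)
    (X : T -> C1) (S : set T) (G : set (set C1)) :
  measurable_fun [set: T] X -> measurable S ->
  d1.-measurable = <<s G >> -> setI_closed G ->
  (forall A, G A -> P (X @^-1` A `&` S) = (P (X @^-1` A) * P S)%E) ->
  forall A, measurable A -> P (X @^-1` A `&` S) = (P (X @^-1` A) * P S)%E.
Proof.
move=> mX mS GE GI GB A mA.
have mXA B : measurable B -> measurable (X @^-1` B).
  by move=> mB; rewrite -[X in measurable X]setTI; exact: mX.
pose Q B := P (X @^-1` B `&` S) = (P (X @^-1` B) * P S)%E.
apply: (@dynkin_induction _ _ G Q) => //; rewrite -?GE //.
- rewrite /Q preimage_setT setTI.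
  have -> : P [set: T] = 1%E by exact: probability_setT.
  by rewrite mul1e.
- move=> B mB QB; rewrite /Q preimage_setC.
  rewrite (probability_setC P (mXA _ mB)) setIC -setDE measureD //=; first last.
  + by rewrite (le_lt_trans (probability_le1 P _)) // ltry.
  + exact: mXA.
  rewrite setIC [P (_ `&` _)]QB -(prE P mS) -(prE P (mXA _ mB)).
  rewrite -EFinM -!EFinB -EFinM.
  by congr (_%:E); ring.
- move=> F mF tF QF; have tF' i j : i != j -> F i `&` F j = set0.
    by move/trivIsetP : tF; apply.
  rewrite /Q preimage_bigcup setI_bigcupl.
  rewrite measure_semi_bigcup //; first last.
  + by apply: bigcup_measurable => k _; apply: measurableI => //; exact: mXA.
  + apply: trivIset_setIr; apply/trivIsetP => i j _ _ ij.
    by rewrite -preimage_setI tF' // preimage_set0.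
  + by move=> i; apply: measurableI => //; exact: mXA.
  rewrite [in RHS]measure_semi_bigcup //; first last.
  + by apply: bigcup_measurable => k _; exact: mXA.
  + apply/trivIsetP => i j _ _ ij.
    by rewrite -preimage_setI tF' // preimage_set0.
  + by move=> i; exact: mXA.
  rewrite muleC -(prE P mS) -nneseriesZl; last by move=> i _; rewrite measure_ge0.
  rewrite prE //; apply: eq_eseriesr => i _; rewrite muleC; exact: QF.
Qed.

Lemma indep2_pi_system (d1 d2 : measure_display) (C1 : measurableType d1)
    (C2 : measurableType d2) (X : T -> C1) (Y : T -> C2)
    (G1 : set (set C1)) (G2 : set (set C2)) :
  measurable_fun [set: T] X -> measurable_fun [set: T] Y ->
  d1.-measurable = <<s G1 >> -> setI_closed G1 ->
  d2.-measurable = <<s G2 >> -> setI_closed G2 ->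
  (forall A B, G1 A -> G2 B ->
    P (X @^-1` A `&` Y @^-1` B) = (P (X @^-1` A) * P (Y @^-1` B))%E) ->
  indep2 P X Y.
Proof.
move=> mX mY G1E G1I G2E G2I GB A B mA mB.
have mXA S : measurable S -> measurable (X @^-1` S).
  by move=> mS; rewrite -[X in measurable X]setTI; exact: mX.
have mYB S : measurable S -> measurable (Y @^-1` S).
  by move=> mS; rewrite -[X in measurable X]setTI; exact: mY.
apply: (independent_of_pi_system mX (mYB _ mB) G1E G1I) => // A' GA'.
have mA' : measurable A' by rewrite G1E; exact: sub_sigma_algebra.
rewrite setIC muleC.
apply: (independent_of_pi_system mY (mXA _ mA') G2E G2I) => // B' GB'.
by rewrite setIC muleC; exact: GB.
Qed.

Context {dW : measure_display} {W : measurableType dW}.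

Definition rectangle n (A : 'I_n -> set W) : set (n.-tuple W) :=
  [set t | forall i, A i (tnth t i)].

Lemma measurable_rectangle n (A : 'I_n -> set W) :
  (forall i, measurable (A i)) -> measurable (rectangle A).
Proof.
move=> mA; have -> : rectangle A =
    \bigcap_(i in [set: 'I_n]) ((fun t : n.-tuple W => tnth t i) @^-1` A i).
  by apply/seteqP; split => t /= H i; [move=> _; exact: H|exact: H].
apply: fin_bigcap_measurable; first exact: finite_finset.
move=> i _; rewrite -[X in measurable X]setTI.
exact: measurable_tnth.
Qed.

Definition rectangles n : set (set (n.-tuple W)) :=
  [set rectangle A | A in [set A | forall i : 'I_n, measurable (A i)]].

Lemma tuple_measurableE n :
  (measurable : set (set (n.-tuple W))) = <<s @rectangles n >>.
Proof.
apply/seteqP; split.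
  apply: smallest_sub; first exact: smallest_sigma_algebra.
  move=> S; rewrite -bigcup_seq => -[i _ [B mB <-]]; rewrite setTI.
  apply: sub_sigma_algebra.
  exists (fun j => if j == i then B else setT).
    by move=> j; case: ifP.
  apply/seteqP; split => t /=; first by move=> /(_ i); rewrite eqxx.
  by move=> Bt j; case: eqP => // ->.
apply: smallest_sub; first exact: sigma_algebra_measurable.
by move=> _ [A mA <-]; exact: measurable_rectangle.
Qed.

Lemma rectangles_setI n : setI_closed (@rectangles n).
Proof.
move=> _ _ [A mA <-] [B mB <-]; exists (fun i => A i `&` B i).
  by move=> i; apply: measurableI.
apply/seteqP; split => t /=; first by move=> H; split=> i; have [] := H i.
by move=> [HA HB] i; split.
Qed.

End Rectangles.

Lemma measurable_cos (R : realType) : measurable_fun [set: R] (@cos R).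
Proof. by apply: continuous_measurable_fun; exact: continuous_cos. Qed.

Section IndependentSequences.
Context {dT : measure_display} {T : measurableType dT} {R : realType}.
Variable P : probability T R.

(** Independence of the first [n] terms only, the number of uniform variables
    being the sample size. *)
Definition indep_seq {dW : measure_display} {W : measurableType dW}
    (xi : nat -> T -> W) n : Prop :=
  forall A : nat -> set W, (forall i, measurable (A i)) ->
    pr P [set w | forall i, (i < n)%N -> A i (xi i w)] =
    \prod_(i < n) pr P (xi i @^-1` A i).

Section Sequence.
Context {dW : measure_display} {W : measurableType dW}.
Variable xi : nat -> T -> W.
Hypothesis mxi : forall i, measurable_fun [set: T] (xi i).

Let mpre i (A : set W) : measurable A -> measurable (xi i @^-1` A).
Proof. by move=> mA; rewrite -[X in measurable X]setTI; exact: mxi. Qed.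

Lemma measurable_cylinder (A : nat -> set W) n : (forall i, measurable (A i)) ->
  measurable [set w | forall i, (i < n)%N -> A i (xi i w)].
Proof.
move=> mA; have -> : [set w | forall i, (i < n)%N -> A i (xi i w)] =
    \bigcap_(i in [set: 'I_n]) (xi i @^-1` A i).
  apply/seteqP; split => w /= H i; first by move=> _; exact: H.
  by move=> ni; exact: (H (Ordinal ni)).
apply: fin_bigcap_measurable; first exact: finite_finset.
by move=> i _; exact: mpre.
Qed.

Lemma pr_setT : pr P [set: T] = 1.
Proof. by have := prE P measurableT; rewrite probability_setT => -[]. Qed.

Lemma indep_seq_le n k : indep_seq xi n -> (k <= n)%N -> indep_seq xi k.
Proof.
move=> xin kn A mA.
pose A' i := if (i < k)%N then A i else setT.
have -> : [set w | forall i, (i < k)%N -> A i (xi i w)] =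
    [set w | forall i, (i < n)%N -> A' i (xi i w)].
  apply/seteqP; split => w /= H i ilt.
    by rewrite /A'; case: ifP => // /H.
  by have := H i (leq_trans ilt kn); rewrite /A' ilt.
rewrite xin; last by move=> i; rewrite /A'; case: ifP.
rewrite -(big_mkord xpredT (fun i => pr P (xi i @^-1` A' i))).
rewrite (@big_cat_nat _ _ _ k) //= [X in _ * X]big_nat_cond [X in _ * X]big1 ?mulr1.
  by rewrite big_mkord; apply: eq_bigr => i _; rewrite /A' ltn_ord.
move=> i; rewrite andbT => /andP[ki _].
by rewrite /A' ltnNge ki /= preimage_setT pr_setT.
Qed.

(** The prefix is a random tuple, whose measurable sets are generated by the
    rectangles; on rectangles the product rule is the hypothesis. *)
Lemma indep_seq_prefix n k : indep_seq xi n -> (k < n)%N ->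
  indep2 P (fun w => [tuple xi i w | i < k]) (xi k).
Proof.
move=> xin kn; have xik := indep_seq_le xin kn.
have xik' := indep_seq_le xin (ltnW kn).
move=> A0 B mA0 mB.
have mX : measurable_fun [set: T] (fun w => [tuple xi i w | i < k]).
  apply/measurable_fun_tnthP => i.
  by have := mxi i; apply: eq_measurable_fun => w _; rewrite /= tnth_mktuple.
apply: (independent_of_pi_system mX (mpre _ mB) (@tuple_measurableE _ W k)
  (@rectangles_setI _ W k)) => // _ [A mA <-].
pose A' i := if insub i is Some j then A j else B.
have mA' i : measurable (A' i) by rewrite /A'; case: insubP.
have A'k : A' k = B by rewrite /A' insubN // ltnn.
have A'E (i : 'I_k) : A' i = A i by rewrite /A' valK.
have E1 : (fun w => [tuple xi i w | i < k]) @^-1` rectangle A =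
    [set w | forall i, (i < k)%N -> A' i (xi i w)].
  apply/seteqP; split => w /= H i.
    by move=> ik; have := H (Ordinal ik); rewrite tnth_mktuple -A'E.
  by rewrite tnth_mktuple -A'E; exact: H.
have E2 : [set w | forall i, (i < k)%N -> A' i (xi i w)] `&` (xi k @^-1` B) =
    [set w | forall i, (i < k.+1)%N -> A' i (xi i w)].
  apply/seteqP; split => w /=.
    move=> [H Bk] i; rewrite ltnS leq_eqVlt => /orP[/eqP ->|]; last exact: H.
    by rewrite A'k.
  move=> H; split; last by have := H k (ltnSn k); rewrite A'k.
  by move=> i ik; apply: H; exact: ltnW.
rewrite E1 E2 -!(prE P); [|exact: mpre|exact: measurable_cylinder..].
by rewrite xik // xik' // big_ord_recr /= A'k EFinM.
Qed.

End Sequence.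

Lemma indep_seq_comp {dW dV : measure_display} {W : measurableType dW}
    {V : measurableType dV} (xi : nat -> T -> W) (h : nat -> W -> V) n :
  (forall i, measurable_fun [set: W] (h i)) -> indep_seq xi n ->
  indep_seq (fun i => h i \o xi i) n.
Proof.
move=> mh xin A mA; apply: (xin (fun i => h i @^-1` A i)) => i.
by rewrite -[X in measurable X]setTI; exact: mh.
Qed.

Section Sums.
Variables (eta : nat -> T -> R) (n : nat).
Hypothesis meta : forall i, measurable_fun [set: T] (eta i).
Hypothesis ieta : indep_seq eta n.

Lemma measurable_partial_sum k :
  measurable_fun [set: T] (fun w => \sum_(i < k) eta i w).
Proof. by apply: measurable_sum => i. Qed.

Lemma indep_partial_sum k : (k < n)%N ->
  indep2 P (fun w => \sum_(i < k) eta i w) (eta k).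
Proof.
move=> kn; have := indep_seq_prefix meta ieta kn.
move=> /(@indep2_comp _ _ _ P _ _ _ _ _ _ _ _ _ _
  (fun t : k.-tuple R => \sum_(i < k) tnth t i) id).
have -> : (fun t : k.-tuple R => \sum_(i < k) tnth t i) \o
   (fun w => [tuple eta i w | i < k]) = fun w => \sum_(i < k) eta i w.
  by apply/funext => w /=; apply: eq_bigr => i _; rewrite tnth_mktuple.
apply=> //; apply: measurable_sum => i; exact: measurable_tnth.
Qed.

Hypothesis eta_sqr : forall i, (i < n)%N -> integ P (fun w => eta i w ^+ 2).
Hypothesis eta_mean : forall i, (i < n)%N -> \int[P]_w eta i w = 0.

Lemma integ_of_sqr (f : T -> R) : measurable_fun [set: T] f ->
  integ P (fun w => f w ^+ 2) -> integ P f.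
Proof.
move=> mf if2; apply: (@integ_dom _ _ _ P _ (fun w => 1 + f w ^+ 2)) => //.
  by apply: integD => //; exact: integ_cst.
move=> w; rewrite -(real_normK (num_real (f w))).
by have := sqr_ge0 (`|f w| - 1); have := normr_ge0 (f w); nra.
Qed.

(** Adding one independent summand adds its variance, because the cross term
    has mean zero once the partial sum is held fixed. *)
Lemma second_moment_sum k : (k <= n)%N ->
  integ P (fun w => (\sum_(i < k) eta i w) ^+ 2) /\
  \int[P]_w (\sum_(i < k) eta i w) ^+ 2 = \sum_(i < k) \int[P]_w (eta i w ^+ 2).
Proof.
elim: k => [|k IH] kn.
  rewrite big_ord0; under eq_fun do rewrite big_ord0 expr0n /=.
  by split; [exact: integ_cst|rewrite ERcst].
have [iS ES] := IH (ltnW kn).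
have mS := measurable_partial_sum k.
have ie := eta_sqr kn; have ie1 := integ_of_sqr (meta k) ie.
pose S w := \sum_(i < k) eta i w.
pose Phi (z : R * R) : \bar R := ((z.1 + z.2) ^+ 2)%:E.
have mPhi : measurable_fun [set: R * R] Phi.
  by apply/measurable_EFinP/measurable_funX/measurable_funD.
have Phi0 z : (0 <= Phi z)%E by rewrite lee_fin sqr_ge0.
have inner w : (\int[P]_v Phi (S w, eta k v) =
    (S w ^+ 2 + \int[P]_v (eta k v ^+ 2))%:E)%E.
  rewrite /Phi /=.
  have E v : (S w + eta k v) ^+ 2 = S w ^+ 2 + (2 * S w * eta k v + eta k v ^+ 2) by ring.
  under eq_integral do rewrite E.
  have i1 : integ P (fun v => 2 * S w * eta k v) by exact: integZ.
  have i2 : integ P (fun v => 2 * S w * eta k v + eta k v ^+ 2) by exact: integD.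
  have i3 := @integ_cst _ _ _ P (S w ^+ 2).
  rewrite -EFin_Rintegral; last exact: integD.
  by rewrite ERD // ERD // ERZ // eta_mean // mulr0 add0r ERcst.
have := freeze_ge0 mS (meta k) (indep_partial_sum kn) mPhi Phi0.
under [RHS]eq_integral do rewrite inner.
have i5 := @integ_cst _ _ _ P (\int[P]_v eta k v ^+ 2).
rewrite -(EFin_Rintegral (integD iS i5)).
rewrite (ERD iS i5).
rewrite ERcst ES => E.
have mS1 := measurable_partial_sum k.+1.
have iS1 : integ P (fun w => (\sum_(i < k.+1) eta i w) ^+ 2).
  apply/integrableP; split; first exact/measurable_EFinP/measurable_funX.
  rewrite (_ : (\int[P]_w _)%E = (\int[P]_w Phi (S w, eta k w))%E).
    by rewrite E ltry.
  apply: eq_integral => w _; rewrite /= ger0_norm ?sqr_ge0 //.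
  by rewrite big_ord_recr.
split=> //; apply: EFin_inj; rewrite EFin_Rintegral // [in RHS]big_ord_recr /= -E.
by apply: eq_integral => w _; rewrite big_ord_recr.
Qed.

(** The mean of the second-order expansion of [cos (c + f)] is
    [(1 - v / 2) * cos c], and [1 - v / 2] is the expansion of the Gaussian
    factor [expR (- (v / 2))]. *)
Lemma cos_lindeberg_step (c : R) (f : T -> R) : measurable_fun [set: T] f ->
  integ P (fun w => f w ^+ 2) -> \int[P]_w f w = 0 ->
  `|\int[P]_w cos (c + f w) - expR (- ((\int[P]_w (f w ^+ 2)) / 2)) * cos c| <=
  3 * (\int[P]_w (f w ^+ 2 * Num.min 1 `|f w|)) +
  Num.min (\int[P]_w (f w ^+ 2)) ((\int[P]_w (f w ^+ 2)) ^+ 2).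
Proof.
move=> mf if2 f0; set v := \int[P]_w (f w ^+ 2).
have v0 : 0 <= v by apply: ERge0 => w; exact: sqr_ge0.
have if1 := integ_of_sqr mf if2.
have mrho : measurable_fun [set: T] (fun w => f w ^+ 2 * Num.min 1 `|f w|).
  apply: measurable_funM; first exact: measurable_funX.
  by apply: measurable_minr => //; exact: measurableT_comp.
have irho : integ P (fun w => f w ^+ 2 * Num.min 1 `|f w|).
  apply: (integ_dom mrho if2) => w.
  have m0 : 0 <= Num.min 1 `|f w| by rewrite le_min ler01 normr_ge0.
  rewrite (ger0_norm (mulr_ge0 (sqr_ge0 _) m0)).
  by rewrite ler_piMr ?sqr_ge0 // ge_min lexx.
pose g w := cos c - f w * sin c - f w ^+ 2 / 2 * cos c.
have gE : g =1 fun t => cos c + (- sin c * f t + - (cos c / 2) * f t ^+ 2).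
  by move=> t; rewrite /g; field.
have i1 : integ P (fun w => - sin c * f w) by exact: integZ.
have i2 : integ P (fun w => - (cos c / 2) * f w ^+ 2) by exact: integZ.
have i3 := integD i1 i2.
have i4 := @integ_cst _ _ _ P (cos c).
have ig : integ P g by rewrite (funext gE); exact: (integD i4 i3).
have Eg : \int[P]_w g w = (1 - v / 2) * cos c.
  by rewrite (funext gE) (ERD i4 i3) (ERD i1 i2) !ERZ // f0 ERcst -/v; field.
have mcos : measurable_fun [set: T] (fun w => cos (c + f w)).
  by apply: (measurableT_comp (@measurable_cos R)); exact: measurable_funD.
have icos : integ P (fun w => cos (c + f w)).
  by apply: (@integ_bounded _ _ _ P _ 1 mcos) => ?; exact: cos_max.
have -> : \int[P]_w cos (c + f w) - expR (- (v / 2)) * cos c =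
    \int[P]_w (cos (c + f w) - g w) - (expR (- (v / 2)) - (1 - v / 2)) * cos c.
  by rewrite ERB // Eg; ring.
apply: le_trans (ler_normB _ _) _; apply: lerD.
  rewrite -ERZ //; apply: ERnorm_le; first exact: integB.
    exact: integZ.
  by move=> w; exact: cos_taylor.
rewrite normrM; apply: (@le_trans _ _ `|expR (- (v / 2)) - (1 - v / 2)|).
  by rewrite ler_piMr // cos_max.
have v20 : 0 <= v / 2 by rewrite divr_ge0.
apply: le_trans (expRN_taylor v20) _.
rewrite le_min !ge_min; apply/andP; split; apply/orP; [left; lra|right].
by rewrite exprMn ler_piMr ?sqr_ge0 //; lra.
Qed.

Let v i := \int[P]_w (eta i w ^+ 2).

(** Lindeberg's replacement of the summands, one at a time, by independent
    Gaussian variables of the same variance.  The Gaussian means of a cosine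
    being explicit, those variables need not be constructed. *)
Lemma cos_lindeberg (c : R) k : (k <= n)%N ->
  `|\int[P]_w cos (c + \sum_(i < k) eta i w) -
     expR (- ((\sum_(i < k) v i) / 2)) * cos c| <=
  \sum_(i < k) (3 * (\int[P]_w (eta i w ^+ 2 * Num.min 1 `|eta i w|)) +
               Num.min (v i) (v i ^+ 2)).
Proof.
elim: k => [|k IH] kn.
  rewrite !big_ord0 mul0r oppr0 expR0 mul1r.
  under eq_Rintegral do rewrite big_ord0 addr0.
  by rewrite ERcst subrr normr0.
have {}IH := IH (ltnW kn).
rewrite [in leRHS]big_ord_recr /= addrC.
pose S w := \sum_(i < k) eta i w.
have mS : measurable_fun [set: T] S := measurable_partial_sum k.
pose Phi (z : R * R) : R := cos (c + z.1 + z.2).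
have mPhi : measurable_fun [set: R * R] Phi.
  apply: (measurableT_comp (@measurable_cos R)).
  by apply: measurable_funD => //; exact: measurable_funD.
have Phi1 z : `|Phi z| <= 1 by exact: cos_max.
have [mI EI] := freeze_bounded mS (meta k) (indep_partial_sum kn) mPhi Phi1.
have -> : \int[P]_w cos (c + \sum_(i < k.+1) eta i w) = \int[P]_w Phi (S w, eta k w).
  by apply: eq_Rintegral => w _; rewrite big_ord_recr /= addrA.
rewrite EI big_ord_recr /= mulrDl opprD expRD.
have mcS : measurable_fun [set: T] (fun w => cos (c + S w)).
  by apply: (measurableT_comp (@measurable_cos R)); exact: measurable_funD.
have icS : integ P (fun w => cos (c + S w)).
  by apply: (@integ_bounded _ _ _ P _ 1 mcS) => w; exact: cos_max.
have iI : integ P (fun w => \int[P]_x Phi (S w, eta k x)).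
  apply: (@integ_bounded _ _ _ P _ 1 mI) => w.
  rewrite -[leRHS](ERcst P 1); apply: ERnorm_le => //; last exact: integ_cst.
  apply: (@integ_bounded _ _ _ P _ 1 _) => //.
  by apply: (measurableT_comp mPhi); exact: measurable_fun_pair.
pose e := expR (- (v k / 2)).
have e1 : e <= 1 by rewrite expR_le1 oppr_le0 divr_ge0 // ERge0 // => w; exact: sqr_ge0.
have -> : \int[P]_w \int[P]_x Phi (S w, eta k x) -
    expR (- ((\sum_(i < k) v i) / 2)) * e * cos c =
  \int[P]_w (\int[P]_x Phi (S w, eta k x) - e * cos (c + S w)) +
  e * (\int[P]_w cos (c + S w) - expR (- ((\sum_(i < k) v i) / 2)) * cos c).
  rewrite ERB //; last exact: integZ.
  by rewrite ERZ //; ring.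
apply: le_trans (ler_normD _ _) _; apply: lerD; last first.
  by rewrite normrM ger0_norm ?expR_ge0 // -[leRHS]mul1r ler_pM ?expR_ge0.
rewrite -[leRHS](ERcst P).
apply: ERnorm_le; first by apply: integB => //; exact: integZ.
  exact: integ_cst.
by move=> w; exact: (cos_lindeberg_step (c + S w) (meta k) (eta_sqr kn) (eta_mean kn)).
Qed.

End Sums.
End IndependentSequences.

(** * The cosine transform of the normal law *)

Section DerivativeBySquareBound.
Context {R : realType} {V : normedModType R}.

(** A quadratic remainder gives a derivative.  The bounds that dominated
    integrands provide are of this form, and no interchange of limit and
    integral is needed. *)
Lemma is_derive_sqr_bound (f : V -> R) (x v : V) (D C r : R) : 0 < r ->
  (forall h, `|h| < r -> `|f (x + h *: v) - f x - h * D| <= C * h ^+ 2) ->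
  is_derive x v f D.
Proof.
move=> r0 H.
have C0 : 0 <= C * (r / 2) ^+ 2.
  by apply: le_trans (H (r / 2) _); rewrite ?normr_ge0 // ger0_norm; lra.
have {}C0 : 0 <= C by rewrite pmulr_lge0 // in C0; rewrite exprn_gt0 // divr_gt0.
have cv : h^-1 *: ((f \o shift x) (h *: v) - f x) @[h --> 0^'] --> D.
  apply/cvgrPdist_le => e e0; near=> h.
  have h0 : h != 0 by near: h; exact: nbhs_dnbhs_neq.
  have hr : `|h| < Num.min r (e / (C + 1)).
    near: h; apply: dnbhs0_lt; rewrite lt_min r0 divr_gt0 //; lra.
  move: hr; rewrite lt_min => /andP[hr he].
  have := H h hr; rewrite /= [x + _]addrC /GRing.scale /= => Hh.
  have -> : D - h^-1 * (f (h *: v + x) - f x) =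
      - (h^-1 * (f (h *: v + x) - f x - h * D)).
    by field.
  rewrite normrN normrM normrV ?unitfE //.
  rewrite ler_pdivrMl ?normr_gt0 //; apply: le_trans Hh _.
  rewrite -(real_normK (num_real h)) expr2 mulrCA ler_wpM2l //.
  have C1 : 0 < C + 1 by lra.
  move: he; rewrite ltr_pdivlMr // mulrDr mulr1 mulrC.
  by have := normr_ge0 h; lra.
by apply: DeriveDef; [apply/cvg_ex; exists D|exact: cvg_lim cv].
Unshelve. all: by end_near. Qed.

End DerivativeBySquareBound.

Section NormalDensity.
Context {R : realType}.
Variable s : R.
Hypothesis s0 : s != 0.
Local Notation N := (normal_prob 0 s).
Local Notation mu := (@lebesgue_measure R).

Lemma ge0_integral_normal (f : R -> \bar R) : measurable_fun [set: R] f ->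
  (forall x, 0 <= f x)%E ->
  (\int[N]_x f x = \int[mu]_x (f x * (normal_pdf 0 s x)%:E))%E.
Proof.
move=> mf f0.
have dom : (N : {finite_measure set _ -> \bar R}) `<< mu := normal_prob_dominates 0 s.
rewrite -(Radon_Nikodym_SigmaFinite.change_of_variables dom) //.
have ig := Radon_Nikodym_SigmaFinite.f_integrable dom.
apply: ae_eq_integral => //.
- by apply: emeasurable_funM => //; exact: measurable_int ig.
- by apply: emeasurable_funM => //; apply/measurable_EFinP; exact: measurable_normal_pdf.
- apply: ae_eqe_mul2l; apply: integral_ae_eq => //.
  + by apply/measurable_EFinP; exact: measurable_normal_pdf.
  + by move=> A _ mA; rewrite -Radon_Nikodym_SigmaFinite.f_integral.
Qed.

(** Completing the square. *)
Lemma normal_pdf_tilt (l x : R) :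
  expR (l * x) * normal_pdf 0 s x =
  expR (l ^+ 2 * s ^+ 2 / 2) * normal_pdf 0 s (x - l * s ^+ 2).
Proof.
rewrite !normal_pdfE // [LHS]mulrCA [RHS]mulrCA; congr (_ * _).
by rewrite /normal_fun -!expRD; congr expR; field.
Qed.

(** Multiplying the normal density by an exponential translates it, up to a
    constant factor. *)
Lemma ge0_integral_normal_shift (h : R -> R) (l : R) : continuous h ->
  (forall x, 0 <= h x) ->
  (\int[N]_x (h x * expR (l * x))%:E =
   (expR (l ^+ 2 * s ^+ 2 / 2))%:E * \int[N]_x (h (x + l * s ^+ 2))%:E)%E.
Proof.
move=> hc h0; set a := l * s ^+ 2.
have mh : measurable_fun [set: R] h by exact: continuous_measurable_fun.
have mN := measurable_normal_pdf 0 s.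
have me : measurable_fun [set: R] (fun x => expR (l * x)).
  by apply: measurableT_comp => //; exact: measurable_funM.
have mha : measurable_fun [set: R] (fun x => h (x + a)).
  by apply: (measurableT_comp mh); exact: measurable_funD.
rewrite ge0_integral_normal; first last.
- by move=> x; rewrite lee_fin mulr_ge0 // expR_ge0.
- by apply/measurable_EFinP; exact: measurable_funM.
under eq_integral.
  move=> x _; rewrite -EFinM -mulrA normal_pdf_tilt -/a mulrCA EFinM.
  over.
rewrite ge0_integralZl //; first last.
- by move=> x _; rewrite lee_fin mulr_ge0 // normal_pdf_ge0.
- apply/measurable_EFinP; apply: measurable_funM => //.
  by apply: (measurableT_comp mN); exact: measurable_funB.
congr (_ * _)%E; rewrite ge0_integral_normal; first last.
- by move=> x; rewrite lee_fin.
- exact/measurable_EFinP.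
pose F := fun x : R => x + a.
have dF : derive1 F = cst 1.
  by apply/funext => x; rewrite derive1E deriveD // derive_id derive_cst addr0.
rewrite (@increasing_ge0_integration_by_substitutionT _ F (fun x => h x * normal_pdf 0 s (x - a))).
- apply: eq_integral => x _; rewrite -EFinM dF; congr (_%:E).
  by rewrite /F fctE /= mulr1 addrK.
- by move=> x y xy; rewrite /F ltrD2r.
- by rewrite dF => x; exact: cvg_cst.
- by rewrite dF; exact: is_cvg_cst.
- by rewrite dF; exact: is_cvg_cst.
- by [].
- exact: cvg_addrr_Ny.
- exact: cvg_addrr.
- move=> x; apply: cvgM; first exact: hc.
  apply: (cvg_comp (fun x => x - a)); last exact: continuous_normal_pdf.
  by apply: cvgB; [exact: cvg_id|exact: cvg_cst].
- by move=> x; rewrite mulr_ge0 // normal_pdf_ge0.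
Qed.

Lemma integ_normal_expR l : integ N (fun x => expR (l * x)).
Proof.
apply/integrableP; split.
  by apply/measurable_EFinP; apply: measurableT_comp => //; exact: measurable_funM.
have := @ge0_integral_normal_shift (fun=> 1) l (fun x => cvg_cst _) (fun=> ler01).
rewrite -(EFin_Rintegral (integ_cst N 1)) ERcst mule1 => E; rewrite (_ : (\int[N]_x _)%E = (\int[N]_x (1 * expR (l * x))%:E)%E).
  by rewrite E ltry.
by apply: eq_integral => x _; rewrite /= mul1r ger0_norm // expR_ge0.
Qed.

Lemma sqr_le_expR (x : R) : x ^+ 2 <= 4 * expR `|x|.
Proof.
rewrite -(real_normK (num_real x)); have := normr_ge0 x; set y := `|x| => y0.
have : 1 + y / 2 <= expR (y / 2) by exact: expR_ge1Dx.
have -> : expR y = expR (y / 2) ^+ 2.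
  by rewrite expr2 -expRD; congr expR; field.
by have := expR_gt0 (y / 2); nra.
Qed.

Lemma integ_normal_sqr_expR : integ N (fun x => x ^+ 2 * expR `|x|).
Proof.
have i1 := integD (integ_normal_expR 2) (integ_normal_expR (- 2)).
apply: (integ_dom _ (integZ 4 i1)).
  apply: measurable_funM; first exact: measurable_funX.
  by apply: measurableT_comp => //; exact: measurableT_comp.
move=> x; rewrite (ger0_norm (mulr_ge0 (sqr_ge0 _) (expR_ge0 _))).
apply: (@le_trans _ _ (4 * expR `|x| * expR `|x|)).
  by rewrite ler_wpM2r ?expR_ge0 // sqr_le_expR.
rewrite -mulrA -expRD ler_wpM2l //.
have := expR_gt0 (2 * x); have := expR_gt0 (- 2 * x).
have [x0|x0] := leP 0 x.
  by rewrite (ger0_norm x0) (_ : x + x = 2 * x); [lra|ring].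
by rewrite (ltr0_norm x0) (_ : - x - x = - 2 * x); [lra|ring].
Qed.

Lemma integ_normal_sqr : integ N (fun x => x ^+ 2).
Proof.
apply: (integ_dom _ integ_normal_sqr_expR); first exact: measurable_funX.
move=> x; rewrite ger0_norm ?sqr_ge0 // ler_peMr ?sqr_ge0 //.
by rewrite -expR0 ler_expR.
Qed.

Lemma expR_taylor2 (y : R) : `|expR y - 1 - y| <= y ^+ 2 * expR `|y|.
Proof.
have e1 : 1 + y <= expR y by exact: expR_ge1Dx.
have e2 : 1 - y <= expR (- y) by exact: expR_ge1Dx.
have e0 := expR_gt0 y.
have e3 : expR y - 1 <= y * expR y.
  have : (1 - y) * expR y <= expR (- y) * expR y by rewrite ler_wpM2r // ltW.
  by rewrite -expRD addNr expR0; lra.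
rewrite ger0_norm; last by lra.
have [y0|y0] := leP 0 y; first by rewrite (ger0_norm y0); nra.
rewrite (ltr0_norm y0).
have : 1 <= expR (- y) by rewrite -expR0 ler_expR oppr_ge0 ltW.
nra.
Qed.

Section CharacteristicFunction.
Variable c : R.

Let mlin t : measurable_fun [set: R] (fun x => c + t * x).
Proof. by apply: measurable_funD => //; exact: measurable_funM. Qed.

Let msin t : measurable_fun [set: R] (fun x => sin (c + t * x)).
Proof.
apply: (measurableT_comp _ (mlin t)).
by apply: continuous_measurable_fun; exact: continuous_sin.
Qed.

Let mcos t : measurable_fun [set: R] (fun x => cos (c + t * x)).
Proof. exact: (measurableT_comp (@measurable_cos R) (mlin t)). Qed.

Let isin t : integ N (fun x => sin (c + t * x)).
Proof. by apply: (@integ_bounded _ _ _ N _ 1 (msin t)) => x; exact: sin_max. Qed.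

Let icos t : integ N (fun x => cos (c + t * x)).
Proof. by apply: (@integ_bounded _ _ _ N _ 1 (mcos t)) => x; exact: cos_max. Qed.

Let ixsin t : integ N (fun x => x * sin (c + t * x)).
Proof.
apply: (@integ_dom _ _ _ N _ (fun x => 1 + x ^+ 2)).
- by apply: measurable_funM; [exact: measurable_id|exact: msin].
- by apply: integD; [exact: integ_cst|exact: integ_normal_sqr].
- move=> x; rewrite normrM -(real_normK (num_real x)).
  apply: (@le_trans _ _ `|x|); first by rewrite ler_piMr // sin_max.
  by have := sqr_ge0 (`|x| - 1); nra.
Qed.

Let isine t l : integ N (fun x => sin (c + t * x) * expR (l * x)).
Proof.
apply: (integ_dom _ (integ_normal_expR l)).
  apply: measurable_funM; first exact: msin.
  by apply: measurableT_comp => //; exact: measurable_funM.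
move=> x; rewrite normrM [`|expR _|]ger0_norm ?expR_ge0 //.
by rewrite ler_piMl ?expR_ge0 // sin_max.
Qed.

Let sin_tilt t l :
  \int[N]_x (sin (c + t * x) * expR (l * x)) =
  expR (l ^+ 2 * s ^+ 2 / 2) * \int[N]_x sin (c + t * (l * s ^+ 2) + t * x).
Proof.
(* the translation identity is for nonnegative functions, whence the [1 +] *)
have h0 x : 0 <= 1 + sin (c + t * x).
  by have := sin_max (c + t * x); rewrite ler_norml; lra.
have hc : continuous (fun x => 1 + sin (c + t * x)).
  move=> x; apply: cvgD; first exact: cvg_cst.
  apply: (cvg_comp (fun x => c + t * x)); last exact: continuous_sin.
  apply: cvgD; first exact: cvg_cst.
  by apply: cvgM; [exact: cvg_cst|exact: cvg_id].
have E1 := @ge0_integral_normal_shift _ l hc h0.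
have E2 := @ge0_integral_normal_shift (fun=> 1) l (fun x => cvg_cst _) (fun=> ler01).
have i0 : integ N (fun x => 1 * expR (l * x)).
  by under eq_fun do rewrite mul1r; exact: integ_normal_expR.
have i1 : integ N (fun x => (1 + sin (c + t * x)) * expR (l * x)).
  by under eq_fun do rewrite mulrDl; exact: integD.
have i2 : integ N (fun x => sin (c + t * (l * s ^+ 2) + t * x)).
  have -> : (fun x => sin (c + t * (l * s ^+ 2) + t * x)) =
      (fun x => sin (c + t * (x + l * s ^+ 2))) by apply/funext => x; congr sin; ring.
  apply: (@integ_bounded _ _ _ N _ 1) => [|x]; last exact: sin_max.
  by apply: (measurableT_comp (msin t)); exact: measurable_funD.
have i3 : integ N (fun x => 1 + sin (c + t * (l * s ^+ 2) + t * x)).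
  by apply: integD => //; exact: integ_cst.
have {}E1 : \int[N]_x ((1 + sin (c + t * x)) * expR (l * x)) =
    expR (l ^+ 2 * s ^+ 2 / 2) * \int[N]_x (1 + sin (c + t * (l * s ^+ 2) + t * x)).
  apply: EFin_inj; rewrite EFin_Rintegral // EFinM EFin_Rintegral // E1.
  by congr (_ * _)%E; apply: eq_integral => x _; congr ((1 + sin _)%:E); ring.
have {}E2 : \int[N]_x (1 * expR (l * x)) = expR (l ^+ 2 * s ^+ 2 / 2).
  apply: EFin_inj; rewrite EFin_Rintegral // E2.
  by rewrite -(EFin_Rintegral (integ_cst N 1)) ERcst mule1.
have -> : (fun x => sin (c + t * x) * expR (l * x)) =
  (fun x => (1 + sin (c + t * x)) * expR (l * x) - 1 * expR (l * x)).
  by apply/funext => x; ring.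
rewrite ERB // E1 E2 ERD //; last exact: integ_cst.
by rewrite ERcst; ring.
Qed.

(** Stein's identity for sines: the derivative at [l = 0] of the tilting
    identity [sin_tilt]. *)
Let stein t :
  \int[N]_x (x * sin (c + t * x)) = s ^+ 2 * t * \int[N]_x cos (c + t * x).
Proof.
set X := LHS; set C := \int[N]_x cos (c + t * x).
set S := \int[N]_x sin (c + t * x).
set A := \int[N]_x (x ^+ 2 * expR `|x|).
have S1 : `|S| <= 1.
  by rewrite -[leRHS](ERcst N 1); apply: ERnorm_le => // [|x]; [exact: integ_cst|exact: sin_max].
have C1 : `|C| <= 1.
  by rewrite -[leRHS](ERcst N 1); apply: ERnorm_le => // [|x]; [exact: integ_cst|exact: cos_max].
pose B := s ^+ 2 / 2 * expR (s ^+ 2 / 2).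
pose e (l : R) := expR (l ^+ 2 * s ^+ 2 / 2).
pose k (l : R) := t * (l * s ^+ 2).
have main l : 0 < l <= 1 ->
  l * `|X - s ^+ 2 * t * C| <= l ^+ 2 * (A + expR (s ^+ 2 / 2) * (2 * (t * s ^+ 2) ^+ 2)
     + B * (1 + `|t * s ^+ 2|)).
  move=> /andP[l0 l1].
  have s2 : 0 <= s ^+ 2 / 2 by rewrite divr_ge0 // sqr_ge0.
  have ll : 0 <= l ^+ 2 by rewrite sqr_ge0.
  have ll1 : l ^+ 2 <= 1 by rewrite expr_le1 // ltW.
  (* the left-hand side of the tilting identity, to first order *)
  have L : `|\int[N]_x (sin (c + t * x) * expR (l * x)) - S - l * X| <= l ^+ 2 * A.
    rewrite /S /X -ERZ // -ERB // -ERB //; last exact: integZ; last exact: integB.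
    rewrite -ERZ; last exact: integ_normal_sqr_expR.
    apply: ERnorm_le; first by apply: integB; [exact: integB|exact: integZ].
      by apply: integZ; exact: integ_normal_sqr_expR.
    move=> x.
    have -> : sin (c + t * x) * expR (l * x) - sin (c + t * x) - l * (x * sin (c + t * x))
      = sin (c + t * x) * (expR (l * x) - 1 - l * x) by ring.
    rewrite normrM; apply: le_trans (ler_piMl _ (sin_max _)) _ => //.
    apply: le_trans (expR_taylor2 _) _; rewrite exprMn -mulrA ler_wpM2l //.
    by rewrite ler_wpM2l ?sqr_ge0 // ler_expR normrM (ger0_norm (ltW l0)) ler_piMl.
  (* the right-hand side, to first order *)
  have Rr : `|\int[N]_x sin (c + k l + t * x) - S - k l * C| <= 2 * k l ^+ 2.
    have isk : integ N (fun x => sin (c + k l + t * x)).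
      apply: (@integ_bounded _ _ _ N _ 1) => [|x]; last exact: sin_max.
      apply: measurableT_comp.
        by apply: continuous_measurable_fun; exact: continuous_sin.
      by apply: measurable_funD => //; exact: measurable_funM.
    rewrite /S /C -ERZ // -ERB // -ERB //; last exact: integZ; last exact: integB.
    rewrite -[leRHS](ERcst N); apply: ERnorm_le.
    - by apply: integB; [exact: integB|exact: integZ].
    - exact: integ_cst.
    move=> x; set u := c + t * x.
    have -> : c + k l + t * x = u + k l by rewrite /u; ring.
    have -> : sin (u + k l) - sin u - k l * cos u =
      sin u * (cos (k l) - 1) + cos u * (sin (k l) - k l).
      by rewrite sinD; ring.
    apply: le_trans (ler_normD _ _) _; rewrite !normrM mulr_natl mulr2n.
    apply: lerD.
      by apply: le_trans (ler_piMl _ (sin_max _)) (cosB1_le2 _).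
    apply: le_trans (ler_piMl _ (cos_max _)) _ => //.
    by rewrite -(real_normK (num_real (k l))) sinB_le2.
  have eB : e l <= expR (s ^+ 2 / 2).
    by rewrite ler_expR ler_wpM2r // ler_piMl ?sqr_ge0.
  have el1 : `|e l - 1| <= l ^+ 2 * B.
    have y0 : 0 <= l ^+ 2 * s ^+ 2 / 2 by rewrite -mulrA mulr_ge0.
    rewrite ger0_norm; last by rewrite subr_ge0 -expR0 ler_expR.
    have e2 : 1 - l ^+ 2 * s ^+ 2 / 2 <= expR (- (l ^+ 2 * s ^+ 2 / 2)) by exact: expR_ge1Dx.
    have e3 : e l - 1 <= (l ^+ 2 * s ^+ 2 / 2) * e l.
      have : (1 - l ^+ 2 * s ^+ 2 / 2) * e l <= expR (- (l ^+ 2 * s ^+ 2 / 2)) * e l.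
        by rewrite ler_wpM2r // expR_ge0.
      by rewrite -expRD addNr expR0; lra.
    apply: le_trans e3 _; rewrite (_ : _ * e l = l ^+ 2 * (s ^+ 2 / 2 * e l)); last by ring.
    by rewrite /B ler_wpM2l // ler_wpM2l.
  have e0 : 0 <= e l by exact: expR_ge0.
  have kl : k l = l * (t * s ^+ 2) by rewrite /k; ring.
  have := sin_tilt t l; rewrite -/(e l) -/(k l) => tilt.
  set I1 := \int[N]_x (sin (c + t * x) * expR (l * x)) in tilt L.
  set I2 := \int[N]_x sin (c + k l + t * x) in tilt Rr.
  have -> : l * `|X - s ^+ 2 * t * C| = `|l * X - k l * C|.
    rewrite kl -{1}(ger0_norm (ltW l0)) -normrM; congr `|_|; ring.
  have -> : l * X - k l * C = - (I1 - S - l * X) +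
     (e l * (I2 - S - k l * C) + (e l - 1) * (S + k l * C)).
    by rewrite tilt; ring.
  rewrite -[A + _ + _]addrA (mulrDr (l ^+ 2)) (mulrDr (l ^+ 2) (expR _ * _)).
  apply: le_trans (ler_normD _ _) _; apply: lerD; first by rewrite normrN.
  apply: le_trans (ler_normD _ _) _; apply: lerD.
    rewrite normrM (ger0_norm e0) mulrCA; apply: ler_pM => //.
    by apply: le_trans Rr _; rewrite kl exprMn; lra.
  rewrite normrM mulrA; apply: ler_pM => //.
  apply: le_trans (ler_normD _ _) _; apply: lerD => //.
  rewrite normrM; apply: le_trans (ler_piMr _ C1) _ => //.
  by rewrite kl normrM (ger0_norm (ltW l0)) ler_piMl.
set D := X - _ in main; set M := (A + _ + _) in main.
apply/eqP; rewrite -subr_eq0 -/D -normr_le0 leNgt; apply/negP => D0.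
have M0 : 0 <= M.
  by have := main 1; rewrite ltr01 lexx expr1n !mul1r => /(_ isT); lra.
pose l := Num.min 1 (`|D| / (2 * (M + 1))).
have l0 : 0 < l by rewrite lt_min ltr01 divr_gt0 //; lra.
have := main l; rewrite l0 ge_min lexx => /(_ isT).
rewrite expr2 -mulrA ler_pM2l //.
have : l <= `|D| / (2 * (M + 1)) by rewrite ge_min lexx orbT.
rewrite ler_pdivlMr; last by lra.
nra.
Qed.

Let Dcos (t : R) : is_derive t 1 (fun u => \int[N]_x cos (c + u * x))
  (- (s ^+ 2 * t * \int[N]_x cos (c + t * x))).
Proof.
apply: (@is_derive_sqr_bound _ _ _ _ _ _ (2 * \int[N]_x (x ^+ 2)) 1) => // h _.
rewrite /GRing.scale /= mulr1 mulrN opprK -stein.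
have ix := ixsin t.
rewrite -ERZ // -ERB // -ERD //; last exact: integZ; last exact: integB.
rewrite mulrAC -ERZ; last exact: integ_normal_sqr.
apply: ERnorm_le; first by apply: integD; [exact: integB|exact: integZ].
  by apply: integZ; exact: integ_normal_sqr.
move=> x; set u := c + t * x; set k := h * x.
have -> : c + (t + h) * x = u + k by rewrite /u /k; ring.
have -> : cos (u + k) - cos u + h * (x * sin u) =
   cos u * (cos k - 1) - sin u * (sin k - k).
  by rewrite cosD /k; ring.
apply: le_trans (ler_normB _ _) _; rewrite !normrM -mulrA -exprMn -/k mulr_natl mulr2n.
apply: lerD.
  by apply: le_trans (ler_piMl _ (cos_max _)) (cosB1_le2 _).
apply: le_trans (ler_piMl _ (sin_max _)) _ => //.
by rewrite -(real_normK (num_real k)) sinB_le2.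
Qed.

(** The characteristic function solves the linear equation of Stein's
    identity. *)
Lemma normal_cos t :
  \int[N]_x cos (c + t * x) = expR (- (s ^+ 2 * t ^+ 2 / 2)) * cos c.
Proof.
pose F u := \int[N]_x cos (c + u * x).
pose G u := F u * expR (s ^+ 2 / 2 * u ^+ 2).
have dG (u : R) : is_derive u 1 G 0.
  have dF : is_derive u 1 F (- (s ^+ 2 * u * F u)) := Dcos u.
  have de : is_derive u 1 (fun u => expR (s ^+ 2 / 2 * u ^+ 2))
      (s ^+ 2 * u * expR (s ^+ 2 / 2 * u ^+ 2)).
    have dq : is_derive u 1 (fun u : R => s ^+ 2 / 2 * u ^+ 2) (s ^+ 2 * u).
      by apply: is_derive_eq; rewrite /GRing.scale /=; field.
    rewrite [X in is_derive _ _ _ X]mulrC.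
    exact: (is_derive1_comp (is_derive_expR _) dq).
  by apply: is_derive_eq; rewrite /GRing.scale /=; ring.
have := is_derive_0_is_cst t 0 dG; rewrite /G expr0n /= mulr0 expR0 mulr1.
have -> : F 0 = cos c.
  by rewrite /F; under eq_Rintegral do rewrite mul0r addr0; rewrite ERcst.
by rewrite -/(F t) mulrAC => <-; rewrite expRN mulrC mulfK // gt_eqF // expR_gt0.
Qed.

End CharacteristicFunction.
End NormalDensity.

(** * The continuity theorem *)

Section ContinuityTheorem.
Context {R : realType} {d : nat}.

Section Measurability.
Context {dT : measure_display} {T : measurableType dT}.
Variable X : T -> 'rV[R]_d.
Hypothesis rvX : random_vector X.

Lemma measurable_dot (a : 'rV[R]_d) : measurable_fun [set: T] (fun w => dot a (X w)).
Proof.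
under eq_fun do rewrite dotE.
by apply: measurable_sum => k; apply: measurable_funM => //; exact: rvX.
Qed.

Lemma measurable_cos_dot (a : 'rV[R]_d) (c : R) :
  measurable_fun [set: T] (fun w => cos (c + dot a (X w))).
Proof.
apply: (measurableT_comp (@measurable_cos R)).
by apply: measurable_funD => //; exact: measurable_dot.
Qed.

Lemma measurable_trigpoly (q : 'rV[R]_d -> R) : trigpoly q ->
  measurable_fun [set: T] (fun w => q (X w)).
Proof.
elim=> [a c|f g _ mf _ mg|k f _ mf]; first exact: measurable_cos_dot.
  exact: measurable_funD.
exact: measurable_funM.
Qed.

(** Measurability of the coordinates says nothing directly about a continuous
    function of the whole vector; trigonometric polynomials in the coordinates
    are measurable and converge to it pointwise. *)
Lemma measurable_continuous_bounded (f : 'rV[R]_d -> R) (K : R) : continuous f ->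
  (forall x, `|f x| <= K) -> measurable_fun [set: T] (fun w => f (X w)).
Proof.
move=> fc fK.
have H (j : nat) : exists q, [/\ trigpoly q, (forall x, `|q x| <= K) &
    forall x : 'rV[R]_d, `|x| <= j%:R -> `|f x - q x| <= j.+1%:R^-1].
  by apply: trigpoly_approx => //; rewrite invr_gt0.
have /choice[q qP] := H.
apply: (measurable_fun_cvg (h := fun j w => q j (X w))).
  by move=> j; apply: measurable_trigpoly; have [] := qP j.
move=> w _; apply/cvgrPdist_le => e e0; near=> j.
have [_ _ qj] := qP j; apply: le_trans (qj _ _) _.
  by near: j; exact: nbhs_infty_ger.
by apply: ltW; near: j; exact: near_infty_natSinv_lt (PosNum e0).
Unshelve. all: by end_near. Qed.

End Measurability.

Lemma trigpoly_bounded (q : 'rV[R]_d -> R) : trigpoly q -> exists K, forall x, `|q x| <= K.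
Proof.
elim=> [a c|f g _ [K fK] _ [L gL]|k f _ [K fK]].
- by exists 1 => x; exact: cos_max.
- by exists (K + L) => x; apply: le_trans (ler_normD _ _) _; exact: lerD.
- by exists (`|k| * K) => x; rewrite normrM ler_wpM2l.
Qed.

Lemma tight_random_variable (dT : measure_display) (T : measurableType dT)
    (P : probability T R) (g : T -> R) : measurable_fun [set: T] g ->
  forall e, 0 < e -> exists L : R, pr P [set w | L < `|g w|] <= e.
Proof.
move=> mg e e0.
pose F n := [set w | n%:R < `|g w|].
have mF n : measurable (F n).
  apply: measurable_set_lt => //.
  exact: measurableT_comp.
have F0 : \bigcap_n F n = set0.
  apply/seteqP; split=> // w /= H.
  have := H (Num.truncn `|g w|).+1 I; rewrite /F /= ltNge => /negP; apply.
  exact/ltW/truncnS_gt.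
have PF0 : (P (F 0%N) < +oo)%E by rewrite (le_lt_trans (probability_le1 P _)) // ltry.
have nF : {homo F : n m / (n <= m)%N >-> (m <= n)%O}.
  move=> n m nm; rewrite subsetEset => w /=; apply: le_lt_trans.
  by rewrite ler_nat.
have mI : measurable (\bigcap_n F n) by rewrite F0.
have := nonincreasing_cvg_mu PF0 mF mI nF; rewrite F0 measure0.
move=> /fine_cvgP[_ /cvgrPdist_le/(_ e e0)[n _ /(_ n (leqnn n))]].
rewrite sub0r normrN => He; exists n%:R; apply: le_trans He; exact: ler_norm.
Qed.

(** On a large cube a bounded continuous function is close to a trigonometric
    polynomial with the same bound, and tightness leaves little mass outside of
    the cube. *)
Theorem levy_continuity (dT dT' : measure_display) (T : measurableType dT)
    (T' : measurableType dT') (P : probability T R) (P' : probability T' R)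
    (X : nat -> T -> 'rV[R]_d) (G : T' -> 'rV[R]_d) :
  (forall n, random_vector (X n)) -> random_vector G ->
  (forall k, bounded_in_prob P (fun n w => X n w 0 k)) ->
  (forall a c, \int[P]_w cos (c + dot a (X n w)) @[n --> \oo] -->
     \int[P']_w cos (c + dot a (G w))) ->
  cvg_in_dist P P' X G.
Proof.
move=> rvX rvG tX cf f fc [K fK].
have trig q : trigpoly q ->
    \int[P]_w q (X n w) @[n --> \oo] --> \int[P']_w q (G w).
  elim=> [a c|g h tg Hg th Hh|k g tg Hg]; first exact: cf.
  - have [Kg gK] := trigpoly_bounded tg; have [Kh hK] := trigpoly_bounded th.
    rewrite ERD; first last.
    + by apply: (@integ_bounded _ _ _ _ _ Kh) => //; exact: measurable_trigpoly.
    + by apply: (@integ_bounded _ _ _ _ _ Kg) => //; exact: measurable_trigpoly.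
    under eq_fun => n.
      rewrite ERD; first last.
      + by apply: (@integ_bounded _ _ _ _ _ Kh) => //; exact: measurable_trigpoly.
      + by apply: (@integ_bounded _ _ _ _ _ Kg) => //; exact: measurable_trigpoly.
      over.
    exact: cvgD.
  - have [Kg gK] := trigpoly_bounded tg.
    rewrite ERZ; last first.
      by apply: (@integ_bounded _ _ _ _ _ Kg) => //; exact: measurable_trigpoly.
    under eq_fun => n.
      rewrite ERZ; last first.
        by apply: (@integ_bounded _ _ _ _ _ Kg) => //; exact: measurable_trigpoly.
      over.
    by apply: cvgM => //; exact: cvg_cst.
have K0 : 0 <= K by apply: le_trans (fK 0).
apply/cvgrPdist_le => e e0.
pose e1 := e / (5 * (1 + K * d%:R)).
have D0 : 0 < 1 + K * d%:R by rewrite ltr_wpDr // mulr_ge0.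
have e10 : 0 < e1 by rewrite divr_gt0 // mulr_gt0.
have e1E : 5 * (e1 + K * (d%:R * e1)) = e.
  by rewrite /e1; field; rewrite gt_eqF.
have mtail (dU : measure_display) (U : measurableType dU) (Y : U -> 'rV[R]_d) (L : R) k :
    random_vector Y -> measurable [set w | L < `|Y w 0 k|].
  move=> rvY; apply: measurable_set_lt => //.
  by apply: measurableT_comp => //; exact: rvY.
have HX k : exists L : R, \forall n \near \oo, pr P [set w | L < `|X n w 0 k|] <= e1.
  have [L HL] := tX k e1 e10; exists L; apply: filterS HL => n.
  by rewrite -prE ?lee_fin //; exact: mtail.
have HG k : exists L : R, pr P' [set w | L < `|G w 0 k|] <= e1.
  exact: tight_random_variable.
have /choice[LX HLX] := HX; have /choice[LG HLG] := HG.
pose L := \big[Num.max/0]_k Num.max (LX k) (LG k).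
have L0 : 0 <= L by exact: bigmax_ge_id.
have LXL k : LX k <= L.
  by apply: (le_trans _ (le_bigmax _ _ k)); rewrite le_max lexx.
have LGL k : LG k <= L.
  by apply: (le_trans _ (le_bigmax _ _ k)); rewrite le_max lexx orbT.
have [q [tq qK qf]] := trigpoly_approx L fc fK e10.
have approx (dU : measure_display) (U : measurableType dU) (PU : probability U R)
    (Y : U -> 'rV[R]_d) : random_vector Y ->
    (forall k, pr PU [set w | L < `|Y w 0 k|] <= e1) ->
    `|\int[PU]_w f (Y w) - \int[PU]_w q (Y w)| <= e1 + 2 * K * (d%:R * e1).
  move=> rvY Ytail.
  have mf := measurable_continuous_bounded rvY fc fK.
  have mq := measurable_trigpoly rvY tq.
  rewrite -ERB; [|exact: (integ_bounded PU mf (fun w => fK (Y w)))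
    |exact: (integ_bounded PU mq (fun w => qK (Y w)))].
  pose A := [set w | exists k, L < `|Y w 0 k|].
  have mA : measurable A.
    have -> : A = \bigcup_(k in [set: 'I_d]) [set w | L < `|Y w 0 k|].
      by apply/seteqP; split => w /= [k]; [exists k|move=> _; exists k].
    by apply: fin_bigcup_measurable => [|k _]; [exact: finite_finset|exact: mtail].
  have prA : pr PU A <= d%:R * e1.
    apply: le_trans (pr_bigcup_ord _ _) _; first by move=> k; exact: mtail.
    rewrite (_ : d%:R * e1 = \sum_(k < d) e1); last by rewrite sumr_const card_ord mulr_natl.
    by apply: ler_sum => k _; exact: Ytail.
  apply: (@le_trans _ _ (e1 + 2 * K * pr PU A)); last first.
    by rewrite lerD2l ler_wpM2l // mulr_ge0.
  apply: ERsmall => //; [exact: measurable_funB| |move=> w Aw|exact: ltW].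
    move=> w; apply: le_trans (ler_normB _ _) _.
    by rewrite mulr_natl mulr2n; exact: lerD.
  apply: qf; apply: norm_le_coord => // k; rewrite leNgt; apply/negP => Lk.
  by apply: Aw; exists k.
have qlim := trig q tq.
near=> n.
have HnX0 : forall k, pr P [set w | LX k < `|X n w 0 k|] <= e1.
  by near: n; apply: filter_forall => k; exact: HLX.
have HnX k : pr P [set w | L < `|X n w 0 k|] <= e1.
  apply: (@le_trans _ _ (pr P [set w | LX k < `|X n w 0 k|])).
    by apply: pr_le; [exact: mtail|exact: mtail|move=> w /=; exact: le_lt_trans].
  exact: HnX0.
have HnG k : pr P' [set w | L < `|G w 0 k|] <= e1.
  apply: (@le_trans _ _ (pr P' [set w | LG k < `|G w 0 k|])) => //.
  by apply: pr_le; [exact: mtail|exact: mtail|move=> w /=; exact: le_lt_trans].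
have A1 := approx _ _ P _ (rvX n) HnX.
have A2 := approx _ _ P' _ rvG HnG.
have A3 : `|\int[P']_w q (G w) - \int[P]_w q (X n w)| <= e1.
  by near: n; move/cvgrPdist_le : qlim; apply.
have -> : \int[P']_w f (G w) - \int[P]_w f (X n w) =
  (\int[P']_w f (G w) - \int[P']_w q (G w)) +
  (\int[P']_w q (G w) - \int[P]_w q (X n w)) -
  (\int[P]_w f (X n w) - \int[P]_w q (X n w)) by ring.
apply: le_trans (ler_normB _ _) _.
apply: le_trans (lerD (ler_normD _ _) (lexx _)) _.
have : 0 <= K * (d%:R * e1) by rewrite mulr_ge0 // mulr_ge0 // ltW.
lra.
Unshelve. all: by end_near. Qed.

End ContinuityTheorem.

(** * Existence of Gaussian vectors *)

Section LawUniqueness.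
Context {R : realType} {dT : measure_display} {T : measurableType dT}.
Variables (P : probability T R) (N : probability (measurableTypeR R) R) (g : T -> R).
Hypothesis mg : measurable_fun [set: T] g.
Hypothesis cosE : forall c t,
  \int[P]_w cos (c + t * g w) = \int[N]_y cos (c + t * y).

Let Rintegral_eq (F : R -> R) : continuous F -> (exists K, forall y, `|F y| <= K) ->
  \int[P]_w F (g w) = \int[N]_y F y.
Proof.
move=> cF [K FK].
pose X (n : nat) w : 'rV[R]_1 := \row_(k < 1) g w.
pose G y : 'rV[R]_1 := \row_(k < 1) y.
have dX (a : 'rV[R]_1) (y : R) : dot a (\row_(k < 1) y) = a 0 0 * y.
  by rewrite dotE big_ord1 mxE.
have : cvg_in_dist P N X G.
  apply: levy_continuity.
  - by move=> n k; under eq_fun do rewrite mxE.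
  - by move=> k; under eq_fun do rewrite mxE; exact: measurable_id.
  - move=> k e e0; have [L HL] := tight_random_variable P mg e0.
    exists L; near=> n; under eq_set do rewrite mxE.
    rewrite -prE ?lee_fin //; apply: measurable_set_lt => //.
    exact: measurableT_comp.
  - move=> a c.
    rewrite (_ : (fun n => _) = fun=> \int[N]_y cos (c + dot a (G y))).
      exact: cvg_cst.
    apply/funext => n; under eq_Rintegral do rewrite dX.
    by rewrite cosE; apply: eq_Rintegral => y _; rewrite dX.
move=> /(_ (fun x => F (x 0 0))) H.
have {H} : \int[P]_w F (X n w 0 0) @[n --> \oo] --> \int[N]_w F (G w 0 0).
  apply: H; last by exists K.
  by move=> x; apply: continuous_comp; [exact: coord_continuous|exact: cF].
have -> : (fun n => \int[P]_w F (X n w 0 0)) = fun=> \int[P]_w F (g w).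
  by apply/funext => n; apply: eq_Rintegral => w _; rewrite mxE.
have -> : \int[N]_w F (G w 0 0) = \int[N]_y F y.
  by apply: eq_Rintegral => w _; rewrite mxE.
by move=> /(cvg_lim (@Rhausdorff R)) <-; rewrite lim_cst.
Unshelve. all: by end_near. Qed.

Let ray r : P (g @^-1` `]-oo, r[%classic) = N `]-oo, r[%classic.
Proof.
(* continuous functions that increase to the indicator of the half-line *)
pose F (n : nat) (y : R) := Num.min 1 (Num.max 0 (n%:R * (r - y))).
have cF n : continuous (F n).
  rewrite (_ : F n = (cst 1 : R -> R^o) \min
    ((cst 0 : R -> R^o) \max (fun y => n%:R * (r - y) : R^o))) //.
  move=> y; apply: continuous_min; first exact: cvg_cst.
  apply: continuous_max; first exact: cvg_cst.
  apply: cvgM; first exact: cvg_cst.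
  by apply: cvgB; [exact: cvg_cst|exact: cvg_id].
have F01 n y : 0 <= F n y <= 1.
  by rewrite /F le_min ler01 le_max lexx /= ge_min lexx.
have F1 n y : `|F n y| <= 1 by have /andP[? ?] := F01 n y; rewrite ger0_norm.
have Flim y : F n y @[n --> \oo] --> (\1_(`]-oo, r[%classic) y : R).
  rewrite indicE; have [yr|yr] := boolP (y \in _); move: yr.
    rewrite inE /= in_itv /= => yr.
    apply: cvg_near_cst; near=> n.
    rewrite /F /=; apply/min_idPl; rewrite le_max; apply/orP; right.
    rewrite -ler_pdivrMr ?subr_gt0 // mul1r.
    near: n; exact: nbhs_infty_ger.
  rewrite notin_setE /= in_itv /= => /negP; rewrite -leNgt => ry.
  apply: cvg_near_cst; near=> n.
  rewrite /F (max_idPl _); first by rewrite min_r.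
  by rewrite mulr_ge0_le0 // subr_le0.
have mi : measurable (`]-oo, r[%classic : set R) by exact: measurable_itv.
have mgi : measurable (g @^-1` `]-oo, r[%classic).
  by rewrite -[X in measurable X]setTI; exact: mg.
have L1 : \int[N]_y F n y @[n --> \oo] --> pr N `]-oo, r[%classic.
  rewrite -(ERindic N mi); apply: (@ER_dominated _ _ _ N _ _ (fun=> 1)) => //.
    by move=> n; exact: continuous_measurable_fun.
  exact: integ_cst.
have L2 : \int[P]_w F n (g w) @[n --> \oo] --> pr P (g @^-1` `]-oo, r[%classic).
  rewrite -(ERindic P mgi); apply: (@ER_dominated _ _ _ P _ _ (fun=> 1)) => //.
  - move=> n; apply: measurableT_comp => //.
    exact: continuous_measurable_fun.
  - exact: integ_cst.
rewrite -(prE P mgi) -(prE N mi); congr (_%:E).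
apply: (cvg_unique (@Rhausdorff R) L2).
have -> : (fun n => \int[P]_w F n (g w)) = (fun n => \int[N]_y F n y).
  by apply/funext => n; apply: Rintegral_eq => //; exists 1.
exact: L1.
Unshelve. all: by end_near. Qed.

(** Equality of the cosine transforms is a constant sequence converging in
    distribution, so that the means of bounded continuous functions agree; these
    determine the law through half-lines. *)
Lemma cos_has_law : has_law P g (N : set R -> \bar R).
Proof.
split=> // A mA.
have mgA S : measurable S -> measurable (g @^-1` S).
  by move=> mS; rewrite -[X in measurable X]setTI; exact: mg.
pose Q (S : set R) := P (g @^-1` S) = N S.
apply: (@dynkin_induction _ _ (@RGenInftyO.G R) Q) => //.
- exact: RGenInftyO.measurableE.
- move=> _ _ [x ->] [y ->]; exists (Num.min x y).
  by apply/seteqP; split => z /=; rewrite !in_itv /= lt_min => /andP.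
- rewrite /Q preimage_setT.
  by transitivity (1%E : \bar R); [exact: probability_setT|apply/esym; exact: probability_setT].
- by move=> _ [r ->]; exact: ray.
- move=> S mS QS; rewrite /Q preimage_setC.
  by rewrite (probability_setC P (mgA _ mS)) (probability_setC N mS) QS.
- move=> F mF tF QF; rewrite /Q preimage_bigcup.
  have tF' i j : i != j -> F i `&` F j = set0 by move/trivIsetP : tF; apply.
  rewrite measure_semi_bigcup //; first last.
  + by apply: bigcup_measurable => k _; exact: mgA.
  + apply/trivIsetP => i j _ _ ij.
    by rewrite -preimage_setI tF' // preimage_set0.
  + by move=> i; exact: mgA.
  rewrite [in RHS]measure_semi_bigcup; first last.
  + by apply: bigcup_measurable => k _; exact: mF.
  + exact: tF.
  + exact: mF.
  by apply: eq_eseriesr => i _; exact: QF.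
- have E : (measurable : set (set R)) = <<s @RGenInftyO.G R >> := RGenInftyO.measurableE R.
  by rewrite -E.
Qed.

End LawUniqueness.

Section GaussianVectors.
Context {R : realType} {d : nat}.

(** One factor [normal_prob 0 1] is added to the probability space for each
    vector [b], as an independent coefficient of [b]. *)
Lemma gaussian_of_vectors (bs : seq 'rV[R]_d) :
  exists (dT : measure_display) (T : measurableType dT) (P : probability T R)
    (G : T -> 'rV[R]_d), random_vector G /\
    forall a c, \int[P]_w cos (c + dot a (G w)) =
      expR (- ((\sum_(b <- bs) dot a b ^+ 2) / 2)) * cos c.
Proof.
elim: bs => [|b bs [dT [T [P [G [rvG cfG]]]]]].
  exists _, _, (normal_prob (0 : R) 1 : probability (measurableTypeR R) R), (fun=> 0); split.
    by move=> k; exact: measurable_cst.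
  move=> a c; rewrite big_nil mul0r oppr0 expR0 mul1r.
  have -> : (fun w : R => cos (c + dot a (0 : 'rV[R]_d))) = fun=> cos c.
    by apply/funext => w; rewrite dotC dot0l addr0.
  by rewrite ERcst.
pose N : probability (measurableTypeR R) R := normal_prob (0 : R) 1.
exists _, _, ((P \x N)%E : probability (T * measurableTypeR R)%type R), (fun z => G z.1 + z.2 *: b); split.
  move=> k; under eq_fun do rewrite !mxE.
  apply: measurable_funD; last by apply: measurable_funM => //.
  by apply: (measurableT_comp (rvG k)).
move=> a c; pose Phi (z : T * R) := cos (c + dot a (G z.1 + z.2 *: b)).
have PhiE z : Phi z = cos ((c + dot a (G z.1)) + dot a b * z.2).
  by rewrite /Phi dotDr dotZr; congr cos; ring.
have mPhi : measurable_fun [set: T * R] Phi.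
  rewrite (funext PhiE); apply: (measurableT_comp (@measurable_cos R)).
  apply: measurable_funD; last by apply: measurable_funM.
  apply: measurable_funD => //.
  by apply: (measurableT_comp (measurable_dot rvG a)).
have iPhi : integ (P \x N)%E Phi.
  by apply: (@integ_bounded _ _ _ (P \x N)%E _ 1 mPhi) => z; exact: cos_max.
pose e := expR (- (dot a b ^+ 2 / 2)).
have inner x : \int[N]_y Phi (x, y) = e * cos (c + dot a (G x)).
  rewrite (funext (fun y => PhiE (x, y))) /= normal_cos ?oner_neq0 //.
  by rewrite expr1n mul1r.
have mI : measurable_fun [set: T] (fun w => cos (c + dot a (G w))).
  exact: measurable_cos_dot.
have iI : integ P (fun w => cos (c + dot a (G w))).
  by apply: (@integ_bounded _ _ _ P _ 1 mI) => z; exact: cos_max.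
have iy x : integ N (fun y => Phi (x, y)).
  apply: (@integ_bounded _ _ _ N _ 1) => [|y]; last exact: cos_max.
  by apply: (measurableT_comp mPhi); exact: measurable_pair1.
have E : \int[(P \x N)%E]_z Phi z = \int[P]_x (e * cos (c + dot a (G x))).
  apply: EFin_inj; rewrite (EFin_Rintegral iPhi) (EFin_Rintegral (integZ e iI)).
  rewrite -integral12_prod_meas1 //; apply: eq_integral => x _.
  by rewrite /fubini_F -(EFin_Rintegral (iy x)) inner.
rewrite E ERZ // cfG big_cons mulrDl opprD expRD -/e; ring.
Qed.

(** A Gaussian vector with a prescribed covariance is a combination of
    independent standard normal variables; the uniqueness
    lemma [cos_has_law] identifies the law of its coordinates. *)
Lemma gaussian_vector_exists (V : 'M[R]_d) : psd V ->
  exists (dT : measure_display) (T : measurableType dT) (P : probability T R)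
    (G : T -> 'rV[R]_d), centered_normal_vector P G V /\
    forall a c, \int[P]_w cos (c + dot a (G w)) =
      expR (- (quad V a / 2)) * cos c.
Proof.
move=> pV; have [bs bsE] := psd_sum_outer pV.
have [dT [T [P [G [rvG cfG]]]]] := gaussian_of_vectors bs.
have cf a c : \int[P]_w cos (c + dot a (G w)) = expR (- (quad V a / 2)) * cos c.
  by rewrite cfG bsE.
exists dT, T, P, G; split=> //; split=> // a; rewrite -/(quad V a) /=.
have mG := measurable_dot rvG a.
have cfa c t : \int[P]_w cos (c + t * dot a (G w)) =
    expR (- (quad V a * t ^+ 2 / 2)) * cos c.
  have -> : (fun w => cos (c + t * dot a (G w))) =
      (fun w => cos (c + dot (t *: a) (G w))).
    by apply/funext => w; rewrite dotZl.
  by rewrite cf quadZ [t ^+ 2 * _]mulrC.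
case: (eqVneq (quad V a) 0) => v0.
  apply: (@cos_has_law _ _ _ P (dirac (0 : measurableTypeR R)) _ mG) => c t.
  rewrite cfa v0 !mul0r oppr0 expR0 mul1r /Rintegral integral_dirac //.
    by rewrite diracT mul1e /= mulr0 addr0.
  apply/measurable_EFinP; apply: (measurableT_comp (@measurable_cos R)).
  by apply: measurable_funD => //; exact: measurable_funM.
pose N : probability (measurableTypeR R) R := normal_prob (0 : R) (Num.sqrt (quad V a)).
refine (@cos_has_law R dT T P N (fun w => dot a (G w)) mG _) => c t.
have vp : 0 < quad V a by rewrite lt_def v0; exact: pV.2.
by rewrite cfa normal_cos ?sqrtr_eq0 -?ltNge // sqr_sqrtr // ltW.
Qed.

End GaussianVectors.

(** * Second-order Taylor expansions *)

Section DirectionalDerivatives.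
Context {R : realType} {d : nat}.
Implicit Types (f : 'rV[R]_d -> R) (x v t : 'rV[R]_d).

Lemma enorm_le_norm v : enorm v <= d%:R * `|v|.
Proof.
have dn0 : 0 <= d%:R * `|v| by rewrite mulr_ge0.
rewrite /enorm -[leRHS](ger0_norm dn0) -sqrtr_sqr ler_wsqrtr //.
apply: (@le_trans _ _ (d%:R * `|v| ^+ 2)); last first.
  rewrite exprMn ler_wpM2r ?sqr_ge0 // -natrX ler_nat.
  by case: d => // n; rewrite expnS leq_pmulr.
rewrite (_ : d%:R * _ = \sum_(k < d) `|v| ^+ 2); last first.
  by rewrite sumr_const card_ord mulr_natl.
apply: ler_sum => k _; rewrite -(real_normK (num_real (v 0 k))).
by rewrite lerXn2r ?nnegrE // coord_le_norm.
Qed.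

Lemma grad_dot f x v : differentiable f x -> 'D_v f x = dot (grad f x) v.
Proof.
move=> df; rewrite deriveE // [in LHS](row_sum_delta v) linear_sum /= dotE.
by apply: eq_bigr => k _; rewrite linearZ /= mxE deriveE // mulrC.
Qed.

Lemma is_derive_line f x v (s : R) : differentiable f (x + s *: v) ->
  is_derive s 1 (fun s : R => f (x + s *: v)) (dot (grad f (x + s *: v)) v).
Proof.
move=> df; have [/= dv Dv] := derivableP (diff_derivable (v := v) df).
have E : (fun h : R => h^-1 *: (((fun s : R => f (x + s *: v)) \o shift s) (h *: 1) - f (x + s *: v))) =
    (fun h : R => h^-1 *: ((f \o shift (x + s *: v)) (h *: v) - f (x + s *: v))).
  apply/funext => h /=; congr (_ *: (f _ - _)).
  rewrite (_ : h *: 1 = h); last by rewrite /GRing.scale /= mulr1.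
  by rewrite scalerDl addrCA.
apply: DeriveDef; first by rewrite /derivable E.
by rewrite /derive E -(grad_dot v df).
Qed.

Lemma mvt_unit_interval (phi phi' : R -> R) (B : R) :
  (forall s : R, is_derive s 1 phi (phi' s)) ->
  (forall s, 0 <= s <= 1 -> `|phi' s| <= B) ->
  forall s, 0 <= s <= 1 -> `|phi s - phi 0| <= B.
Proof.
move=> dphi bphi s /andP[s0 s1].
have pc : continuous phi.
  move=> y; apply/differentiable_continuous/derivable1_diffP.
  by have /@ex_derive := dphi y.
have [|c] := @MVT_segment _ phi phi' 0 s s0 (fun y _ => dphi y).
  by apply: continuous_subspaceT => y; exact: pc.
rewrite in_itv /= => /andP[c0 cs] ->.
have B0 : 0 <= B by apply: le_trans (bphi 0 _); rewrite ?lexx ?ler01.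
rewrite subr0 normrM (ger0_norm s0) -[leRHS]mulr1 ler_pM //.
by apply: bphi; rewrite c0 (le_trans cs).
Qed.

Lemma mulmx_coordB_le v (A B : 'M[R]_d) l (C : R) :
  (forall k, `|A k l - B k l| <= C) ->
  `|(v *m A) 0 l - (v *m B) 0 l| <= d%:R * `|v| * C.
Proof.
move=> AB; rewrite !mxE -sumrB.
apply: le_trans (ler_norm_sum _ _ _) _.
rewrite (_ : _ * _ * _ = \sum_(k < d) `|v| * C); last first.
  by rewrite sumr_const card_ord -mulrA mulr_natl.
apply: ler_sum => k _; rewrite -mulrBr normrM ler_pM //.
exact: coord_le_norm.
Qed.

Section Taylor.
Variables (f : 'rV[R]_d -> R) (x v : 'rV[R]_d) (psi : R).
Hypothesis tdf : twice_differentiable f.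
Hypothesis hlip : forall s k l, 0 <= s <= 1 ->
  `|hess f (x + s *: v) k l - hess f x k l| <= psi * enorm (s *: v).

Let C := d%:R * `|psi| * `|v|.

Let hlipC s k l : 0 <= s <= 1 -> `|hess f (x + s *: v) k l - hess f x k l| <= C.
Proof.
move=> s01; apply: le_trans (hlip k l s01) _.
have e0 : 0 <= enorm (s *: v) by exact: sqrtr_ge0.
apply: (@le_trans _ _ (`|psi| * enorm (s *: v))).
  by rewrite ler_wpM2r // ler_norm.
have -> : C = `|psi| * (d%:R * `|v|) by rewrite /C; ring.
rewrite ler_wpM2l //; apply: le_trans (enorm_le_norm _) _.
rewrite ler_wpM2l // normrZ; case/andP: s01 => s0 s1.
by rewrite (ger0_norm s0) ler_piMl.
Qed.

Let is_derive_grad l (s : R) : is_derive s 1 (fun s : R => grad f (x + s *: v) 0 l)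
  ((v *m hess f (x + s *: v)) 0 l).
Proof.
have dg : differentiable (fun u => grad f u 0 l) (x + s *: v).
  apply: (differentiable_comp (f := grad f) (g := fun N : 'rV[R]_d => N 0 l)).
    by have [] := tdf (x + s *: v).
  exact: differentiable_coord.
have := is_derive_line dg; congr (is_derive _ _ _ _).
rewrite dotE mxE; apply: eq_bigr => k _.
by rewrite !mxE mulrC.
Qed.

Let d2_bound (l : 'I_d) s : 0 <= s <= 1 ->
  `|(v *m hess f (x + s *: v)) 0 l - (v *m hess f x) 0 l| <= d%:R * `|v| * C.
Proof.
by move=> s01; apply: mulmx_coordB_le => k; exact: hlipC.
Qed.

(** The mean value theorem along the segment, for the gradient minus its affine
    part. *)
Lemma grad_taylor l :
  `|grad f (x + v) 0 l - grad f x 0 l - (v *m hess f x) 0 l| <= d%:R * `|v| * C.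
Proof.
pose phi (s : R) := grad f (x + s *: v) 0 l - s * (v *m hess f x) 0 l.
have dphi (s : R) : is_derive s 1 phi
    ((v *m hess f (x + s *: v)) 0 l - (v *m hess f x) 0 l).
  apply: (is_deriveB (is_derive_grad l s)).
  by apply: is_derive_eq; rewrite /GRing.scale /= mulr0 add0r mulr1.
have := mvt_unit_interval dphi (d2_bound l) (s := 1).
rewrite ler01 lexx /phi !scale1r !scale0r !mul0r mul1r addr0 subr0 => /(_ isT).
by rewrite addrAC.
Qed.

(** The constants are crude (powers of the dimension), which costs nothing in
    the limit. *)
Lemma taylor2 :
  `|f (x + v) - f x - dot (grad f x) v - quad (hess f x) v / 2| <=
  d%:R * `|v| * (d%:R * `|v| * C).
Proof.
set B := leRHS.
have df (s : R) : is_derive s 1 (fun s : R => f (x + s *: v)) (dot (grad f (x + s *: v)) v).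
  by apply: is_derive_line; have [] := tdf (x + s *: v).
pose rho (s : R) := dot (grad f (x + s *: v)) v - dot (grad f x) v - s * quad (hess f x) v.
have drho (s : R) : 0 <= s <= 1 -> `|rho s| <= B.
  move=> s01.
  have -> : rho s = \sum_l (grad f (x + s *: v) 0 l - grad f x 0 l -
     s * (v *m hess f x) 0 l) * v 0 l.
    rewrite /rho quadE !dotE mulr_sumr -!sumrB; apply: eq_bigr => l _; ring.
  apply: le_trans (ler_norm_sum _ _ _) _.
  rewrite /B (_ : d%:R * `|v| * _ = \sum_(k < d) `|v| * (d%:R * `|v| * C)); last first.
    by rewrite sumr_const card_ord -[LHS]mulrA mulr_natl.
  apply: ler_sum => l _; rewrite normrM [leRHS]mulrC ler_pM //; last exact: coord_le_norm.
  pose phi (s : R) := grad f (x + s *: v) 0 l - s * (v *m hess f x) 0 l.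
  have dphi (t : R) : is_derive t 1 phi
      ((v *m hess f (x + t *: v)) 0 l - (v *m hess f x) 0 l).
    apply: (is_deriveB (is_derive_grad l t)).
    by apply: is_derive_eq; rewrite /GRing.scale /= mulr0 add0r mulr1.
  have := mvt_unit_interval dphi (d2_bound l) s01.
  by rewrite /phi !scale0r !mul0r addr0 subr0 addrAC.
pose kap (s : R) := f (x + s *: v) - s * dot (grad f x) v - s ^+ 2 / 2 * quad (hess f x) v.
have dkap (s : R) : is_derive s 1 kap (rho s).
  have d1 := df s.
  have d2 : is_derive s 1 (fun s : R => s * dot (grad f x) v) (dot (grad f x) v).
    by apply: is_derive_eq; rewrite /GRing.scale /= mulr0 add0r mulr1.
  have d3 : is_derive s 1 (fun s : R => s ^+ 2 / 2 * quad (hess f x) v) (s * quad (hess f x) v).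
    by apply: is_derive_eq; rewrite /GRing.scale /=; field.
  by apply: is_deriveB.
have := mvt_unit_interval dkap drho (s := 1).
rewrite ler01 lexx => /(_ isT); rewrite /kap.
rewrite scale1r scale0r addr0 !mul0r mul1r expr1n expr0n /= !mul0r !subr0.
by congr (`|_| <= _); ring.
Qed.

End Taylor.
End DirectionalDerivatives.

(** A derivative is a limit of the difference quotients along
    [n.+1%:R^-1]. *)
Lemma measurable_derive (R : realType) (d : nat) (dE : measure_display)
    (E : measurableType dE) (g : E -> 'rV[R]_d -> R) (t v : 'rV[R]_d) :
  (forall t, measurable_fun [set: E] (g ^~ t)) ->
  (forall z, differentiable (g z) t) ->
  measurable_fun [set: E] (fun z => 'D_v (g z) t).
Proof.
move=> mg dg.
pose h (n : nat) z := n.+1%:R * (g z (n.+1%:R^-1 *: v + t) - g z t).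
apply: (@measurable_fun_cvg _ _ _ _ h).
  by move=> n; apply: measurable_funM => //; exact: measurable_funB.
move=> z _; have := diff_derivable (v := v) (dg z).
rewrite /derivable => /cvg_ex[l cl].
have -> : 'D_v (g z) t = l by exact: (cvg_lim (@Rhausdorff R) cl).
have hn : n.+1%:R^-1 @[n --> \oo] --> (0 : R)^'.
  move=> A /= [e e0 eA]; suff : \forall n \near \oo, A n.+1%:R^-1 by [].
  near=> n.
  have n0 : n.+1%:R^-1 != 0 :> R by rewrite invr_eq0 pnatr_eq0.
  apply: (eA _ _ n0); rewrite /= sub0r normrN ger0_norm //.
  by near: n; exact: near_infty_natSinv_lt (PosNum e0).
have cn := cvg_comp _ _ hn cl.
rewrite (_ : (fun n => h n z) = (fun x : R => x^-1 *: ((g z \o shift t) (x *: v) - g z t))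
  \o (fun n : nat => n.+1%:R^-1)) //.
by apply/funext => n; rewrite /h /= invrK.
Unshelve. all: by end_near. Qed.

(** * The population criterion *)

Section Population.
Context {R : realType} {d : nat} {dE : measure_display} {E : measurableType dE}.
Variables (Q : probability E R) (m : E -> 'rV[R]_d -> R) (Theta : set 'rV[R]_d).
Variable psi : E -> R.
Hypothesis m_meas : forall t, measurable_fun [set: E] (m ^~ t).
Hypothesis m_diff : forall z, twice_differentiable (m z).
Hypothesis m_L2 : forall t, Theta t -> integ Q (fun z => m z t ^+ 2).
Hypothesis hess_L2 : forall t k l, Theta t ->
  integ Q (fun z => hess (m z) t k l ^+ 2).
Hypothesis psi_meas : measurable_fun [set: E] psi.
Hypothesis psi_L2 : integ Q (fun z => psi z ^+ 2).
Hypothesis hess_lip : forall z t1 t2 k l, Theta t1 -> Theta t2 ->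
  `|hess (m z) t1 k l - hess (m z) t2 k l| <= psi z * enorm (t1 - t2).
Hypothesis grad_L2 : forall t k l, Theta t ->
  integ Q (fun z => outer (grad (m z) t) k l).

Lemma interior_ball t : interior Theta t ->
  exists2 r : R, 0 < r & forall u, `|u - t| <= r -> Theta u.
Proof.
move=> /nbhs_ballP[r /= r0 rT]; exists (r / 2); first by rewrite divr_gt0.
move=> u ur; apply: rT; rewrite -ball_normE /= distrC.
by apply: le_lt_trans ur _; rewrite ltr_pdivrMr // ltr_pMr // ltr1n.
Qed.

Lemma measurable_grad t k : measurable_fun [set: E] (fun z => grad (m z) t 0 k).
Proof.
under eq_fun do rewrite mxE.
by apply: measurable_derive => // z; have [] := m_diff z t.
Qed.

Lemma differentiable_grad z t l : differentiable (fun u => grad (m z) u 0 l) t.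
Proof.
apply: (differentiable_comp (f := grad (m z)) (g := fun N : 'rV[R]_d => N 0 l)).
  by have [] := m_diff z t.
exact: differentiable_coord.
Qed.

Lemma measurable_hess t k l : measurable_fun [set: E] (fun z => hess (m z) t k l).
Proof.
under eq_fun do rewrite mxE.
apply: (@measurable_derive _ _ _ _ (fun z u => grad (m z) u 0 l)).
  by move=> u; exact: measurable_grad.
by move=> z; exact: differentiable_grad.
Qed.

Lemma integ_m t : Theta t -> integ Q (m ^~ t).
Proof. by move=> Tt; apply: integ_of_sqr (m_L2 Tt). Qed.

Lemma outerE (v : 'rV[R]_d) k l : outer v k l = v 0 k * v 0 l.
Proof. by rewrite /outer mxE big_ord1 mxE. Qed.

Lemma integ_grad_sqr t k : Theta t -> integ Q (fun z => grad (m z) t 0 k ^+ 2).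
Proof.
move=> Tt; have := grad_L2 k k Tt.
by under eq_fun do rewrite outerE -expr2.
Qed.

Lemma integ_grad t k : Theta t -> integ Q (fun z => grad (m z) t 0 k).
Proof. by move=> Tt; apply: integ_of_sqr (integ_grad_sqr k Tt); exact: measurable_grad. Qed.

Lemma integ_hess t k l : Theta t -> integ Q (fun z => hess (m z) t k l).
Proof. by move=> Tt; apply: integ_of_sqr (hess_L2 k l Tt); exact: measurable_hess. Qed.

Lemma integ_psi : integ Q (fun z => `|psi z|).
Proof. by apply: integ_norm; apply: integ_of_sqr psi_L2. Qed.

(** On a ball inside the parameter set the Hessian is Lipschitz along
    segments. *)
Lemma taylor_ball z t r v : 0 < r -> (forall u, `|u - t| <= r -> Theta u) ->
  `|v| <= r ->
  `|m z (t + v) - m z t - dot (grad (m z) t) v - quad (hess (m z) t) v / 2| <=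
    d%:R ^+ 3 * `|psi z| * `|v| ^+ 3.
Proof.
move=> r0 ball vr.
apply: le_trans (@taylor2 _ _ (m z) t v (psi z) (m_diff z) _) _; last first.
  by rewrite le_eqVlt; apply/orP; left; apply/eqP; ring.
move=> s k l /andP[s0 s1].
have -> : enorm (s *: v) = enorm (t + s *: v - t) by rewrite addrAC subrr add0r.
apply: hess_lip; apply: ball; last by rewrite subrr normr0 ltW.
rewrite addrAC subrr add0r normrZ (ger0_norm s0).
by apply: le_trans vr; rewrite ler_piMl.
Qed.

Lemma grad_taylor_ball z t r v l : 0 < r -> (forall u, `|u - t| <= r -> Theta u) ->
  `|v| <= r ->
  `|grad (m z) (t + v) 0 l - grad (m z) t 0 l - (v *m hess (m z) t) 0 l| <=
    d%:R ^+ 2 * `|psi z| * `|v| ^+ 2.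
Proof.
move=> r0 ball vr.
apply: le_trans (@grad_taylor _ _ (m z) t v (psi z) (m_diff z) _ l) _; last first.
  by rewrite le_eqVlt; apply/orP; left; apply/eqP; ring.
move=> s k j /andP[s0 s1].
have -> : enorm (s *: v) = enorm (t + s *: v - t) by rewrite addrAC subrr add0r.
apply: hess_lip; apply: ball; last by rewrite subrr normr0 ltW.
rewrite addrAC subrr add0r normrZ (ger0_norm s0).
by apply: le_trans vr; rewrite ler_piMl.
Qed.

Let norm_hdelta (h : R) (k : 'I_d) : `|h *: (delta_mx 0 k : 'rV[R]_d)| <= `|h|.
Proof.
apply: norm_le_coord => // j; rewrite !mxE eqxx /=.
by case: (j == k); rewrite ?mulr1 ?mulr0 ?normr0.
Qed.

Let M t := \int[Q]_z m z t.

(** Integrating the pointwise expansion gives one for the mean, because the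
    Lipschitz factor [psi] is integrable: differentiation under the integral
    without domination of the derivatives. *)
Lemma mean_taylor t r k : 0 < r -> (forall u, `|u - t| <= r -> Theta u) ->
  exists C : R, forall h, `|h| < r ->
    `|M (t + h *: delta_mx 0 k) - M t - h * \int[Q]_z grad (m z) t 0 k| <= C * h ^+ 2.
Proof.
move=> r0 ball.
have Tt : Theta t by apply: ball; rewrite subrr normr0 ltW.
pose K z := 2^-1 * `|hess (m z) t k k| + (d%:R ^+ 3 * r) * `|psi z|.
have iK : integ Q K.
  apply: integD; apply: integZ; last exact: integ_psi.
  by apply: integ_norm; exact: integ_hess.
exists (\int[Q]_z K z) => h hr.
set v := h *: _; have vh : `|v| <= `|h| by exact: norm_hdelta.
have vr : `|v| <= r by apply: le_trans vh (ltW hr).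
have Ttv : Theta (t + v) by apply: ball; rewrite addrAC subrr add0r.
have i1 := integ_m Tt; have i2 := integ_m Ttv; have i3 := integ_grad k Tt.
rewrite /M -ERZ // -ERB // -ERB //; last exact: integZ; last exact: integB.
rewrite mulrC -ERZ //.
apply: ERnorm_le; [by apply: integB; [exact: integB|exact: integZ]|exact: integZ|].
move=> z; have := taylor_ball z r0 ball vr.
rewrite /v dotZr dotC dot_delta quadZ quad_delta -/v => T.
have -> : m z (t + v) - m z t - h * grad (m z) t 0 k =
  (m z (t + v) - m z t - h * grad (m z) t 0 k - h ^+ 2 * hess (m z) t k k / 2) +
  h ^+ 2 * (2^-1 * hess (m z) t k k) by ring.
apply: le_trans (ler_normD _ _) _.
rewrite /K mulrDr addrC; apply: lerD.
  by rewrite normrM [`|h ^+ 2|]ger0_norm ?sqr_ge0 // normrM [`|2^-1|]ger0_norm.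
apply: le_trans T _.
have -> : h ^+ 2 * (d%:R ^+ 3 * r * `|psi z|) = d%:R ^+ 3 * `|psi z| * (`|h| ^+ 2 * r).
  by rewrite real_normK ?num_real //; ring.
rewrite ler_wpM2l ?mulr_ge0 ?exprn_ge0 // exprSr ler_pM ?exprn_ge0 //.
by rewrite lerXn2r ?nnegrE.
Qed.

Lemma derive_mean t r k : 0 < r -> (forall u, `|u - t| <= r -> Theta u) ->
  'D_(delta_mx 0 k) M t = \int[Q]_z grad (m z) t 0 k.
Proof.
move=> r0 ball; have [C HC] := mean_taylor k r0 ball.
by have [_ ->] := is_derive_sqr_bound r0 HC.
Qed.

Lemma hess_mean t : interior Theta t ->
  hess M t = \matrix_(k < d, l < d) \int[Q]_z hess (m z) t k l.
Proof.
move=> /interior_ball[r r0 ball]; apply/matrixP => k l; rewrite [LHS]mxE [RHS]mxE.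
have r20 : 0 < r / 2 by rewrite divr_gt0.
have Tt : Theta t by apply: ball; rewrite subrr normr0 ltW.
transitivity ('D_(delta_mx 0 k) (fun u => \int[Q]_z grad (m z) u 0 l) t).
  apply: near_eq_derive; apply/nbhs_ballP; exists (r / 2) => //= u.
  rewrite -ball_normE /= distrC => ut; rewrite mxE.
  apply: (derive_mean _ r20) => y yu; apply: ball.
  have -> : y - t = (y - u) + (u - t) by rewrite addrA subrK.
  by apply: le_trans (ler_normD _ _) _; lra.
pose C := \int[Q]_z (d%:R ^+ 2 * `|psi z|).
suff [_ ->] : is_derive t (delta_mx 0 k) (fun u => \int[Q]_z grad (m z) u 0 l)
  (\int[Q]_z hess (m z) t k l) by [].
apply: (@is_derive_sqr_bound _ _ _ _ _ _ C _ r0) => h hr.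
set v := h *: _; have vh : `|v| <= `|h| by exact: norm_hdelta.
have vr : `|v| <= r by apply: le_trans vh (ltW hr).
have Ttv : Theta (t + v) by apply: ball; rewrite addrAC subrr add0r.
have i1 := integ_grad l Tt; have i2 := integ_grad l Ttv; have i3 := integ_hess k l Tt.
rewrite -ERZ // -ERB // -ERB //; last exact: integZ; last exact: integB.
have ip : integ Q (fun z => d%:R ^+ 2 * `|psi z|) by apply: integZ; exact: integ_psi.
rewrite /C mulrC -ERZ //.
apply: ERnorm_le; [by apply: integB; [exact: integB|exact: integZ]|exact: integZ|].
move=> z; have := grad_taylor_ball z l r0 ball vr.
rewrite {2}/v -scalemxAl -rowE !mxE => /le_trans; apply.
rewrite [leRHS]mulrC ler_wpM2l ?mulr_ge0 ?sqr_ge0 //.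
by rewrite -(real_normK (num_real h)) lerXn2r ?nnegrE.
Qed.

(** Near an interior maximizer a nonzero slope would outweigh the quadratic
    remainder of [mean_taylor]. *)
Lemma mean_grad_eq0 t k : interior Theta t -> is_argmax Theta M t ->
  \int[Q]_z grad (m z) t 0 k = 0.
Proof.
move=> /interior_ball[r r0 ball] [_ tmax].
have [C HC] := mean_taylor k r0 ball.
set D := \int[Q]_z _ in HC *.
have C0 : 0 <= C.
  have r2 : `|r / 2| < r by rewrite gtr0_norm; lra.
  have : 0 <= C * (r / 2) ^+ 2 := le_trans (normr_ge0 _) (HC _ r2).
  by rewrite pmulr_lge0 // exprn_gt0 // divr_gt0.
have main h : `|h| < r -> h * D <= C * h ^+ 2.
  move=> hr; have := HC h hr; rewrite ler_norml => /andP[+ _].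
  have : M (t + h *: delta_mx 0 k) <= M t.
    apply: tmax; apply: ball; rewrite addrAC subrr add0r.
    exact: le_trans (norm_hdelta _ _) (ltW hr).
  lra.
apply/eqP; rewrite -normr_le0 leNgt; apply/negP => D0.
(* a step small enough for the slope to outweigh the remainder *)
pose e := Num.min (r / 2) (`|D| / (2 * (C + 1))).
have e0 : 0 < e by rewrite lt_min !divr_gt0 //; lra.
have er : e < r.
  by apply: (@le_lt_trans _ _ (r / 2)); [rewrite ge_min lexx|lra].
have eD : e * (2 * (C + 1)) <= `|D|.
  by rewrite -ler_pdivlMr; [rewrite ge_min lexx orbT|lra].
have h1 := main (Num.sg D * e).
have sD : `|Num.sg D| = 1 by rewrite normr_sg -normr_gt0 D0.
rewrite normrM sD mul1r (gtr0_norm e0) in h1; have {}h1 := h1 er.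
rewrite exprMn -[Num.sg D ^+ 2](real_normK (num_real _)) sD expr1n mul1r in h1.
rewrite mulrAC -normrEsg in h1.
have : `|D| <= C * e by move: h1; rewrite expr2 mulrA ler_pM2r.
nra.
Qed.

End Population.

(** * The observations and the uniform variables *)

Section LawTransfer.
Context {R : realType} {dT dE : measure_display} {T : measurableType dT}
  {E : measurableType dE}.
Variables (P : probability T R) (Q : probability E R) (X : T -> E).
Hypothesis lawX : has_law P X Q.

Lemma ge0_law_integral (f : E -> \bar R) : measurable_fun [set: E] f ->
  (forall z, 0 <= f z)%E -> (\int[P]_w f (X w) = \int[Q]_z f z)%E.
Proof.
move=> mf f0; pose X' : {mfun T >-> E} := mfun_Sub (mem_set lawX.1).
rewrite -[LHS](@ge0_integral_distribution _ _ _ _ _ P X') //.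
by apply: eq_measure_integral => A mA _; exact: lawX.2.
Qed.

Lemma law_integ (f : E -> R) : integ Q f -> integ P (fun w => f (X w)).
Proof.
move=> iF; have mf := integ_meas iF.
apply/integrableP; split.
  by apply/measurable_EFinP; exact: (measurableT_comp mf lawX.1).
rewrite (ge0_law_integral (f := fun z => `|(f z)%:E|%E)) //.
  by case/integrableP : iF.
by apply: measurableT_comp => //; exact/measurable_EFinP.
Qed.

Lemma law_Rintegral (f : E -> R) : integ Q f -> \int[P]_w f (X w) = \int[Q]_z f z.
Proof.
move=> iF; have mf := integ_meas iF.
pose X' : {mfun T >-> E} := mfun_Sub (mem_set lawX.1).
rewrite /Rintegral; congr fine.
transitivity (\int[distribution P X']_z (f z)%:E)%E.
  rewrite integral_distribution //; first exact/measurable_EFinP.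
  exact: (law_integ iF).
by apply: eq_measure_integral => A mA _; exact: lawX.2.
Qed.

End LawTransfer.

Lemma uniform_cdf (R : realType) (dT : measure_display) (T : measurableType dT)
    (P : probability T R) (U : T -> R) (q : R) :
  has_law P U (uniform_prob (@ltr01 R)) -> 0 <= q <= 1 ->
  pr P [set w | U w <= q] = q.
Proof.
move=> [mU lawU] /andP[q0 q1].
have -> : [set w | U w <= q] = U @^-1` `]-oo, q]%classic.
  by apply/seteqP; split => w /=; rewrite in_itv.
have mI : measurable (`]-oo, q]%classic : set (measurableTypeR R)) by exact: measurable_itv.
rewrite /pr lawU //.
have -> : uniform_prob (@ltr01 R) `]-oo, q]%classic =
    (\int[uniform_prob (@ltr01 R)]_x (\1_(`]-oo, q]%classic) x)%:E)%E.
  by rewrite integral_indic // setIT.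
rewrite integral_uniform //; last first.
  by apply/measurable_EFinP; exact: measurable_indic.
rewrite subr0 invr1 mul1e integral_indic //.
have -> : `]-oo, q]%classic `&` `[0, 1]%classic = `[0, q]%classic :> set R.
  apply/seteqP; split => x /=; rewrite !in_itv /=.
    by move=> [xq /andP[x0 _]]; rewrite x0.
  by move=> /andP[x0 xq]; rewrite xq x0 (le_trans xq).
transitivity (fine (lebesgue_measure (`[0, q]%classic : set R))) => //.
rewrite lebesgue_measure_itv /= lte_fin.
by move: q0; rewrite le_eqVlt => /orP[/eqP <-|->]; rewrite ?ltxx //= oppr0 addr0.
Qed.

Section PoissonIndependence.
Context {R : realType} {dT dE : measure_display} {T : measurableType dT}
  {E : measurableType dE}.
Variables (P : probability T R) (n : nat) (Z : nat -> T -> E) (u : 'I_n -> T -> R).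
Hypothesis mZ : forall i, measurable_fun [set: T] (Z i).
Hypothesis mu : forall i, measurable_fun [set: T] (u i).
Hypothesis Zu_indep : data_uniforms_independent P (fun i : 'I_n => Z i) u.

Let mZpre i (A : set E) : measurable A -> measurable (Z i @^-1` A).
Proof. by move=> mA; rewrite -[X in measurable X]setTI; exact: mZ. Qed.

Let mupre i (A : set R) : measurable A -> measurable (u i @^-1` A).
Proof. by move=> mA; rewrite -[X in measurable X]setTI; exact: mu. Qed.

(** The product rule for preimages under all the observations and all the
    uniform variables at once; a set equal to [setT] drops the corresponding
    variable. *)
Lemma joint_rectangle (A : 'I_n -> set E) (B : 'I_n -> set R) :
  (forall i, measurable (A i)) -> (forall i, measurable (B i)) ->
  pr P [set w | (forall i, A i (Z i w)) /\ (forall i, B i (u i w))] =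
  (\prod_(i < n) pr P (Z i @^-1` A i)) * (\prod_(i < n) pr P (u i @^-1` B i)).
Proof.
move=> mA mB.
pose F (x : 'I_n + 'I_n) := match x with inl i => Z i @^-1` A i | inr i => u i @^-1` B i end.
have := Zu_indep [set: 'I_n + 'I_n]%SET (A := F).
have -> : \bigcap_(i in [set` [set: 'I_n + 'I_n]%SET]) F i =
    [set w | (forall i, A i (Z i w)) /\ (forall i, B i (u i w))].
  apply/seteqP; split => w /=.
    move=> H; split=> i; first exact: (H (inl i) (finset.in_setT _)).
    exact: (H (inr i) (finset.in_setT _)).
  by move=> [H1 H2] [i|i] _; [exact: H1|exact: H2].
rewrite /pr => ->.
  rewrite big_sumType /= (eq_bigl xpredT); last by move=> i; rewrite finset.in_setT.
  rewrite [X in (_ * X)%E](eq_bigl xpredT); last by move=> i; rewrite finset.in_setT.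
  under eq_bigr => i _ do rewrite -(prE P (mZpre i (mA i))).
  rewrite prodEFin.
  under [X in (_ * X)%E]eq_bigr => i _ do rewrite -(prE P (mupre i (mB i))).
  by rewrite prodEFin.
move=> [i|i].
  by exists (A i) => //; rewrite setTI.
by exists (B i) => //; rewrite setTI.
Qed.

Lemma pr_preimageT (W : Type) (X : T -> W) : pr P (X @^-1` setT) = 1.
Proof. by rewrite preimage_setT pr_setT. Qed.

Let prod_uniformT : \prod_(i < n) pr P (u i @^-1` setT) = 1.
Proof. by apply: big1 => i _; exact: pr_preimageT. Qed.

Let prod_dataT : \prod_(i < n) pr P (Z i @^-1` setT) = 1.
Proof. by apply: big1 => i _; exact: pr_preimageT. Qed.

Definition data_tuple w : n.-tuple E := [tuple Z j w | j < n].
Definition uniform_tuple w : n.-tuple R := [tuple u j w | j < n].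

Lemma measurable_data_tuple : measurable_fun [set: T] data_tuple.
Proof.
apply/measurable_fun_tnthP => i.
by have := mZ i; apply: eq_measurable_fun => w _; rewrite /= tnth_mktuple.
Qed.

Lemma measurable_uniform_tuple : measurable_fun [set: T] uniform_tuple.
Proof.
apply/measurable_fun_tnthP => i.
by have := mu i; apply: eq_measurable_fun => w _; rewrite /= tnth_mktuple.
Qed.

Lemma data_uniform_indep2 : indep2 P data_tuple uniform_tuple.
Proof.
apply: (indep2_pi_system measurable_data_tuple measurable_uniform_tuple
  (@tuple_measurableE _ E n) (@rectangles_setI _ E n)
  (@tuple_measurableE _ R n) (@rectangles_setI _ R n)).
move=> _ _ [A mA <-] [B mB <-].
have EA : data_tuple @^-1` rectangle A =
    [set w | (forall i, A i (Z i w)) /\ (forall i : 'I_n, setT (u i w))].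
  apply/seteqP; split => w /=.
    by move=> H; split=> // i; have := H i; rewrite tnth_mktuple.
  by move=> [H _] i; rewrite tnth_mktuple.
have EB : uniform_tuple @^-1` rectangle B =
    [set w | (forall i : 'I_n, setT (Z i w)) /\ (forall i, B i (u i w))].
  apply/seteqP; split => w /=.
    by move=> H; split=> // i; have := H i; rewrite tnth_mktuple.
  by move=> [_ H] i; rewrite tnth_mktuple.
have EAB : data_tuple @^-1` rectangle A `&` uniform_tuple @^-1` rectangle B =
    [set w | (forall i, A i (Z i w)) /\ (forall i, B i (u i w))].
  by rewrite EA EB; apply/seteqP; split => w /= [] => [[? _] [_ ?]|? ?].
have mpA : measurable (data_tuple @^-1` rectangle A).
  rewrite -[X in measurable X]setTI; apply: measurable_data_tuple => //.
  exact: measurable_rectangle.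
have mpB : measurable (uniform_tuple @^-1` rectangle B).
  rewrite -[X in measurable X]setTI; apply: measurable_uniform_tuple => //.
  exact: measurable_rectangle.
rewrite -(prE P mpA) -(prE P mpB) -(prE P (measurableI _ _ mpA mpB)) -EFinM.
rewrite EAB EA EB joint_rectangle //.
rewrite (@joint_rectangle A (fun=> setT)) // (@joint_rectangle (fun=> setT) B) //.
rewrite prod_uniformT mulr1; congr (_ * _)%:E; rewrite -[LHS]mul1r; congr (_ * _).
Qed.

Lemma indep_seq_data : indep_seq P Z n.
Proof.
move=> A mA; transitivity (pr P [set w | (forall i : 'I_n, A i (Z i w)) /\
    (forall i : 'I_n, setT (u i w))]).
  congr pr; apply/seteqP; split => w /=.
    by move=> H; split=> // i; exact: H.
  by move=> [H _] i ni; exact: (H (Ordinal ni)).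
rewrite (@joint_rectangle (fun i => A i) (fun=> setT)) //.
by rewrite prod_uniformT mulr1.
Qed.

(** The notion of independent sequence takes families indexed by [nat]. *)
Definition uniform_seq (i : nat) w : R := if insub i is Some j then u j w else 0.

Lemma uniform_seqE (i : 'I_n) w : uniform_seq i w = u i w.
Proof. by rewrite /uniform_seq valK. Qed.

Lemma indep_seq_uniform : indep_seq P uniform_seq n.
Proof.
move=> B mB; transitivity (pr P [set w | (forall i : 'I_n, setT (Z i w)) /\
    (forall i : 'I_n, B i (u i w))]).
  congr pr; apply/seteqP; split => w /=.
    by move=> H; split=> // i; rewrite -uniform_seqE; exact: H.
  by move=> [_ H] i ni; have := H (Ordinal ni); rewrite -uniform_seqE.
rewrite (@joint_rectangle (fun=> setT) (fun i => B i)) //.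
rewrite prod_dataT mul1r; apply: eq_bigr => i _; congr pr.
by apply/seteqP; split => w /=; rewrite uniform_seqE.
Qed.

End PoissonIndependence.

(** * Inclusion sums for given data *)

Section FixedData.
Context {R : realType} {dT dE : measure_display} {T : measurableType dT}
  {E : measurableType dE}.
Variables (P : probability T R) (n : nat) (Z : nat -> T -> E) (u : 'I_n -> T -> R).
Hypothesis mZ : forall i, measurable_fun [set: T] (Z i).
Hypothesis u_law : forall i, has_law P (u i) (uniform_prob (@ltr01 R)).
Hypothesis Zu_indep : data_uniforms_independent P (fun i : 'I_n => Z i) u.

Let mu i : measurable_fun [set: T] (u i) := (u_law i).1.

Definition le_indic (a : R * R) : R := ((a.1 <= a.2)%R)%:R.

Lemma measurable_le_indic : measurable_fun [set: R * R] le_indic.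
Proof.
rewrite (_ : le_indic = \1_[set a : R * R | a.1 <= a.2]).
  by apply: measurable_indic; exact: measurable_set_le.
apply/funext => a; rewrite indicE /le_indic; congr (_ : bool)%:R.
by apply/idP/idP; rewrite inE.
Qed.

Variables (q c : 'I_n -> R).
Hypothesis q01 : forall i, 0 <= q i <= 1.

Let eta i w := (le_indic (u i w, q i) - q i) * c i.
Let v i := q i * (1 - q i) * c i ^+ 2.

Let mb i : measurable_fun [set: T] (fun w => le_indic (u i w, q i)).
Proof. by apply: (measurableT_comp measurable_le_indic); exact: measurable_fun_pair. Qed.

Let meta i : measurable_fun [set: T] (eta i).
Proof. by apply: measurable_funM => //; exact: measurable_funB. Qed.

Let b01 a : le_indic a = 0 \/ le_indic a = 1.
Proof. by rewrite /le_indic; case: (_ <= _); [right|left]. Qed.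

Let ib i : integ P (fun w => le_indic (u i w, q i)).
Proof.
apply: (@integ_bounded _ _ _ P _ 1) => [|w]; first exact: mb.
by case: (b01 (u i w, q i)) => ->; rewrite ?normr0 ?normr1 ?ler01.
Qed.

Let Eb i : \int[P]_w le_indic (u i w, q i) = q i.
Proof.
rewrite -[RHS](uniform_cdf (u_law i) (q01 i)) -ERindic; last first.
  by apply: measurable_set_le => //; exact: mu.
apply: eq_Rintegral => w _; rewrite indicE /le_indic; congr (_ : bool)%:R.
by apply/idP/idP; rewrite inE.
Qed.

Let eta_abs i w : `|eta i w| <= `|c i|.
Proof.
rewrite /eta normrM ler_piMl //; have /andP[q0 q1] := q01 i.
by case: (b01 (u i w, q i)) => ->; rewrite ler_norml; lra.
Qed.

Let ieta i : integ P (eta i).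
Proof. exact: (integ_bounded P (meta i) (eta_abs i)). Qed.

Let Eeta i : \int[P]_w eta i w = 0.
Proof.
rewrite (_ : eta i = fun w => c i * (le_indic (u i w, q i) - q i)); last first.
  by apply/funext => w; rewrite mulrC.
have icst := @integ_cst _ _ _ P (q i).
by rewrite ERZ ?ERB ?ERcst ?Eb ?subrr ?mulr0 //; exact: integB.
Qed.

Let eta2E i w : eta i w ^+ 2 =
  (c i ^+ 2 * (1 - 2 * q i)) * le_indic (u i w, q i) + c i ^+ 2 * q i ^+ 2.
Proof. by rewrite /eta; case: (b01 (u i w, q i)) => ->; ring. Qed.

Let ieta2 i : integ P (fun w => eta i w ^+ 2).
Proof.
by rewrite (funext (eta2E i)); apply: integD; [exact: integZ|exact: integ_cst].
Qed.

Let Eeta2 i : \int[P]_w (eta i w ^+ 2) = v i.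
Proof.
rewrite (funext (eta2E i)) (ERD (integZ _ (ib i)) (integ_cst P _)) ERZ // Eb ERcst.
by rewrite /v; ring.
Qed.

Let v0 i : 0 <= v i.
Proof.
have /andP[q0 q1] := q01 i.
by apply: mulr_ge0 (sqr_ge0 _); apply: mulr_ge0 => //; rewrite subr_ge0.
Qed.

Let vc i : v i <= c i ^+ 2.
Proof.
rewrite /v ler_piMl ?sqr_ge0 //; have /andP[? ?] := q01 i.
by nra.
Qed.

Let etas (i : nat) w := if insub i is Some j then
  (le_indic (uniform_seq u i w, q j) - q j) * c j else 0.

Let etasE (i : 'I_n) w : etas i w = eta i w.
Proof. by rewrite /etas valK uniform_seqE. Qed.

Let metas i : measurable_fun [set: T] (etas i).
Proof.
rewrite /etas; case: insubP => // j _ <-.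
rewrite (_ : (fun w => _) = eta j); first exact: meta.
by apply/funext => w; rewrite uniform_seqE.
Qed.

Let indep_etas : indep_seq P etas n.
Proof.
pose h (i : nat) (r : R) := if insub i is Some j then (le_indic (r, q j) - q j) * c j else 0.
rewrite (_ : etas = fun i => h i \o uniform_seq u i); last first.
  by apply/funext => i; apply/funext => w; rewrite /etas /h /=; case: insubP.
apply: indep_seq_comp; last exact: (indep_seq_uniform mZ mu Zu_indep).
move=> i; rewrite /h; case: insubP => // j _ _.
apply: measurable_funM => //; apply: measurable_funB => //.
by apply: (measurableT_comp measurable_le_indic); exact: measurable_fun_pair.
Qed.

Let etas_sqr i : (i < n)%N -> integ P (fun w => etas i w ^+ 2).
Proof.
move=> ni; have := ieta2 (Ordinal ni); congr (integ P _).
by apply/funext => w; rewrite -etasE.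
Qed.

Let etas_mean i : (i < n)%N -> \int[P]_w etas i w = 0.
Proof.
move=> ni; rewrite -[RHS](Eeta (Ordinal ni)).
by apply: eq_Rintegral => w _; rewrite -etasE.
Qed.

Let sumE w : \sum_(i < n) etas i w = \sum_(i < n) eta i w.
Proof. by apply: eq_bigr => i _; exact: etasE. Qed.

(** A centred Bernoulli variable of parameter [q] has variance [q * (1 - q)]. *)
Lemma inclusion_sum_second_moment :
  integ P (fun w => (\sum_(i < n) (le_indic (u i w, q i) - q i) * c i) ^+ 2) /\
  \int[P]_w (\sum_(i < n) (le_indic (u i w, q i) - q i) * c i) ^+ 2 =
  \sum_(i < n) q i * (1 - q i) * c i ^+ 2.
Proof.
have [] := second_moment_sum metas indep_etas etas_sqr etas_mean (leqnn n).
have -> : (fun w => (\sum_(i < n) etas i w) ^+ 2) = (fun w => (\sum_(i < n) eta i w) ^+ 2).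
  by apply/funext => w; rewrite sumE.
move=> ? ->; split=> //; apply: eq_bigr => i _; rewrite -[RHS]Eeta2.
by apply: eq_Rintegral => w _; rewrite etasE.
Qed.

(** The central limit theorem for given data: the inclusion indicators are
    independent and bounded, so that the Lindeberg bound needs no truncation of
    its own. *)
Lemma inclusion_sum_cos a :
  `|\int[P]_w cos (a + \sum_(i < n) (le_indic (u i w, q i) - q i) * c i) -
    expR (- ((\sum_(i < n) q i * (1 - q i) * c i ^+ 2) / 2)) * cos a| <=
  \sum_(i < n) 4 * (q i * (1 - q i) * c i ^+ 2 * Num.min 1 `|c i|).
Proof.
have := cos_lindeberg metas indep_etas etas_sqr etas_mean a (leqnn n).
have vE (i : 'I_n) : \int[P]_w (etas i w ^+ 2) = v i.
  by rewrite -Eeta2; apply: eq_Rintegral => w _; rewrite etasE.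
have -> : \int[P]_w cos (a + \sum_(i < n) etas i w) =
    \int[P]_w cos (a + \sum_(i < n) eta i w).
  by apply: eq_Rintegral => w _; rewrite sumE.
rewrite (eq_bigr v) => [|i _]; last exact: vE.
move=> /le_trans; apply; apply: ler_sum => i _; rewrite vE -/(v i).
rewrite (_ : 4 * _ = 3 * (v i * Num.min 1 `|c i|) + v i * Num.min 1 `|c i|); last by ring.
apply: lerD.
  rewrite ler_wpM2l // -Eeta2 mulrC -ERZ //.
  have irho : integ P (fun w => Num.min 1 `|c i| * eta i w ^+ 2) by exact: integZ.
  have ptw w : etas i w ^+ 2 * Num.min 1 `|etas i w| <= Num.min 1 `|c i| * eta i w ^+ 2.
    rewrite etasE [leRHS]mulrC ler_wpM2l ?sqr_ge0 //.
    by rewrite le_min !ge_min lexx /= eta_abs orbT.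
  have ptw0 w : 0 <= etas i w ^+ 2 * Num.min 1 `|etas i w|.
    by rewrite mulr_ge0 ?sqr_ge0 // le_min ler01 normr_ge0.
  apply: ERle => //; apply: (integ_dom _ irho).
    apply: measurable_funM; first exact: measurable_funX.
    by apply: measurable_minr => //; exact: measurableT_comp.
  by move=> w; rewrite ger0_norm.
(* [v <= c ^ 2], so that [min v (v ^ 2)] is at most [v * min 1 |c|] *)
have := v0 i; have := vc i; rewrite -(real_normK (num_real (c i))).
have := normr_ge0 (c i); set y := `|c i|; set x := v i => y0 xy x0.
rewrite ge_min; have [y1|y1] := leP 1 y; first by rewrite mulr1 lexx.
have xy1 : x <= y by apply: le_trans xy _; rewrite expr2 ler_piMl // ltW.
by apply/orP; right; rewrite expr2 ler_wpM2l.
Qed.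

End FixedData.

(** * Horvitz-Thompson sums at a fixed sample size *)

Lemma le_indicE (R : realType) (a b : R) : le_indic (a, b) = (a <= b)%R%:R.
Proof. by []. Qed.

Lemma sum_ord_cst (R : realType) n (x : R) : \sum_(i < n) x = n%:R * x.
Proof. by rewrite sumr_const card_ord mulr_natl. Qed.

Section PoissonSampling.
Context {R : realType} {dT dE : measure_display} {T : measurableType dT}
  {E : measurableType dE}.
Variables (P : probability T R) (Q : probability E R) (n : nat).
Variables (Z : nat -> T -> E) (u : 'I_n -> T -> R).
Variables (s : R) (p : 'I_n -> n.-tuple E -> R).
Hypothesis Z_law : forall i, has_law P (Z i) Q.
Hypothesis u_law : forall i, has_law P (u i) (uniform_prob (@ltr01 R)).
Hypothesis Zu_indep : data_uniforms_independent P (fun i : 'I_n => Z i) u.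
Hypothesis p_meas : forall i, measurable_fun [set: n.-tuple E] (p i).

Let zt := @data_tuple _ _ _ _ n Z.
Let ut := uniform_tuple u.
Let mZ i : measurable_fun [set: T] (Z i) := (Z_law i).1.
Let mu i : measurable_fun [set: T] (u i) := (u_law i).1.
Let mzt : measurable_fun [set: T] zt := measurable_data_tuple mZ.
Let mut : measurable_fun [set: T] ut := measurable_uniform_tuple mu.

Hypothesis s0 : 0 < s.
Hypothesis sn : s < n%:R.
Hypothesis design : forall w, subsampling_distribution s (fun i => p i (zt w)).

Let n0 : 0 < n%:R :> R. Proof. exact: lt_trans s0 sn. Qed.
Let n_neq0 : n%:R != 0 :> R. Proof. by rewrite gt_eqF. Qed.
Let s_neq0 : s != 0. Proof. by rewrite gt_eqF. Qed.
Let p0 i w : 0 < p i (zt w). Proof. by have [] := design w. Qed.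
Let p_neq0 i w : p i (zt w) != 0. Proof. by rewrite gt_eqF. Qed.

Let q01 i w : 0 <= s * p i (zt w) <= 1.
Proof.
rewrite mulr_ge0 ?(ltW s0) ?(ltW (p0 i w)) //=.
by have [_ _ /(_ i)] := design w; rewrite -ler_pdivlMl // mulr1.
Qed.

(** The Horvitz-Thompson weight. *)
Definition ht_weight i w : R :=
  le_indic (u i w, s * p i (zt w)) / (n%:R * s * p i (zt w)).

Definition ht_sum (f : E -> R) w : R := \sum_(i < n) ht_weight i w * f (Z i w).

Definition data_mean (f : E -> R) w : R := n%:R^-1 * \sum_(i < n) f (Z i w).

Definition max_inv_prob w : R := \big[Num.max/0]_(i < n) (n%:R * p i (zt w))^-1.

Lemma ht_weight_ge0 i w : 0 <= ht_weight i w.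
Proof. by rewrite divr_ge0 ?ler0n // !mulr_ge0 ?ltW. Qed.

Let mp i : measurable_fun [set: T] (fun w => p i (zt w)).
Proof. exact: (measurableT_comp (p_meas i) mzt). Qed.

Lemma measurable_ht_weight i : measurable_fun [set: T] (ht_weight i).
Proof.
apply: measurable_funM.
  apply: (measurableT_comp (@measurable_le_indic R)).
  by apply: measurable_fun_pair => //; exact: measurable_funM.
by apply: (measurableT_comp (@measurable_invr R)); exact: measurable_funM.
Qed.

Lemma measurable_ht_sum f : measurable_fun [set: E] f ->
  measurable_fun [set: T] (ht_sum f).
Proof.
move=> mf; apply: measurable_sum => i; apply: measurable_funM.
  exact: measurable_ht_weight.
exact: (measurableT_comp mf).
Qed.

Lemma measurable_data_mean f : measurable_fun [set: E] f ->
  measurable_fun [set: T] (data_mean f).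
Proof.
move=> mf; apply: measurable_funM => //; apply: measurable_sum => i.
exact: (measurableT_comp mf).
Qed.

Lemma measurable_max_inv_prob : measurable_fun [set: T] max_inv_prob.
Proof.
apply: measurable_bigmaxr => i.
by apply: (measurableT_comp (@measurable_invr R)); exact: measurable_funM.
Qed.

Section Statistic.
Variable f : E -> R.
Hypothesis mf : measurable_fun [set: E] f.
Hypothesis if2 : integ Q (fun z => f z ^+ 2).

Let if1 : integ Q f. Proof. exact: integ_of_sqr. Qed.

Lemma data_mean_L2 :
  integ P (fun w => (data_mean f w - \int[Q]_z f z) ^+ 2) /\
  \int[P]_w (data_mean f w - \int[Q]_z f z) ^+ 2 <= n%:R^-1 * \int[Q]_z (f z ^+ 2).
Proof.
set e := \int[Q]_z f z.
pose h z := n%:R^-1 * (f z - e).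
have ie := @integ_cst _ _ _ Q e.
have mh : measurable_fun [set: E] h by apply: measurable_funM => //; exact: measurable_funB.
have h2E z : h z ^+ 2 = n%:R^-2 * (f z ^+ 2 + (- (2 * e) * f z + e ^+ 2)).
  by rewrite /h; field.
have i1 : integ Q (fun z => - (2 * e) * f z + e ^+ 2).
  by apply: integD; [exact: integZ|exact: integ_cst].
have ih2 : integ Q (fun z => h z ^+ 2).
  by rewrite (funext h2E); apply: integZ; exact: integD.
have Eh : \int[Q]_z h z = 0.
  by rewrite /h ERZ ?ERB ?ERcst ?subrr ?mulr0 //; exact: integB.
have Eh2 : \int[Q]_z (h z ^+ 2) <= n%:R^-2 * \int[Q]_z (f z ^+ 2).
  rewrite (funext h2E) (ERZ _ (integD if2 i1)) (ERD if2 i1).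
  rewrite (ERD (integZ _ if1) (integ_cst Q _)) ERZ // ERcst -/e.
  rewrite ler_wpM2l ?invr_ge0 ?sqr_ge0 //; have := sqr_ge0 e; lra.
pose eta (i : nat) w := h (Z i w).
have meta i : measurable_fun [set: T] (eta i) by exact: (measurableT_comp mh).
have ieta : indep_seq P eta n.
  apply: (@indep_seq_comp _ _ _ P _ _ _ _ Z (fun=> h)) => //.
  exact: (indep_seq_data mZ mu Zu_indep).
have ieta2 i : (i < n)%N -> integ P (fun w => eta i w ^+ 2).
  by move=> _; exact: (law_integ (Z_law i) ih2).
have meta0 i : (i < n)%N -> \int[P]_w eta i w = 0.
  by move=> _; rewrite (law_Rintegral (Z_law i)) ?Eh //; exact: integ_of_sqr.
have [iS ES] := second_moment_sum meta ieta ieta2 meta0 (leqnn n).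
have sumE w : \sum_(i < n) eta i w = data_mean f w - e.
  rewrite /eta /h -mulr_sumr sumrB sum_ord_cst /data_mean mulrBr.
  by rewrite mulrA mulVf // mul1r.
have E2 : (fun w => (\sum_(i < n) eta i w) ^+ 2) = (fun w => (data_mean f w - e) ^+ 2).
  by apply/funext => w; rewrite sumE.
rewrite E2 in iS ES; split=> //; rewrite ES.
apply: (@le_trans _ _ (\sum_(i < n) n%:R^-2 * \int[Q]_z (f z ^+ 2))).
  apply: ler_sum => i _; rewrite (@law_Rintegral _ _ _ _ _ _ _ _ (Z_law i) (fun z => h z ^+ 2)) //.
rewrite sum_ord_cst mulrA.
by rewrite (_ : n%:R * n%:R^-2 = n%:R^-1) //; field.
Qed.

(** The central limit theorem for the mean over the full data, in the
    normalization where [f] contains the factor [sqrt s]: the summands are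
    [f / n], and their variances add up to [n^-1] times the second moment. *)
Lemma data_mean_cos c : \int[Q]_z f z = 0 ->
  `|\int[P]_w cos (c + data_mean f w) -
     expR (- (n%:R^-1 * \int[Q]_z (f z ^+ 2) / 2)) * cos c| <=
  3 / n%:R * (\int[Q]_z (f z ^+ 2 * Num.min 1 (`|f z| / n%:R))) +
    (\int[Q]_z (f z ^+ 2)) ^+ 2 / n%:R ^+ 3.
Proof.
move=> Ef; set tau := \int[Q]_z (f z ^+ 2).
pose h z := n%:R^-1 * f z.
have mh : measurable_fun [set: E] h by apply: measurable_funM.
have h2E z : h z ^+ 2 = n%:R^-2 * f z ^+ 2 by rewrite /h; field.
have ih2 : integ Q (fun z => h z ^+ 2) by rewrite (funext h2E); exact: integZ.
have Eh : \int[Q]_z h z = 0 by rewrite /h ERZ // Ef mulr0.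
have Eh2 : \int[Q]_z (h z ^+ 2) = n%:R^-2 * tau by rewrite (funext h2E) ERZ.
pose eta (i : nat) w := h (Z i w).
have meta i : measurable_fun [set: T] (eta i) by exact: (measurableT_comp mh).
have ieta : indep_seq P eta n.
  apply: (@indep_seq_comp _ _ _ P _ _ _ _ Z (fun=> h)) => //.
  exact: (indep_seq_data mZ mu Zu_indep).
have ieta2 i : (i < n)%N -> integ P (fun w => eta i w ^+ 2).
  by move=> _; exact: (law_integ (Z_law i) ih2).
have meta0 i : (i < n)%N -> \int[P]_w eta i w = 0.
  by move=> _; rewrite (law_Rintegral (Z_law i)) ?Eh //; exact: integ_of_sqr.
have := cos_lindeberg meta ieta ieta2 meta0 c (leqnn n).
have E2 i : \int[P]_w (eta i w ^+ 2) = n%:R^-2 * tau.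
  by rewrite (@law_Rintegral _ _ _ _ _ _ _ _ (Z_law i) (fun z => h z ^+ 2)).
have -> : (fun w => cos (c + \sum_(i < n) eta i w)) = (fun w => cos (c + data_mean f w)).
  by apply/funext => w; rewrite /data_mean mulr_sumr.
rewrite (eq_bigr (fun=> n%:R^-2 * tau)) => [|i _]; last exact: E2.
rewrite sum_ord_cst mulrA.
rewrite (_ : n%:R * n%:R^-2 = n%:R^-1); last by field.
move=> /le_trans; apply.
have hmin z : h z ^+ 2 * Num.min 1 `|h z| =
    n%:R^-2 * (f z ^+ 2 * Num.min 1 (`|f z| / n%:R)).
  have nn : `|n%:R^-1 : R| = n%:R^-1 by rewrite ger0_norm // invr_ge0.
  by rewrite h2E /h normrM nn (mulrC n%:R^-1 `|f z|) -[LHS]mulrA.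
have mrho : measurable_fun [set: E] (fun z => f z ^+ 2 * Num.min 1 (`|f z| / n%:R)).
  apply: measurable_funM; first exact: measurable_funX.
  apply: measurable_minr => //; apply: measurable_funM => //.
  exact: measurableT_comp.
have irho : integ Q (fun z => f z ^+ 2 * Num.min 1 (`|f z| / n%:R)).
  apply: (integ_dom mrho if2) => z.
  have m0 : 0 <= Num.min 1 (`|f z| / n%:R) by rewrite le_min ler01 divr_ge0.
  rewrite (ger0_norm (mulr_ge0 (sqr_ge0 _) m0)).
  by rewrite ler_piMr ?sqr_ge0 // ge_min lexx.
have Er i : \int[P]_w (eta i w ^+ 2 * Num.min 1 `|eta i w|) =
    n%:R^-2 * \int[Q]_z (f z ^+ 2 * Num.min 1 (`|f z| / n%:R)).
  rewrite -ERZ // (@law_Rintegral _ _ _ _ _ _ _ _ (Z_law i) (fun z => h z ^+ 2 * Num.min 1 `|h z|)).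
    by apply: eq_Rintegral => z _; exact: hmin.
  by rewrite (funext hmin); exact: integZ.
apply: (@le_trans _ _ (\sum_(i < n) (3 * (n%:R^-2 * \int[Q]_z (f z ^+ 2 * Num.min 1 (`|f z| / n%:R)))
    + (n%:R^-2 * tau) ^+ 2))).
  by apply: ler_sum => i _; rewrite Er E2 lerD2l ge_min lexx orbT.
rewrite sum_ord_cst mulrDr le_eqVlt; apply/orP; left; apply/eqP.
by congr (_ + _); field.
Qed.

Variable K : R.
Hypothesis K0 : 0 <= K.

(* Truncating the coefficients where a weight is large keeps them bounded.  The
   truncation is a function of the data, so that it is constant once the data
   are held fixed. *)
Let Bz (z : n.-tuple E) : R := \big[Num.max/0]_(i < n) (n%:R * p i z)^-1.
Let cut z : R := le_indic (Bz z, K).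
Let c i z := cut z * (f (tnth z i) / (n%:R * s * p i z)).
(* the effect of the subsampling on the truncated estimator *)
Let gap (a : n.-tuple E * n.-tuple R) : R :=
  \sum_(i < n) (le_indic (tnth a.2 i, s * p i a.1) - s * p i a.1) * c i a.1.
Let var z := \sum_(i < n) s * p i z * (1 - s * p i z) * c i z ^+ 2.

Let mBz : measurable_fun [set: n.-tuple E] Bz.
Proof.
apply: measurable_bigmaxr => i.
by apply: (measurableT_comp (@measurable_invr R)); exact: measurable_funM.
Qed.

Let mcut : measurable_fun [set: n.-tuple E] cut.
Proof. by apply: (measurableT_comp (@measurable_le_indic R)); exact: measurable_fun_pair. Qed.

Let mft i : measurable_fun [set: n.-tuple E] (fun z => f (tnth z i)).
Proof. by apply: (measurableT_comp mf); exact: measurable_tnth. Qed.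

Let mc i : measurable_fun [set: n.-tuple E] (c i).
Proof.
apply: measurable_funM => //; apply: measurable_funM => //.
by apply: (measurableT_comp (@measurable_invr R)); exact: measurable_funM.
Qed.

Let mgap : measurable_fun [set: n.-tuple E * n.-tuple R] gap.
Proof.
apply: measurable_sum => i.
have mq : measurable_fun [set: n.-tuple E * n.-tuple R]
    (fun a : n.-tuple E * n.-tuple R => s * p i a.1).
  by apply: measurable_funM => //; exact: (measurableT_comp (p_meas i)).
apply: measurable_funM; last exact: (measurableT_comp (mc i)).
apply: measurable_funB => //.
apply: (measurableT_comp (@measurable_le_indic R)); apply: measurable_fun_pair => //.
exact: (measurableT_comp (@measurable_tnth _ R n i)).
Qed.

Let mvar : measurable_fun [set: n.-tuple E] var.
Proof.
apply: measurable_sum => i; apply: measurable_funM; last exact: measurable_funX.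
apply: measurable_funM; first exact: measurable_funM.
by apply: measurable_funB => //; exact: measurable_funM.
Qed.

Let gapE w w' : gap (zt w, ut w') =
  \sum_(i < n) (le_indic (u i w', s * p i (zt w)) - s * p i (zt w)) * c i (zt w).
Proof. by apply: eq_bigr => i _; rewrite /= tnth_mktuple. Qed.

Let gap_ht w : gap (zt w, ut w) = cut (zt w) * (ht_sum f w - data_mean f w).
Proof.
rewrite gapE /ht_sum /data_mean mulr_sumr -sumrB mulr_sumr; apply: eq_bigr => i _.
rewrite /c /ht_weight tnth_mktuple; field.
by rewrite n_neq0 s_neq0 p_neq0.
Qed.

Let cutP w : (cut (zt w) = 1 /\ max_inv_prob w <= K) \/ (cut (zt w) = 0 /\ K < max_inv_prob w).
Proof.
rewrite /cut le_indicE -/(max_inv_prob w).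
by have [?|?] := leP (max_inv_prob w) K; [left|right].
Qed.

Let inv_prob_le i w : (n%:R * p i (zt w))^-1 <= max_inv_prob w.
Proof. exact: (le_bigmax 0 (fun i : 'I_n => (n%:R * p i (zt w))^-1) i). Qed.

Let c_le i w : `|c i (zt w)| <= K * `|f (Z i w)| / s.
Proof.
rewrite /c tnth_mktuple; have [[-> BK]|[-> _]] := cutP w; last first.
  by rewrite mul0r normr0 divr_ge0 ?mulr_ge0 // ltW.
have ip : 0 < (n%:R * p i (zt w))^-1 by rewrite invr_gt0 mulr_gt0.
have is0 : 0 < s^-1 by rewrite invr_gt0.
have -> : 1 * (f (Z i w) / (n%:R * s * p i (zt w))) =
    (n%:R * p i (zt w))^-1 * f (Z i w) / s.
  by field; rewrite n_neq0 s_neq0 p_neq0.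
rewrite !normrM (gtr0_norm ip) (gtr0_norm is0) ler_wpM2r ?(ltW is0) //.
by rewrite ler_wpM2r // (le_trans (inv_prob_le i w) BK).
Qed.

Let v_le i w : s * p i (zt w) * (1 - s * p i (zt w)) * c i (zt w) ^+ 2 <=
  K / (n%:R * s) * f (Z i w) ^+ 2.
Proof.
have /andP[q0 q1] := q01 i w.
apply: (@le_trans _ _ (s * p i (zt w) * c i (zt w) ^+ 2)).
  rewrite ler_wpM2r ?sqr_ge0 // ler_piMr //; lra.
rewrite /c tnth_mktuple; have [[-> BK]|[-> _]] := cutP w; last first.
  rewrite mul0r expr0n /= mulr0 mulr_ge0 ?sqr_ge0 // divr_ge0 // mulr_ge0 ?ltW //.
have -> : s * p i (zt w) * (1 * (f (Z i w) / (n%:R * s * p i (zt w)))) ^+ 2 =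
  (n%:R * p i (zt w))^-1 / (n%:R * s) * f (Z i w) ^+ 2.
  by field; rewrite n_neq0 s_neq0 p_neq0.
have ns : 0 <= (n%:R * s)^-1 by rewrite invr_ge0 mulr_ge0 // ltW.
by rewrite ler_wpM2r ?sqr_ge0 // ler_wpM2r // (le_trans (inv_prob_le i w) BK).
Qed.

Let v_ge0 i w : 0 <= s * p i (zt w) * (1 - s * p i (zt w)) * c i (zt w) ^+ 2.
Proof.
have /andP[q0 q1] := q01 i w.
by apply: mulr_ge0 (sqr_ge0 _); apply: mulr_ge0 => //; rewrite subr_ge0.
Qed.

Let if2Z i : integ P (fun w => f (Z i w) ^+ 2) := law_integ (Z_law i) if2.

Let ivar : integ P (fun w => var (zt w)).
Proof.
apply: (@integ_dom _ _ _ P _ (fun w => \sum_(i < n) K / (n%:R * s) * f (Z i w) ^+ 2)).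
- exact: (measurableT_comp mvar mzt).
- by apply: integ_sum => i; apply: integZ; exact: if2Z.
- move=> w; rewrite ger0_norm; last by apply: sumr_ge0 => i _; exact: v_ge0.
  by apply: ler_sum => i _; exact: v_le.
Qed.

Let sum_law (C : R) (g : E -> R) : integ Q g ->
  \int[P]_w (\sum_(i < n) C * g (Z i w)) = n%:R * C * \int[Q]_z g z.
Proof.
move=> ig; rewrite ERsum => [|i]; last by apply: integZ; exact: (law_integ (Z_law i)).
rewrite (eq_bigr (fun=> C * \int[Q]_z g z)) => [|i _].
  by rewrite sum_ord_cst mulrA.
by rewrite ERZ ?(law_Rintegral (Z_law i)) //; exact: (law_integ (Z_law i)).
Qed.

Let gap_L2 : integ P (fun w => gap (zt w, ut w) ^+ 2) /\
  \int[P]_w (gap (zt w, ut w) ^+ 2) <= K / s * \int[Q]_z (f z ^+ 2).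
Proof.
pose Phi a := (gap a ^+ 2)%:E.
have mPhi : measurable_fun [set: n.-tuple E * n.-tuple R] Phi.
  by apply/measurable_EFinP; exact: measurable_funX.
have Phi0 a : (0 <= Phi a)%E by rewrite lee_fin sqr_ge0.
have := freeze_ge0 mzt mut (data_uniform_indep2 mZ mu Zu_indep) mPhi Phi0.
have inner w : (\int[P]_x Phi (zt w, ut x) = (var (zt w))%:E)%E.
  have [i2 E2] := inclusion_sum_second_moment mZ u_law Zu_indep (c ^~ (zt w)) (q01 ^~ w).
  rewrite /var -E2 EFin_Rintegral //.
  by apply: eq_integral => x _; rewrite /Phi gapE.
under [RHS]eq_integral do rewrite inner.
rewrite -(EFin_Rintegral ivar) => H.
have ig : integ P (fun w => gap (zt w, ut w) ^+ 2).
  apply/integrableP; split.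
    apply/measurable_EFinP; apply: measurable_funX.
    by apply: (measurableT_comp mgap); exact: measurable_fun_pair.
  rewrite (_ : (\int[P]_w _)%E = (\int[P]_w Phi (zt w, ut w))%E); first by rewrite H ltry.
  by apply: eq_integral => w _; rewrite /= ger0_norm ?sqr_ge0.
split=> //.
have -> : \int[P]_w (gap (zt w, ut w) ^+ 2) = \int[P]_w var (zt w).
  by apply: EFin_inj; rewrite EFin_Rintegral.
rewrite (_ : K / s * _ = \int[P]_w (\sum_(i < n) K / (n%:R * s) * f (Z i w) ^+ 2)); last first.
  rewrite (sum_law (K / (n%:R * s)) if2); congr (_ * _); field.
  by rewrite n_neq0 s_neq0.
apply: ERle => //; first by apply: integ_sum => i; apply: integZ; exact: if2Z.
by move=> w; apply: ler_sum => i _; exact: v_le.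
Qed.

(** Chebyshev's inequality for the Horvitz-Thompson estimator of a mean, on the
    event that the sampling probabilities are not too small. *)
Lemma ht_sum_deviation (e : R) : 0 < e ->
  pr P [set w | e <= `|ht_sum f w - \int[Q]_z f z|] <=
  pr P [set w | K < max_inv_prob w] + 4 * (K + 1) / (s * e ^+ 2) * \int[Q]_z (f z ^+ 2).
Proof.
move=> e0; set Ef := \int[Q]_z f z; set tau := \int[Q]_z (f z ^+ 2).
have mht := measurable_ht_sum mf; have mdm := measurable_data_mean mf.
have mB := measurable_max_inv_prob.
have mgz : measurable_fun [set: T] (fun w => gap (zt w, ut w)).
  by apply: (measurableT_comp mgap); exact: measurable_fun_pair.
pose A0 := [set w | K < max_inv_prob w].
pose A1 := [set w | e / 2 <= `|gap (zt w, ut w)|].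
pose A2 := [set w | e / 2 <= `|data_mean f w - Ef|].
have mA0 : measurable A0 by exact: measurable_set_lt.
have mA1 : measurable A1 by apply: measurable_set_le => //; exact: measurableT_comp.
have mA2 : measurable A2.
  by apply: measurable_set_le => //; apply: measurableT_comp => //; exact: measurable_funB.
have mA : measurable [set w | e <= `|ht_sum f w - Ef|].
  by apply: measurable_set_le => //; apply: measurableT_comp => //; exact: measurable_funB.
have sub : [set w | e <= `|ht_sum f w - Ef|] `<=` A0 `|` (A1 `|` A2).
  move=> w /= ew; have [[cw BK]|[_ KB]] := cutP w; last by left.
  right; have [g1|g1] := leP (e / 2) `|gap (zt w, ut w)|; first by left.
  right; rewrite /A2 /=.
  have := ler_normD (ht_sum f w - data_mean f w) (data_mean f w - Ef).
  rewrite addrA subrK; move: g1; rewrite gap_ht cw mul1r; lra.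
have mA12 := measurableU _ _ mA1 mA2.
apply: le_trans (pr_le P mA (measurableU _ _ mA0 mA12) sub) _.
apply: le_trans (pr_leU P mA0 mA12) _.
rewrite lerD2l; apply: le_trans (pr_leU P mA1 mA2) _.
have tau0 : 0 <= tau by apply: ERge0 => z; exact: sqr_ge0.
have e20 : 0 < (e / 2) ^+ 2 by rewrite exprn_gt0 // divr_gt0.
have se : 0 < s * e ^+ 2 by rewrite mulr_gt0 // exprn_gt0.
have B1 : pr P A1 <= 4 * K / (s * e ^+ 2) * tau.
  have [ig Eg] := gap_L2.
  apply: (@le_trans _ _ (((e / 2) ^+ 2)^-1 * \int[P]_w (gap (zt w, ut w) ^+ 2))).
    apply: pr_markov => // w; first exact: sqr_ge0.
    rewrite /A1 /= -(real_normK (num_real (gap _))) => h.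
    by rewrite lerXn2r ?nnegrE // divr_ge0 // ltW.
  rewrite (_ : _ * tau = ((e / 2) ^+ 2)^-1 * (K / s * tau)).
    by rewrite ler_wpM2l // invr_ge0 ltW.
  by field; rewrite s_neq0 gt_eqF.
have B2 : pr P A2 <= 4 / (s * e ^+ 2) * tau.
  have [ig Eg] := data_mean_L2.
  apply: (@le_trans _ _ (((e / 2) ^+ 2)^-1 * \int[P]_w ((data_mean f w - Ef) ^+ 2))).
    apply: pr_markov => // w; first exact: sqr_ge0.
    rewrite /A2 /= -(real_normK (num_real (_ - _))) => h.
    by rewrite lerXn2r ?nnegrE // divr_ge0 // ltW.
  rewrite (_ : 4 / _ * tau = ((e / 2) ^+ 2)^-1 * (s^-1 * tau)); last first.
    by field; rewrite s_neq0 gt_eqF.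
  rewrite ler_wpM2l ?invr_ge0 ?(ltW e20) //; apply: le_trans Eg _.
  by rewrite ler_wpM2r // lef_pV2 ?posrE // ltW.
apply: le_trans (lerD B1 B2) _.
by rewrite -mulrDl -mulrDl mulrDr mulr1.
Qed.

(** The conditional variance of [ht_sum f] given the data. *)
Definition ht_variance w : R :=
  \sum_(i < n) s * p i (zt w) * (1 - s * p i (zt w)) *
    (f (Z i w) / (n%:R * s * p i (zt w))) ^+ 2.

Lemma ht_varianceE w : ht_variance w =
  \sum_(i < n) f (Z i w) ^+ 2 / (n%:R ^+ 2 * s * p i (zt w)) -
  n%:R^-1 * data_mean (fun z => f z ^+ 2) w.
Proof.
rewrite /ht_variance /data_mean !mulr_sumr -sumrB; apply: eq_bigr => i _.
by field; rewrite n_neq0 s_neq0 p_neq0.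
Qed.

Lemma ht_variance_ge0 w : 0 <= ht_variance w.
Proof.
apply: sumr_ge0 => i _; have /andP[q0 q1] := q01 i w.
by apply: mulr_ge0 (sqr_ge0 _); apply: mulr_ge0 => //; rewrite subr_ge0.
Qed.

Lemma measurable_ht_variance : measurable_fun [set: T] ht_variance.
Proof.
have mq i : measurable_fun [set: T] (fun w => s * p i (zt w)) by exact: measurable_funM.
apply: measurable_sum => i; apply: measurable_funM.
  by apply: measurable_funM => //; exact: measurable_funB.
apply: measurable_funX; apply: measurable_funM; first exact: (measurableT_comp mf).
by apply: (measurableT_comp (@measurable_invr R)); exact: measurable_funM.
Qed.

(** Conditionally on the data, the Horvitz-Thompson sum is asymptotically normal
    with mean [data_mean f] and variance [ht_variance].  The design may depend on
    the data; the data and the uniform variables being independent, the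
    former are held fixed. *)
Lemma ht_sum_cos (a : R) :
  `|\int[P]_w cos (a + ht_sum f w) -
    \int[P]_w (expR (- (ht_variance w / 2)) * cos (a + data_mean f w))| <=
  4 * pr P [set w | K < max_inv_prob w] +
  4 * K / s * \int[Q]_z (f z ^+ 2 * Num.min 1 (K * `|f z| / s)).
Proof.
pose Phi (x : n.-tuple E * n.-tuple R) :=
  cos (a + n%:R^-1 * \sum_(i < n) f (tnth x.1 i) + gap x).
have mPhi : measurable_fun [set: n.-tuple E * n.-tuple R] Phi.
  apply: (measurableT_comp (@measurable_cos R)); apply: measurable_funD => //.
  apply: measurable_funD => //; apply: measurable_funM => //.
  by apply: measurable_sum => i; exact: (measurableT_comp (mft i)).
have Phi1 x : `|Phi x| <= 1 by exact: cos_max.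
have [mI EI] := freeze_bounded mzt mut (data_uniform_indep2 mZ mu Zu_indep) mPhi Phi1.
have mB := measurable_max_inv_prob.
pose A0 := [set w | K < max_inv_prob w].
have mA0 : measurable A0 by exact: measurable_set_lt.
have dmE w : n%:R^-1 * \sum_(i < n) f (tnth (zt w) i) = data_mean f w.
  by congr (_ * _); apply: eq_bigr => i _; rewrite tnth_mktuple.
have mht := measurable_ht_sum mf; have mdm := measurable_data_mean mf.
have mV := measurable_ht_variance.
have V0 := ht_variance_ge0.
have mcht : measurable_fun [set: T] (fun w => cos (a + ht_sum f w)).
  by apply: (measurableT_comp (@measurable_cos R)); exact: measurable_funD.
have mcdm : measurable_fun [set: T] (fun w => cos (a + data_mean f w)).
  by apply: (measurableT_comp (@measurable_cos R)); exact: measurable_funD.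
have mPzu : measurable_fun [set: T] (fun w => Phi (zt w, ut w)).
  by apply: (measurableT_comp mPhi); exact: measurable_fun_pair.
have mex (V : T -> R) : measurable_fun [set: T] V -> 
    measurable_fun [set: T] (fun w => expR (- (V w / 2)) * cos (a + data_mean f w)).
  move=> mV'; apply: measurable_funM => //; apply: measurableT_comp => //.
  by apply: measurableT_comp => //; exact: measurable_funM.
have ex1 (V : R) : 0 <= V -> `|expR (- (V / 2))| <= 1.
  by move=> V0'; rewrite ger0_norm ?expR_ge0 // expR_le1 oppr_le0 divr_ge0.
have var0 w : 0 <= var (zt w) by apply: sumr_ge0 => i _; exact: v_ge0.
have mvz : measurable_fun [set: T] (fun w => var (zt w)) := measurableT_comp mvar mzt.
have exc (V b : R) : 0 <= V -> `|expR (- (V / 2)) * cos b| <= 1.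
  by move=> V0'; rewrite normrM -[leRHS]mulr1 ler_pM ?ex1 ?cos_max.
have i1 := @integ_bounded _ _ _ P _ 1 mcht (fun w => cos_max _).
have i2 := @integ_bounded _ _ _ P _ 1 mPzu (fun w => Phi1 _).
have i3 := @integ_bounded _ _ _ P _ 1 (mex _ mV) (fun w => exc _ _ (V0 w)).
have i4 := @integ_bounded _ _ _ P _ 1 (mex _ mvz) (fun w => exc _ _ (var0 w)).
(* first comparison: the truncation of the weights *)
have S1 : `|\int[P]_w (cos (a + ht_sum f w) - Phi (zt w, ut w))| <= 0 + 2 * pr P A0.
  apply: ERsmall => //; first exact: measurable_funB.
    by move=> w; apply: le_trans (ler_normB _ _) _; rewrite -[leRHS]/(1 + 1) lerD ?cos_max.
  move=> w Aw; rewrite /Phi dmE gap_ht.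
  have [[-> _]|[_ KB]] := cutP w; last by case: Aw.
  have -> : a + data_mean f w + 1 * (ht_sum f w - data_mean f w) = a + ht_sum f w by ring.
  by rewrite subrr normr0.
(* second comparison: Lindeberg's replacement, given the data *)
pose rho z := f z ^+ 2 * Num.min 1 (K * `|f z| / s).
have rho_le z : 0 <= rho z <= f z ^+ 2.
  have m0 : 0 <= Num.min 1 (K * `|f z| / s).
    by rewrite le_min ler01 divr_ge0 ?mulr_ge0 // ltW.
  by rewrite mulr_ge0 ?sqr_ge0 //= ler_piMr ?sqr_ge0 // ge_min lexx.
have mrho : measurable_fun [set: E] rho.
  apply: measurable_funM; first exact: measurable_funX.
  apply: measurable_minr => //; apply: measurable_funM => //.
  by apply: measurable_funM => //; exact: measurableT_comp.
have irho : integ Q rho.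
  apply: (integ_dom mrho if2) => z; have /andP[r0 r1] := rho_le z.
  by rewrite ger0_norm.
have S2 : `|\int[P]_w Phi (zt w, ut w) -
    \int[P]_w (expR (- (var (zt w) / 2)) * cos (a + data_mean f w))| <=
    4 * K / s * \int[Q]_z rho z.
  have iI : integ P (fun w => \int[P]_x Phi (zt w, ut x)).
    apply: (@integ_bounded _ _ _ P _ 1 mI) => w.
    rewrite -[leRHS](ERcst P 1); apply: ERnorm_le => //; last exact: integ_cst.
    apply: (@integ_bounded _ _ _ P _ 1) => //.
    by apply: (measurableT_comp mPhi); exact: measurable_fun_pair.
  rewrite EI -ERB //.
  rewrite (_ : 4 * K / s * _ = \int[P]_w (\sum_(i < n) (4 * K / (n%:R * s)) * rho (Z i w))); last first.
    by rewrite sum_law //; congr (_ * _); field; rewrite n_neq0 s_neq0.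
  apply: ERnorm_le; first exact: integB.
    by apply: integ_sum => i; apply: integZ; exact: (law_integ (Z_law i) irho).
  move=> w.
  have := inclusion_sum_cos mZ u_law Zu_indep (c ^~ (zt w)) (q01 ^~ w) (a + data_mean f w).
  rewrite (_ : \int[P]_x cos _ = \int[P]_x Phi (zt w, ut x)); last first.
    by apply: eq_Rintegral => x _; rewrite /Phi gapE dmE.
  move=> /le_trans; apply; apply: ler_sum => i _.
  rewrite (_ : 4 * K / _ * _ = 4 * (K / (n%:R * s) * f (Z i w) ^+ 2 *
      Num.min 1 (K * `|f (Z i w)| / s))); last by rewrite /rho; ring.
  rewrite ler_wpM2l //; apply: ler_pM.
  - exact: v_ge0.
  - by rewrite le_min ler01 normr_ge0.
  - exact: v_le.
  - by rewrite le_min !ge_min lexx /= c_le orbT.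
(* third comparison: the truncation in the conditional variance *)
have S3 : `|\int[P]_w (expR (- (var (zt w) / 2)) * cos (a + data_mean f w) -
    expR (- (ht_variance w / 2)) * cos (a + data_mean f w))| <= 0 + 2 * pr P A0.
  apply: ERsmall => //; first by apply: measurable_funB; exact: mex.
    by move=> w; apply: le_trans (ler_normB _ _) _; rewrite -[leRHS]/(1 + 1) lerD ?exc.
  move=> w Aw; have [[cw _]|[_ KB]] := cutP w; last by case: Aw.
  rewrite (_ : var (zt w) = ht_variance w) ?subrr ?normr0 //.
  apply: eq_bigr => i _; rewrite /c cw mul1r tnth_mktuple //.
rewrite ERB // in S1; rewrite ERB // in S3.
move: S1 S2 S3; rewrite -/A0 !ler_norml.
move=> /andP[? ?] /andP[? ?] /andP[? ?]; apply/andP; split; lra.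
Qed.

End Statistic.
End PoissonSampling.

(** * Limit theorems for Horvitz-Thompson sums *)

Section Asymptotics.
Context {R : realType} {dT dE : measure_display} {T : measurableType dT}
  {E : measurableType dE}.
Variables (P : probability T R) (Q : probability E R).
Variables (Z : nat -> T -> E) (u : forall n, 'I_n -> T -> R).
Variables (s : nat -> R) (p : forall n, 'I_n -> n.-tuple E -> R).
Hypothesis Z_law : forall i, has_law P (Z i) Q.
Hypothesis u_law : forall n (i : 'I_n), has_law P (u i) (uniform_prob (@ltr01 R)).
Hypothesis Zu_indep : forall n,
  data_uniforms_independent P (fun i : 'I_n => Z i) (@u n).
Hypothesis p_meas : forall n (i : 'I_n), measurable_fun [set: n.-tuple E] (p i).
Hypothesis s_range : forall n, (1 < n)%N -> 0 < s n < n%:R.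
Hypothesis s_infty : s n @[n --> \oo] --> +oo.
Hypothesis design : forall n w, (1 < n)%N ->
  subsampling_distribution (s n) (fun i => @p n i (data_tuple n Z w)).
Hypothesis weights_tight : bounded_in_prob P (fun n w => max_inv_prob Z (@p n) w).

Notation hts n := (ht_sum Z (@u n) (s n) (@p n)).
Notation dmean n := (data_mean n Z).
Notation maxinv n := (max_inv_prob Z (@p n)).

Let s0 n : (1 < n)%N -> 0 < s n. Proof. by move=> /s_range /andP[]. Qed.
Let sn n : (1 < n)%N -> s n < n%:R. Proof. by move=> /s_range /andP[]. Qed.
Let dsg n (n1 : (1 < n)%N) w : subsampling_distribution (s n)
  (fun i => @p n i (data_tuple n Z w)) := design w n1.

Let near_gt1 : \forall n \near \oo, (1 < n)%N. Proof. exact: nbhs_infty_gt. Qed.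

Lemma weights_tight_pr e : 0 < e -> exists2 K : R, 0 <= K &
  \forall n \near \oo, pr P [set w | K < maxinv n w] <= e.
Proof.
move=> e0; have [K HK] := weights_tight e0; exists `|K| => //.
near=> n.
have mB : measurable_fun [set: T] (maxinv n) by exact: measurable_max_inv_prob.
have H : (P [set w | (K < `|maxinv n w|)%R] <= e%:E)%E by near: n.
rewrite -lee_fin prE; last exact: measurable_set_lt.
apply: le_trans H; apply: le_measure; rewrite ?inE; try apply: measurable_set_lt => //.
  exact: measurableT_comp.
move=> w /= h; apply: le_lt_trans (ler_norm _) _; apply: lt_le_trans h _.
exact: ler_norm.
Unshelve. all: by end_near. Qed.

(** Lindeberg's condition for a single law, by dominated convergence, with only
    a second moment. *)
Lemma weighted_lindeberg_cvg0 (f : E -> R) (K : R) : measurable_fun [set: E] f ->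
  integ Q (fun z => f z ^+ 2) -> 0 <= K ->
  \int[Q]_z (f z ^+ 2 * Num.min 1 (K * (`|f z| / Num.sqrt (s n)))) @[n --> \oo] --> (0 : R).
Proof.
move=> mf if2 K0; rewrite -(ERcst Q 0).
have m01 n z : 0 <= Num.min 1 (K * (`|f z| / Num.sqrt (s n))) <= 1.
  by rewrite le_min ler01 ge_min lexx /= mulr_ge0 ?divr_ge0 ?sqrtr_ge0.
apply: (ER_dominated (g := fun z => f z ^+ 2)) => //.
- move=> n; apply: measurable_funM; first exact: measurable_funX.
  apply: measurable_minr => //; apply: measurable_funM => //.
  by apply: measurable_funM => //; exact: measurableT_comp.
- move=> z; rewrite -[X in _ --> X](mulr0 (f z ^+ 2)); apply: cvgM; first exact: cvg_cst.
  apply/cvgrPdist_le => /= e e0; near=> n.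
  have /andP[h0 _] := m01 n z.
  rewrite sub0r normrN ger0_norm // ge_min; apply/orP; right.
  have n1 : (1 < n)%N by near: n; exact: near_gt1.
  have sq0 : 0 < Num.sqrt (s n) by rewrite sqrtr_gt0; exact: s0.
  rewrite mulrA ler_pdivrMr //.
  rewrite -ler_pdivrMl // mulrC.
  apply: (@le_trans _ _ (Num.sqrt ((K * `|f z| / e) ^+ 2))); first by rewrite sqrtr_sqr ler_norm.
  apply: ler_wsqrtr; near: n.
  by have /cvgryPge/(_ ((K * `|f z| / e) ^+ 2)) := s_infty.
- move=> n z; have /andP[h0 h1] := m01 n z.
  by rewrite /= (ger0_norm (mulr_ge0 (sqr_ge0 _) h0)) ler_piMr ?sqr_ge0.
Unshelve. all: by end_near. Qed.

(** The weak law of large numbers under a first moment only: truncate at a level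
    [M] that leaves a small mean, then apply Chebyshev's inequality.  It is
    applied to the squares of functions that have two moments. *)
Lemma data_mean_lln (g : E -> R) : integ Q g -> forall e eta : R, 0 < e -> 0 < eta ->
  \forall n \near \oo, pr P [set w | e <= `|dmean n g w - \int[Q]_z g z|] <= eta.
Proof.
move=> ig e eta e0 eta0; have mg := integ_meas ig.
pose gM (M : nat) z := Num.max (- M%:R) (Num.min M%:R (g z)).
have mgM M : measurable_fun [set: E] (gM M).
  by apply: measurable_maxr => //; exact: measurable_minr.
have gMb M z : `|gM M z| <= M%:R.
  rewrite ler_norml /gM le_max lexx /= ge_max ge_min lexx andbT.
  by rewrite (le_trans (_ : _ <= 0)) // oppr_le0.
have dgM M z : `|g z - gM M z| <= `|g z|.
  have M0 : 0 <= M%:R :> R by [].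
  have a1 := ler_norm (g z); have a2 := ler_norm (- g z); rewrite normrN in a2.
  have a3 := normr_ge0 (g z); rewrite ler_norml /gM.
  by case: (leP M%:R (g z)) => h1; case: (leP (- M%:R) _) => h2; apply/andP; split; lra.
have igM M : integ Q (gM M) := @integ_bounded _ _ _ Q _ M%:R (mgM M) (gMb M).
have igM2 M : integ Q (fun z => gM M z ^+ 2).
  apply: (@integ_bounded _ _ _ Q _ (M%:R ^+ 2)); first exact: measurable_funX.
  by move=> z; rewrite normrX lerXn2r ?nnegrE.
pose r M := \int[Q]_z `|g z - gM M z|.
have idg M : integ Q (fun z => g z - gM M z) by exact: integB.
have rcvg : r M @[M --> \oo] --> (0 : R).
  rewrite -(ERcst Q 0); apply: (ER_dominated (g := fun z => `|g z|)).
  - by move=> M; apply: measurableT_comp => //; exact: measurable_funB.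
  - move=> z; apply/cvgrPdist_le => /= d d0; near=> M.
    suff -> : gM M z = g z by rewrite subrr normr0 subrr normr0 ltW.
    have : `|g z| <= M%:R by near: M; exact: nbhs_infty_ger.
    rewrite ler_norml => /andP[a b].
    by rewrite /gM min_r // max_r.
  - exact: integ_norm.
  - by move=> M z; rewrite normr_id.
have [M rM] : exists M, r M <= Num.min (e / 4) (e * eta / 8).
  have m0 : 0 < Num.min (e / 4) (e * eta / 8) by rewrite lt_min !divr_gt0 // mulr_gt0.
  have /cvgrPdist_le/(_ _ m0)[N _ /(_ N (leqnn N))] := rcvg.
  rewrite /= sub0r normrN => h; exists N; apply: le_trans h; exact: ler_norm.
move: rM; rewrite le_min => /andP[rM1 rM2].
have r0 : 0 <= r M by apply: ERge0.
near=> n.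
have n1 : (1 < n)%N by near: n; exact: near_gt1.
have n0 : 0 < n%:R :> R by rewrite ltr0n; apply: ltn_trans n1.
have [i2 E2] := data_mean_L2 Z_law (@u_law n) (@Zu_indep n) (s0 n1) (sn n1) (mgM M) (igM2 M).
have mdm (f : E -> R) : measurable_fun [set: E] f -> measurable_fun [set: T] (dmean n f).
  by move=> mf; exact: measurable_data_mean.
(* at least [1] on the event: Markov for the tail, Chebyshev for the rest *)
pose h w := 4 / e * dmean n (fun z => `|g z - gM M z|) w +
  4 / e ^+ 2 * (dmean n (gM M) w - \int[Q]_z gM M z) ^+ 2.
have ie : integ P (dmean n (fun z => `|g z - gM M z|)).
  apply: integZ; apply: integ_sum => i.
  exact: (@law_integ _ _ _ _ _ _ _ _ (Z_law i) (fun z => `|g z - gM M z|) (integ_norm (idg M))).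
have Ee : \int[P]_w dmean n (fun z => `|g z - gM M z|) w = r M.
  rewrite /data_mean ERZ; last first.
    apply: integ_sum => i.
    exact: (@law_integ _ _ _ _ _ _ _ _ (Z_law i) (fun z => `|g z - gM M z|) (integ_norm (idg M))).
  rewrite ERsum; last first.
    move=> i.
    exact: (@law_integ _ _ _ _ _ _ _ _ (Z_law i) (fun z => `|g z - gM M z|) (integ_norm (idg M))).
  rewrite (eq_bigr (fun=> r M)) ?sum_ord_cst ?mulrA ?mulVf ?mul1r ?gt_eqF //.
  move=> i _; apply: (@law_Rintegral _ _ _ _ _ _ _ _ (Z_law i) (fun z => `|g z - gM M z|)).
  exact: integ_norm.
have ih : integ P h by apply: integD; exact: integZ.
apply: le_trans (@pr_markov _ _ _ P h _ 1 ih _ _ ltr01 _) _.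
- apply: measurable_set_le => //; apply: measurableT_comp => //.
  by apply: measurable_funB => //; exact: mdm.
- move=> w; apply: addr_ge0; apply: mulr_ge0.
  + by rewrite divr_ge0 // ltW.
  + by apply: mulr_ge0; [rewrite invr_ge0|exact: sumr_ge0].
  + by rewrite divr_ge0 // sqr_ge0.
  + exact: sqr_ge0.
- move=> w /= ew.
  have dec : dmean n g w = dmean n (fun z => g z - gM M z) w + dmean n (gM M) w.
    by rewrite /data_mean sumrB mulrBr subrK.
  have Edec : \int[Q]_z g z = \int[Q]_z (g z - gM M z) + \int[Q]_z gM M z.
    by rewrite ERB // subrK.
  have b1 : `|\int[Q]_z (g z - gM M z)| <= r M by apply: ERnorm_le => //; exact: integ_norm.
  set X := dmean n (fun z => `|g z - gM M z|) w.
  have b2 : `|dmean n (fun z => g z - gM M z) w| <= X.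
    rewrite /X /data_mean normrM ger0_norm ?invr_ge0 // ler_wpM2l ?invr_ge0 //.
    exact: ler_norm_sum.
  pose Y := dmean n (gM M) w - \int[Q]_z gM M z.
  have tri : e <= X + e / 4 + `|Y|.
    apply: le_trans ew _; rewrite dec Edec.
    rewrite (_ : _ - _ = dmean n (fun z => g z - gM M z) w - \int[Q]_z (g z - gM M z) + Y);
      last by rewrite /Y; ring.
    apply: le_trans (ler_normD _ _) _; rewrite lerD2r.
    apply: le_trans (ler_normB _ _) _; rewrite lerD //; exact: le_trans rM1.
  rewrite /h -/X -/Y -[Y ^+ 2]real_normK ?num_real //.
  have X0 : 0 <= X by apply: le_trans b2.
  case: (lerP (e / 4) X) => hX.
    have : 1 <= 4 / e * X by rewrite mulrAC ler_pdivlMr //; lra.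
    move=> h1; apply: le_trans h1 _; rewrite lerDl mulr_ge0 ?sqr_ge0 // divr_ge0 //.
    exact: sqr_ge0.
  have : 1 <= 4 / e ^+ 2 * `|Y| ^+ 2.
    rewrite mulrAC ler_pdivlMr ?exprn_gt0 // mul1r.
    have : e / 2 <= `|Y| by lra.
    by move=> h1; rewrite (_ : e ^+ 2 = 4 * (e / 2) ^+ 2); [rewrite ler_wpM2l // lerXn2r ?nnegrE // divr_ge0 ?ltW|field].
  move=> h1; apply: le_trans h1 _; rewrite lerDr mulr_ge0 // divr_ge0 //.
  exact: ltW.
rewrite invr1 mul1r /h (ERD (integZ _ ie) (integZ _ i2)) (ERZ _ ie) (ERZ _ i2) Ee.
have t1 : 4 / e * r M <= eta / 2.
  rewrite mulrAC ler_pdivrMr //; lra.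
have c0 : 0 <= 4 / e ^+ 2 by rewrite divr_ge0 ?sqr_ge0.
have t2 : 4 / e ^+ 2 * \int[P]_w (dmean n (gM M) w - \int[Q]_z gM M z) ^+ 2 <= eta / 2.
  apply: (@le_trans _ _ (4 / e ^+ 2 * (n%:R^-1 * \int[Q]_z (gM M z) ^+ 2))).
    by rewrite ler_wpM2l.
  rewrite mulrCA mulrC ler_pdivrMr // -ler_pdivrMl ?divr_gt0 //.
  by near: n; exact: nbhs_infty_ger.
lra.
Unshelve. all: by end_near. Qed.

Lemma ht_sum_lln (f : E -> R) : measurable_fun [set: E] f ->
  integ Q (fun z => f z ^+ 2) -> forall e eta : R, 0 < e -> 0 < eta ->
  \forall n \near \oo, pr P [set w | e <= `|hts n f w - \int[Q]_z f z|] <= eta.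
Proof.
move=> mf if2 e eta e0 eta0.
have h0 : 0 < eta / 2 by rewrite divr_gt0.
have [K K0 HK] := weights_tight_pr h0.
near=> n.
have n1 : (1 < n)%N by near: n; exact: near_gt1.
apply: le_trans (ht_sum_deviation Z_law (@u_law n) (@Zu_indep n) (@p_meas n)
  (s0 n1) (sn n1) (dsg n1) mf if2 K0 e0) _.
rewrite [eta]splitr lerD //; first by near: n.
set tau := \int[Q]_z _.
have sp := s0 n1.
rewrite (_ : _ * tau = (4 * (K + 1) / e ^+ 2 * tau) / s n); last first.
  by field; rewrite !gt_eqF.
rewrite ler_pdivrMr // [eta / 2 * _]mulrC -ler_pdivrMr //; near: n.
move: s_infty => /cvgryPge; exact.
Unshelve. all: by end_near. Qed.

(** At the scale [L / sqrt s] the bound of [ht_sum_deviation] no longer depends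
    on [s]. *)
Lemma ht_sum_tight (f : E -> R) : measurable_fun [set: E] f ->
  integ Q (fun z => f z ^+ 2) -> \int[Q]_z f z = 0 -> forall eta : R, 0 < eta ->
  exists2 L : R, 0 < L &
    \forall n \near \oo, pr P [set w | L <= Num.sqrt (s n) * `|hts n f w|] <= eta.
Proof.
move=> mf if2 Ef eta eta0.
have h0 : 0 < eta / 2 by rewrite divr_gt0.
have [K K0 HK] := weights_tight_pr h0.
set tau := \int[Q]_z (f z ^+ 2).
have tau0 : 0 <= tau by apply: ERge0 => z; exact: sqr_ge0.
pose B := 4 * (K + 1) * tau / (eta / 2).
have B0 : 0 <= B by rewrite divr_ge0 ?mulr_ge0 ?addr_ge0 // ltW.
have L0 : 0 < 1 + B by lra.
exists (1 + B) => //.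
near=> n.
have n1 : (1 < n)%N by near: n; exact: near_gt1.
have sp := s0 n1.
have sq0 : 0 < Num.sqrt (s n) by rewrite sqrtr_gt0.
have e0 : 0 < (1 + B) / Num.sqrt (s n) by rewrite divr_gt0.
have := ht_sum_deviation Z_law (@u_law n) (@Zu_indep n) (@p_meas n)
  (s0 n1) (sn n1) (dsg n1) mf if2 K0 e0.
rewrite Ef (_ : [set w | _ <= `|_ - 0|] = [set w | 1 + B <= Num.sqrt (s n) * `|hts n f w|]); last first.
  by apply/seteqP; split => w /=; rewrite subr0 ler_pdivrMr // mulrC.
move=> /le_trans; apply.
rewrite [eta]splitr lerD //; first by near: n.
rewrite exprMn exprVn sqr_sqrtr; last exact: ltW.
rewrite mulrCA divff ?gt_eqF // mulr1 -/tau.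
rewrite mulrAC ler_pdivrMr; last exact: exprn_gt0.
by rewrite [eta / 2 * _]mulrC -ler_pdivrMr // -/B; nra.
Unshelve. all: by end_near. Qed.

Section CentralLimit.
Variable f : E -> R.
Hypothesis mf : measurable_fun [set: E] f.
Hypothesis if2 : integ Q (fun z => f z ^+ 2).
Hypothesis Ef : \int[Q]_z f z = 0.

Let tau : R := \int[Q]_z (f z ^+ 2).
Let lind n (k : R) : R :=
  \int[Q]_z (f z ^+ 2 * Num.min 1 (k * (`|f z| / Num.sqrt (s n)))).

Definition ht_square_sum n w : R :=
  \sum_(i < n) f (Z i w) ^+ 2 / (n%:R ^+ 2 * @p n i (data_tuple n Z w)).

Lemma measurable_ht_square_sum n : measurable_fun [set: T] (ht_square_sum n).
Proof.
apply: measurable_sum => i; apply: measurable_funM.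
  by apply: measurable_funX; exact: (measurableT_comp mf (Z_law i).1).
apply: (measurableT_comp (@measurable_invr R)); apply: measurable_funM => //.
apply: (measurableT_comp (p_meas i)).
by apply: measurable_data_tuple => j; exact: (Z_law j).1.
Qed.

Let tau0 : 0 <= tau. Proof. by apply: ERge0 => z; exact: sqr_ge0. Qed.

Let lind_ge0 n k z : 0 <= k -> 0 <= f z ^+ 2 * Num.min 1 (k * (`|f z| / Num.sqrt (s n))) <= f z ^+ 2.
Proof.
move=> k0; set x := Num.min _ _.
have /andP[x0 x1] : 0 <= x <= 1.
  by rewrite le_min ler01 ge_min lexx /= mulr_ge0 ?divr_ge0 ?sqrtr_ge0.
by rewrite (mulr_ge0 (sqr_ge0 _) x0) ler_piMr ?sqr_ge0.
Qed.

Let lind_integ n k : 0 <= k ->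
  integ Q (fun z => f z ^+ 2 * Num.min 1 (k * (`|f z| / Num.sqrt (s n)))).
Proof.
move=> k0; apply: (integ_dom _ if2).
  apply: measurable_funM; first exact: measurable_funX.
  apply: measurable_minr => //; apply: measurable_funM => //.
  by apply: measurable_funM => //; exact: measurableT_comp.
by move=> z; have /andP[x0 x1] := lind_ge0 n z k0; rewrite (ger0_norm x0).
Qed.

(** The error splits into three: the sampling given the data, the replacement of
    the conditional variance by its limit, and the sampling of the data. *)
Lemma ht_sum_clt_bound n (sigma2 K dl c : R) : (1 < n)%N ->
  0 <= sigma2 -> 0 <= K -> 0 < dl ->
  `|\int[P]_w cos (c + Num.sqrt (s n) * hts n f w) - expR (- (sigma2 / 2)) * cos c| <=
  4 * pr P [set w | K < maxinv n w] + 4 * K * lind n K +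
  (expR (tau / 2) * dl + (1 + expR (tau / 2)) *
     (pr P [set w | dl <= `|ht_square_sum n w - sigma2|] +
      pr P [set w | dl <= `|dmean n (fun z => f z ^+ 2) w - tau|])) +
  expR (tau / 2) * (3 * lind n 1 + tau ^+ 2 / n%:R).
Proof.
move=> n1 sg0 K0 dl0; set C := expR (tau / 2); pose S := ht_square_sum n.
have C0 : 0 <= C by exact: expR_ge0.
have sp := s0 n1; have sl := sn n1.
have np : 0 < n%:R :> R := lt_trans sp sl.
pose rs := Num.sqrt (s n).
have rs0 : 0 < rs by rewrite sqrtr_gt0.
have rs2 : rs ^+ 2 = s n by rewrite sqr_sqrtr // ltW.
(* the rescaled function makes [sqrt s] times a sum of [f] a sum of [g] *)
pose g z := rs * f z.
have mg : measurable_fun [set: E] g by exact: measurable_funM.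
have g2E z : g z ^+ 2 = s n * f z ^+ 2 by rewrite /g exprMn rs2.
have ig2 : integ Q (fun z => g z ^+ 2) by rewrite (funext g2E); exact: integZ.
have Eg2 : \int[Q]_z (g z ^+ 2) = s n * tau by rewrite (funext g2E) ERZ.
have Eg : \int[Q]_z g z = 0.
  by rewrite /g ERZ ?Ef ?mulr0 //; exact: integ_of_sqr.
have htg w : hts n g w = rs * hts n f w.
  by rewrite /ht_sum mulr_sumr; apply: eq_bigr => i _; rewrite mulrCA.
pose V w := ht_variance Z (s n) (@p n) g w.
have mV : measurable_fun [set: T] V by exact: measurable_ht_variance.
have V0 w : 0 <= V w by exact: (ht_variance_ge0 sp (dsg n1)).
pose D w := dmean n (fun z => f z ^+ 2) w.
have mD : measurable_fun [set: T] D.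
  by apply: measurable_data_mean => //; exact: measurable_funX.
have mS : measurable_fun [set: T] S by exact: measurable_ht_square_sum.
pose rho := s n / n%:R.
have rho0 : 0 <= rho by rewrite divr_ge0 // ltW.
have rho1 : rho <= 1 by rewrite ler_pdivrMr // mul1r ltW.
have VE w : V w = S w - rho * D w.
  rewrite /V (ht_varianceE sp sl (dsg n1)); congr (_ - _).
    apply: eq_bigr => i _; rewrite g2E.
    have [pp _ _] := design w n1; have p0 := pp i.
    by field; rewrite !gt_eqF.
  rewrite /D /data_mean (eq_bigr (fun i : 'I_n => s n * f (Z i w) ^+ 2)); last by move=> i _; exact: g2E.
  by rewrite -mulr_sumr /rho; ring.
(* what [V] approaches; it may be negative for a given [n], but not below
   [- tau], which bounds the Lipschitz constant of the exponential *)
pose kappa := sigma2 - rho * tau.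
have kap0 : - tau <= kappa.
  have : rho * tau <= tau by rewrite ler_piMl.
  by rewrite /kappa; lra.
pose Y w := cos (c + dmean n g w).
have Y1 w : `|Y w| <= 1 by exact: cos_max.
have mY : measurable_fun [set: T] Y.
  apply: (measurableT_comp (@measurable_cos R)); apply: measurable_funD => //.
  exact: measurable_data_mean.
have mexp : measurable_fun [set: T] (fun w => expR (- (V w / 2))).
  apply: measurableT_comp => //; apply: measurableT_comp => //.
  exact: measurable_funM.
have ek : 0 <= expR (- (kappa / 2)) <= C.
  by rewrite expR_ge0 ler_expR; lra.
have eV w : 0 <= expR (- (V w / 2)) <= 1.
  by rewrite expR_ge0 expR_le1 oppr_le0 divr_ge0.
have step1 : `|\int[P]_w cos (c + rs * hts n f w) -
    \int[P]_w (expR (- (V w / 2)) * Y w)| <=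
    4 * pr P [set w | K < maxinv n w] + 4 * K * lind n K.
  have := ht_sum_cos Z_law (@u_law n) (@Zu_indep n) (@p_meas n) sp sl (dsg n1) mg ig2 K0 c.
  rewrite (_ : (fun w => cos (c + hts n g w)) = fun w => cos (c + rs * hts n f w)); last first.
    by apply/funext => w; rewrite htg.
  move=> /le_trans; apply; rewrite lerD2l.
  rewrite (_ : (fun z => g z ^+ 2 * _) = (fun z => s n * (f z ^+ 2 *
     Num.min 1 (K * (`|f z| / rs))))); last first.
    apply/funext => z; rewrite g2E mulrA; congr (_ * Num.min _ _).
    by rewrite /g normrM (gtr0_norm rs0) -rs2; field; rewrite gt_eqF.
  rewrite ERZ; last exact: lind_integ.
  by rewrite le_eqVlt; apply/orP; left; apply/eqP; rewrite /lind; field; rewrite gt_eqF.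
have step2 : `|\int[P]_w (expR (- (V w / 2)) * Y w) -
    \int[P]_w (expR (- (kappa / 2)) * Y w)| <=
    C * dl + (1 + C) * (pr P [set w | dl <= `|S w - sigma2|] + pr P [set w | dl <= `|D w - tau|]).
  have iY : integ P Y by exact: (@integ_bounded _ _ _ P _ 1).
  rewrite -ERB; last exact: integZ; last first.
    apply: (@integ_bounded _ _ _ P _ 1); first exact: measurable_funM.
    by move=> w; have /andP[a b] := eV w; rewrite normrM -[leRHS]mulr1 ler_pM // (ger0_norm a).
  have mA : measurable [set w | dl <= `|S w - sigma2|].
    by apply: measurable_set_le => //; apply: measurableT_comp => //; exact: measurable_funB.
  have mB : measurable [set w | dl <= `|D w - tau|].
    by apply: measurable_set_le => //; apply: measurableT_comp => //; exact: measurable_funB.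
  have C10 : 0 <= 1 + C by rewrite addr_ge0.
  apply: le_trans (_ : _ <= C * dl + (1 + C) * pr P ([set w | dl <= `|S w - sigma2|] `|`
     [set w | dl <= `|D w - tau|])) _; last by rewrite lerD2l ler_wpM2l // pr_leU.
  apply: ERsmall.
  - by apply: measurable_funB; apply: measurable_funM.
  - exact: measurableU.
  - move=> w; rewrite -mulrBl normrM -[leRHS]mulr1 ler_pM //.
    have /andP[a b] := eV w; have /andP[a' b'] := ek.
    by rewrite ler_norml; apply/andP; split; lra.
  - move=> w /= /not_orP[/negP + /negP]; rewrite -!ltNge => hS hD.
    rewrite -mulrBl normrM -[leRHS]mulr1 ler_pM //.
    apply: le_trans (_ : C * `|V w / 2 - kappa / 2| <= _).
      by apply: expRN_lip; have := V0 w; have := tau0; lra.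
    rewrite ler_wpM2l // VE /kappa.
    rewrite (_ : _ - _ = ((S w - sigma2) - rho * (D w - tau)) / 2); last by field.
    rewrite normrM [`|2^-1|]ger0_norm // ler_pdivrMr //.
    apply: le_trans (ler_normB _ _) _; rewrite normrM (ger0_norm rho0).
    have : rho * `|D w - tau| <= `|D w - tau| by rewrite ler_piMl.
    lra.
  - by rewrite mulr_ge0 // ltW.
have step3 : `|\int[P]_w (expR (- (kappa / 2)) * Y w) - expR (- (sigma2 / 2)) * cos c| <=
    C * (3 * lind n 1 + tau ^+ 2 / n%:R).
  rewrite ERZ; last exact: (@integ_bounded _ _ _ P _ 1).
  (* the two variances add up to [sigma2] *)
  rewrite (_ : expR (- (sigma2 / 2)) = expR (- (kappa / 2)) * expR (- (n%:R^-1 * (s n * tau) / 2))); last first.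
    by rewrite -expRD /kappa /rho; congr expR; field; rewrite gt_eqF.
  rewrite -mulrA -mulrBr normrM; have /andP[a b] := ek; rewrite (ger0_norm a).
  apply: ler_pM => //.
  have := data_mean_cos Z_law (@u_law n) (@Zu_indep n) sp sl mg ig2 c Eg; rewrite Eg2.
  move=> /le_trans; apply; apply: lerD.
    have ig3 : integ Q (fun z => g z ^+ 2 * Num.min 1 (`|g z| / n%:R)).
      apply: (integ_dom _ ig2).
        apply: measurable_funM; first exact: measurable_funX.
        apply: measurable_minr => //; apply: measurable_funM => //.
        exact: measurableT_comp.
      move=> z; set x := Num.min _ _.
      have /andP[x0 x1] : 0 <= x <= 1 by rewrite le_min ler01 ge_min lexx /= divr_ge0.
      by rewrite (ger0_norm (mulr_ge0 (sqr_ge0 _) x0)) ler_piMr ?sqr_ge0.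
    rewrite /lind -(ERZ _ ig3) -(ERZ _ (lind_integ n ler01)).
    apply: ERle; [exact: integZ|by apply: integZ; exact: lind_integ|move=> z].
    rewrite g2E (_ : 3 / n%:R * _ = 3 * (f z ^+ 2 * (rho * Num.min 1 (`|g z| / n%:R)))); last first.
      by rewrite /rho; ring.
    rewrite ler_wpM2l // ler_wpM2l ?sqr_ge0 // mul1r.
    have x0 : 0 <= Num.min 1 (`|g z| / n%:R) by rewrite le_min ler01 divr_ge0.
    apply: le_trans (_ : _ <= Num.min 1 (`|g z| / n%:R)) _; first by rewrite ler_piMl.
    rewrite le_min !ge_min lexx /=; apply/orP; right.
    rewrite /g normrM (gtr0_norm rs0) ler_pdivrMr // (_ : rs * `|f z| = `|f z| / rs * s n); last first.
      by rewrite -rs2; field; rewrite gt_eqF.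
    by apply: ler_wpM2l; [rewrite divr_ge0 // ltW|exact: ltW].
  rewrite exprMn mulrAC (_ : _ / _ * _ = tau ^+ 2 / n%:R * (rho ^+ 2)); last first.
    by rewrite /rho; field; rewrite gt_eqF.
  rewrite ler_piMr // ?expr_le1 //.
  by rewrite divr_ge0 ?sqr_ge0.
rewrite -/rs -/D -/S.
move: step1 step2 step3; rewrite !ler_norml.
move=> /andP[? ?] /andP[? ?] /andP[? ?]; apply/andP; split; lra.
Qed.

(** The conditional variance [S - (s/n) tau] given the data and the variance
    [(s/n) tau] of the conditional mean add up to the limit of [S], whatever the
    behaviour of the sampling fraction [s/n]. *)
Lemma ht_sum_clt (sigma2 : R) : 0 <= sigma2 ->
  (forall e eta : R, 0 < e -> 0 < eta -> \forall n \near \oo,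
     pr P [set w | e <= `|ht_square_sum n w - sigma2|] <= eta) ->
  forall c, \int[P]_w cos (c + Num.sqrt (s n) * hts n f w) @[n --> \oo] -->
    expR (- (sigma2 / 2)) * cos c.
Proof.
move=> sg0 Scvg c; apply/cvgrPdist_le => /= e e0.
set C := expR (tau / 2); have C0 : 0 < C by exact: expR_gt0.
have e40 : 0 < e / 16 by rewrite divr_gt0.
have [K K0 HK] := weights_tight_pr e40.
have dl0 : 0 < e / 8 / C by rewrite divr_gt0 ?divr_gt0.
have eta0 : 0 < e / 16 / (1 + C) by rewrite divr_gt0 ?divr_gt0 // addr_gt0.
have HS := Scvg _ _ dl0 eta0.
have HD := data_mean_lln if2 dl0 eta0.
have d10 : 0 < e / 8 / (4 * (K + 1)).
  by rewrite divr_gt0 ?divr_gt0 // mulr_gt0 // ltr_pwDr.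
have d20 : 0 < e / 24 / C by rewrite divr_gt0 ?divr_gt0.
have d30 : 0 < e / 8 / C by rewrite divr_gt0 ?divr_gt0.
have /cvgrPdist_le/(_ _ d10) H1 := weighted_lindeberg_cvg0 mf if2 K0.
have /cvgrPdist_le/(_ _ d20) H2 := weighted_lindeberg_cvg0 mf if2 ler01.
near=> n.
have n1 : (1 < n)%N by near: n; exact: near_gt1.
have n0 : 0 < n%:R :> R by rewrite ltr0n; apply: ltn_trans n1.
rewrite distrC; apply: le_trans (ht_sum_clt_bound c n1 sg0 K0 dl0) _.
have h1 : lind n K <= e / 8 / (4 * (K + 1)).
  have : `|0 - lind n K| <= e / 8 / (4 * (K + 1)) by near: n.
  by rewrite sub0r normrN; apply: le_trans; exact: ler_norm.
have h2 : lind n 1 <= e / 24 / C.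
  have : `|0 - lind n 1| <= e / 24 / C by near: n.
  by rewrite sub0r normrN; apply: le_trans; exact: ler_norm.
have h3 : pr P [set w | K < maxinv n w] <= e / 16 by near: n.
have h4 : pr P [set w | e / 8 / C <= `|ht_square_sum n w - sigma2|] <= e / 16 / (1 + C) by near: n.
have h5 : pr P [set w | e / 8 / C <= `|dmean n (fun z => f z ^+ 2) w - tau|] <=
  e / 16 / (1 + C) by near: n.
have h6 : tau ^+ 2 / n%:R <= e / 8 / C.
  rewrite ler_pdivrMr // -ler_pdivrMl //; near: n; exact: nbhs_infty_ger.
have h0 : 0 <= lind n K by apply: ERge0 => z; have /andP[] := lind_ge0 n z K0.
have k1 : 4 * K * lind n K <= e / 8.
  have kp : 0 < K + 1 by lra.
  move: h1; rewrite ler_pdivlMr ?mulr_gt0 // => h1.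
  have : 0 <= lind n K * 4 by rewrite mulr_ge0.
  nra.
have k2 : C * (e / 8 / C) = e / 8 by rewrite mulrC divfK // gt_eqF.
have k3 : (1 + C) * (e / 16 / (1 + C)) = e / 16 by rewrite mulrC divfK // gt_eqF // addr_gt0.
have k4 : C * (e / 24 / C) = e / 24 by rewrite mulrC divfK // gt_eqF.
have C1 : 0 <= 1 + C by lra.
have := ler_wpM2l C1 h4; have := ler_wpM2l C1 h5; rewrite k3 => k5 k6.
have := ler_wpM2l (ltW C0) h2; rewrite k4 => k7.
have := ler_wpM2l (ltW C0) h6; rewrite k2 => k8.
rewrite -/C !mulrDr [C * (3 * _)]mulrCA; lra.
Unshelve. all: by end_near. Qed.

End CentralLimit.

End Asymptotics.

(** * The weighted criterion *)

Lemma quad_weighted_sum (R : realType) (d n : nat) (w : 'I_n -> R)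
    (A : 'I_n -> 'M[R]_d) (v : 'rV[R]_d) :
  quad (\matrix_(k, l) \sum_(i < n) w i * A i k l) v = \sum_(i < n) w i * quad (A i) v.
Proof.
rewrite quad_entries.
transitivity (\sum_k \sum_l \sum_(i < n) w i * (v 0 k * v 0 l * A i k l)).
  apply: eq_bigr => k _; apply: eq_bigr => l _; rewrite mxE mulr_sumr.
  by apply: eq_bigr => i _; rewrite mulrCA.
under eq_bigr do rewrite exchange_big /=.
rewrite exchange_big /=; apply: eq_bigr => i _.
rewrite quad_entries mulr_sumr; apply: eq_bigr => k _.
by rewrite mulr_sumr.
Qed.

Lemma norm_mulmx_le {R : realType} {d : nat} (x : 'rV[R]_d) (A : 'M[R]_d) (c : R) :
  0 <= c -> (forall k, `|x 0 k| <= c) ->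
  `|x *m A| <= c * \sum_k \sum_l `|A k l|.
Proof.
move=> c0 xc; apply: norm_le_coord => [|l].
  by rewrite mulr_ge0 // sumr_ge0 // => k _; exact: sumr_ge0.
rewrite mxE; apply: le_trans (ler_norm_sum _ _ _) _; rewrite mulr_sumr.
apply: ler_sum => k _; rewrite normrM; apply: ler_pM => //.
by rewrite (bigD1 l) //= lerDl sumr_ge0.
Qed.

Section WeightedCriterion.
Context {R : realType} {d : nat} {E : Type}.
Variables (m : E -> 'rV[R]_d -> R) (n : nat) (z : 'I_n -> E).

(** The random normalization by the subsample size does not move the maximizer;
    replacing the size by its mean [s] gives a sum of independent terms given the
    data.  For an empty subsample both sides vanish. *)
Lemma poisson_objective_weights (s : R) (p u : 'I_n -> R) t : 0 < s ->
  (forall i, 0 < p i) ->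
  \sum_(i < n) le_indic (u i, s * p i) / (n%:R * s * p i) * m (z i) t =
  #|poisson_included s p u|%:R / s * poisson_objective m s z p u t.
Proof.
move=> s0 p0; rewrite /poisson_objective.
set B := poisson_included s p u; set N := #|B|.
have s1 : s != 0 by rewrite gt_eqF.
have p1 i : p i != 0 by rewrite gt_eqF.
have [N0|N0] := eqVneq N 0%N.
  rewrite N0 !mul0r big1 // => i _.
  have : i \notin B by have /card0_eq := N0; move=> ->.
  by rewrite /B /poisson_included unfold_in le_indicE => /negbTE ->; rewrite !mul0r.
rewrite mulr_sumr [RHS]big_mkcond /=; apply: eq_bigr => i _.
rewrite le_indicE -/(poisson_included s p u i) -/B.
case: (B i); last by rewrite !mul0r.
have n0 : n%:R != 0 :> R by rewrite pnatr_eq0; case: (n) i => // -[].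
by rewrite mulr1n; field; rewrite n0 s1 p1 pnatr_eq0 N0.
Qed.

Lemma argmax_scale (U : Type) (D : set U) (f g : U -> R) (k : R) t : 0 <= k ->
  (forall x, g x = k * f x) -> is_argmax D f t -> is_argmax D g t.
Proof. by move=> k0 gf [Dt mt]; split=> // t' Dt'; rewrite !gf ler_wpM2l // mt. Qed.

Variable w : 'I_n -> R.
Hypothesis w0 : forall i, 0 <= w i.

Lemma weighted_sum_concave : (forall x, concave (m x)) ->
  forall x y (l : R), 0 <= l <= 1 ->
  l * (\sum_(i < n) w i * m (z i) x) + (1 - l) * (\sum_(i < n) w i * m (z i) y) <=
  \sum_(i < n) w i * m (z i) (l *: x + (1 - l) *: y).
Proof.
move=> mc x y l l01; rewrite !mulr_sumr -big_split /=; apply: ler_sum => i _.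
rewrite mulrCA [(1 - l) * _]mulrCA -mulrDr ler_wpM2l //; exact: concaveP.
Qed.

(** The pointwise expansions are summed; the Hessian of the sum is then exchanged
    for the matrix [H], at a cost quadratic in [v]. *)
Lemma weighted_sum_taylor (t v : 'rV[R]_d) (C : R) (psi : E -> R) (H : 'M[R]_d)
    (dl : R) :
  (forall x, `|m x (t + v) - m x t - dot (grad (m x) t) v - quad (hess (m x) t) v / 2| <=
     C * `|psi x| * `|v| ^+ 3) ->
  (forall k l, `|\sum_(i < n) w i * hess (m (z i)) t k l - H k l| <= dl) ->
  `|(\sum_(i < n) w i * m (z i) (t + v)) - (\sum_(i < n) w i * m (z i) t) -
    dot (\row_k \sum_(i < n) w i * grad (m (z i)) t 0 k) v - quad H v / 2| <=
  C * (\sum_(i < n) w i * `|psi (z i)|) * `|v| ^+ 3 + d%:R ^+ 2 * dl * `|v| ^+ 2 / 2.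
Proof.
move=> T HH.
pose Hn := \matrix_(k, l) \sum_(i < n) w i * hess (m (z i)) t k l.
have dotS : dot (\row_k \sum_(i < n) w i * grad (m (z i)) t 0 k) v =
    \sum_(i < n) w i * dot (grad (m (z i)) t) v.
  rewrite dotE; under eq_bigr do rewrite mxE mulr_suml.
  rewrite exchange_big /=; apply: eq_bigr => i _; rewrite dotE mulr_sumr.
  by apply: eq_bigr => k _; rewrite mulrA.
have quadS : quad Hn v = \sum_(i < n) w i * quad (hess (m (z i)) t) v.
  exact: quad_weighted_sum.
have quadB : `|quad Hn v - quad H v| <= d%:R ^+ 2 * dl * `|v| ^+ 2.
  rewrite !quad_entries -sumrB.
  apply: le_trans (ler_norm_sum _ _ _) _.
  rewrite (_ : d%:R ^+ 2 * dl * `|v| ^+ 2 = \sum_(k < d) \sum_(l < d) `|v| ^+ 2 * dl); last first.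
    by rewrite !sum_ord_cst; ring.
  apply: ler_sum => k _; rewrite -sumrB; apply: le_trans (ler_norm_sum _ _ _) _.
  apply: ler_sum => l _; rewrite -mulrBr !normrM; apply: ler_pM => //.
    by rewrite expr2; apply: ler_pM => //; exact: coord_le_norm.
  by rewrite mxE.
rewrite (_ : _ - quad H v / 2 = \sum_(i < n) w i * (m (z i) (t + v) - m (z i) t -
   dot (grad (m (z i)) t) v - quad (hess (m (z i)) t) v / 2) +
   (quad Hn v - quad H v) / 2); last first.
  rewrite dotS quadS.
  under [in RHS]eq_bigr do rewrite !mulrBr mulrA.
  by rewrite !sumrB -mulr_suml; ring.
apply: le_trans (ler_normD _ _) _; apply: lerD.
  apply: le_trans (ler_norm_sum _ _ _) _.
  rewrite mulr_sumr mulr_suml; apply: ler_sum => i _.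
  rewrite normrM (ger0_norm (w0 i)) (_ : C * _ * _ = w i * (C * `|psi (z i)| * `|v| ^+ 3)); last by ring.
  by rewrite ler_wpM2l.
by rewrite normrM [`|2^-1|]ger0_norm // ler_wpM2r.
Qed.

End WeightedCriterion.

(** * Events of small probability *)

Lemma near_small_union {R : realType} {dT : measure_display} {T : measurableType dT}
    (P : probability T R) (d : nat) (A : nat -> 'I_d -> set T) :
  (forall n i, measurable (A n i)) ->
  (forall i (eta : R), 0 < eta -> \forall n \near \oo, pr P (A n i) <= eta) ->
  forall eta : R, 0 < eta ->
    \forall n \near \oo, pr P [set w | exists i, A n i w] <= eta.
Proof.
move=> mA hA eta eta0.
have e0 : 0 < eta / d.+1%:R by rewrite divr_gt0.
have H : \forall n \near \oo, forall i, pr P (A n i) <= eta / d.+1%:R.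
  by apply: filter_forall => i; exact: hA.
near=> n; have hn : forall i, pr P (A n i) <= eta / d.+1%:R by near: n.
apply: le_trans (pr_bigcup_ord P (mA n)) _.
apply: (@le_trans _ _ (\sum_(i < d) eta / d.+1%:R)); first by apply: ler_sum => i _; exact: hn.
rewrite sum_ord_cst mulrCA -[leRHS]mulr1 ler_wpM2l ?(ltW eta0) //.
by rewrite ler_pdivrMr // mul1r ler_nat.
Unshelve. all: by end_near. Qed.

Lemma measurable_exists_ord {dT : measure_display} {T : measurableType dT}
    (d : nat) (A : 'I_d -> set T) : (forall i, measurable (A i)) ->
  measurable [set w | exists i, A i w].
Proof.
move=> mA; rewrite (_ : [set w | _] = \bigcup_(i in [set: 'I_d]) A i).
  by apply: fin_bigcup_measurable => //; exact: finite_finset.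
by apply/seteqP; split => w /= [i]; [exists i|move=> _; exists i].
Qed.

Lemma cvg_in_prob_pr {R : realType} {dT : measure_display} {T : measurableType dT}
    (P : probability T R) (X : nat -> T -> R) (c : R) :
  cvg_in_prob P X c ->
  forall e eta : R, 0 < e -> 0 < eta ->
    \forall n \near \oo, pr P [set w | e <= `|X n w - c|] <= eta.
Proof.
move=> cX e eta e0 eta0.
have /fine_cvgP[_ /cvgrPdist_le/(_ _ eta0)] := cX e e0.
by apply: filterS => n /=; rewrite sub0r normrN; apply: le_trans; exact: ler_norm.
Qed.

(** * Asymptotic normality of the estimator *)

Section PoissonSubsamplingEstimator.
Context {R : realType} {d : nat} {dT dE : measure_display} {T : measurableType dT}
  {E : measurableType dE}.
Variables (P : probability T R) (Q : probability E R).
Variables (m : E -> 'rV[R]_d -> R) (Theta : set 'rV[R]_d) (theta0 : 'rV[R]_d).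
Variable psi : E -> R.
Hypothesis m_meas : forall t, measurable_fun [set: E] (m ^~ t).
Hypothesis m_diff : forall z, twice_differentiable (m z).
Hypothesis m_concave : forall z, concave (m z).
Hypothesis m_L2 : forall t, Theta t -> integ Q (fun z => m z t ^+ 2).
Hypothesis hess_L2 : forall t k l, Theta t ->
  integ Q (fun z => hess (m z) t k l ^+ 2).
Hypothesis psi_meas : measurable_fun [set: E] psi.
Hypothesis psi_L2 : integ Q (fun z => psi z ^+ 2).
Hypothesis hess_lip : forall z t1 t2 k l, Theta t1 -> Theta t2 ->
  `|hess (m z) t1 k l - hess (m z) t2 k l| <= psi z * enorm (t1 - t2).
Hypothesis grad_L2 : forall t k l, Theta t ->
  integ Q (fun z => outer (grad (m z) t) k l).
Let M t := \int[Q]_z m z t.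
Hypothesis theta0_max : is_argmax Theta M theta0.
Hypothesis theta0_int : interior Theta theta0.
Hypothesis hess_posdef :
  posdefmx (- \matrix_(k < d, l < d) \int[Q]_z hess (m z) theta0 k l).

Variables (Z : nat -> T -> E) (u : forall n, 'I_n -> T -> R).
Variables (s : nat -> R) (p : forall n, 'I_n -> n.-tuple E -> R).
Hypothesis Z_law : forall i, has_law P (Z i) Q.
Hypothesis u_law : forall n (i : 'I_n), has_law P (u i) (uniform_prob (@ltr01 R)).
Hypothesis Zu_indep : forall n,
  data_uniforms_independent P (fun i : 'I_n => Z i) (@u n).
Hypothesis p_meas : forall n (i : 'I_n), measurable_fun [set: n.-tuple E] (p i).
Hypothesis s_range : forall n, (1 < n)%N -> 0 < s n < n%:R.
Hypothesis s_infty : s n @[n --> \oo] --> +oo.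
Hypothesis design : forall n w, (1 < n)%N ->
  subsampling_distribution (s n) (fun i => @p n i (data_tuple n Z w)).
Hypothesis weights_tight : bounded_in_prob P (fun n w => max_inv_prob Z (@p n) w).

Variable theta_tilde : nat -> T -> 'rV[R]_d.
Hypothesis theta_tilde_rv : forall n, random_vector (theta_tilde n).
Hypothesis theta_tilde_max : forall n w,
  is_argmax Theta (poisson_objective m (s n) (fun i : 'I_n => Z i w)
    (fun i => @p n i (data_tuple n Z w)) (fun i => u i w)) (theta_tilde n w).

Variable Lambda_pi : 'M[R]_d.
Hypothesis Lambda_pi_psd : psd Lambda_pi.
Hypothesis Lambda_nR_cvg : forall k l, cvg_in_prob P
  (fun n w => Lambda_nR m (fun i : 'I_n => Z i w)
     (fun i => @p n i (data_tuple n Z w)) theta0 k l) (Lambda_pi k l).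

Notation hts n := (ht_sum Z (@u n) (s n) (@p n)).
Notation H := (hess M theta0).

Let near_gt1 : \forall n \near \oo, (1 < n)%N. Proof. exact: nbhs_infty_gt. Qed.

Let theta0_in : Theta theta0. Proof. exact: theta0_max.1. Qed.

Let HE : H = \matrix_(k < d, l < d) \int[Q]_z hess (m z) theta0 k l.
Proof. exact: (hess_mean m_meas m_diff m_L2 hess_L2 psi_meas psi_L2 hess_lip grad_L2). Qed.

Let pdH : posdefmx (- H). Proof. by rewrite HE. Qed.

Let Hsym : H^T = H. Proof. by apply: oppr_inj; rewrite -linearN /=; exact: pdH.1. Qed.

Let Hunit : H \in unitmx.
Proof. by rewrite -[H]opprK -[- - H]scaleN1r unitmxZ ?unitrN1 //; exact: posdef_unit. Qed.

Let iHsym : (invmx H)^T = invmx H. Proof. by rewrite trmx_inv Hsym. Qed.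

(** The gradient of the weighted criterion at the true parameter. *)
Definition score n w : 'rV[R]_d := \row_k hts n (fun z => grad (m z) theta0 0 k) w.

(** The Newton step from [theta0] with the Hessian of the mean criterion, in
    units of [1 / sqrt s]. *)
Definition linearization n w : 'rV[R]_d :=
  - (Num.sqrt (s n) *: (score n w *m invmx H)).

(** The weighted criterion is concave and, on the ball of radius [D / sqrt s]
    around [theta0], close to a quadratic with Hessian [H] at the precision
    [1 / s]; its maximizer is therefore close to the vertex, at the precision
    [1 / sqrt s].  An exceptional event that is measurable by construction
    spares the measurability of the distance itself. *)
Lemma estimator_linearization (eps eta : R) : 0 < eps -> 0 < eta ->
  exists L : R, \forall n \near \oo, exists2 N, measurable N & pr P N <= eta /\
    forall w, ~ N w ->
      `|Num.sqrt (s n) *: (theta_tilde n w - theta0) - linearization n w| <= eps /\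
      `|linearization n w| <= L.
Proof.
move=> eps0 eta0.
have [r r0 ball] := interior_ball theta0_int.
have [c c0 coer] := posdef_coercive pdH.
have eta30 : 0 < eta / 3 by rewrite divr_gt0.
have eta40 : 0 < eta / 3 / d.+1%:R by rewrite divr_gt0.
have mg k : measurable_fun [set: E] (fun z => grad (m z) theta0 0 k) by exact: measurable_grad.
have ig2 k : integ Q (fun z => grad (m z) theta0 0 k ^+ 2) by exact: (integ_grad_sqr grad_L2 k theta0_in).
have Eg k : \int[Q]_z grad (m z) theta0 0 k = 0.
  exact: (mean_grad_eq0 m_meas m_diff m_L2 hess_L2 psi_meas psi_L2 hess_lip grad_L2).
have LfE k : exists L, 0 < L /\ \forall n \near \oo,
    pr P [set w | L <= Num.sqrt (s n) * `|hts n (fun z => grad (m z) theta0 0 k) w|] <=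
    eta / 3 / d.+1%:R.
  by have [L ? ?] := ht_sum_tight Z_law u_law Zu_indep p_meas s_range design
    weights_tight (mg k) (ig2 k) (Eg k) eta40; exists L.
have /choice[Lf LfP] := LfE.
pose L0 := \sum_k Lf k.
have Lf0 k : 0 <= Lf k by have [/ltW] := LfP k.
have L00 : 0 <= L0 by exact: sumr_ge0.
have LfL k : Lf k <= L0 by rewrite /L0 (bigD1 k) //= lerDl sumr_ge0.
pose CA := \sum_k \sum_l `|invmx H k l|.
have CA0 : 0 <= CA by apply: sumr_ge0 => k _; exact: sumr_ge0.
pose L := L0 * CA; have L_ge0 : 0 <= L by exact: mulr_ge0.
exists L.
(* all that happens is within the distance [D / sqrt s] of [theta0] *)
pose D := L + eps; have D0 : 0 < D by rewrite ltr_pwDr.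
(* the precision on the Hessian that makes its share of the Taylor error at
   most [c * eps ^+ 2 / 16], after multiplication by [s] *)
pose dl := c * eps ^+ 2 / (8 * (d%:R ^+ 2 + 1) * D ^+ 2).
have dl0 : 0 < dl.
  apply: divr_gt0; first exact: (mulr_gt0 c0 (exprn_gt0 2 eps0)).
  apply: mulr_gt0 (exprn_gt0 2 D0); exact: mulr_gt0.
pose Psi := \int[Q]_z `|psi z|.
have Psi0 : 0 <= Psi by exact: ERge0.
have mpsi : measurable_fun [set: E] (fun z => `|psi z|) by exact: measurableT_comp.
have ipsi2 : integ Q (fun z => `|psi z| ^+ 2).
  by rewrite (_ : (fun z => _) = fun z => psi z ^+ 2) //; apply/funext => z; rewrite real_normK ?num_real.
have mh k l : measurable_fun [set: E] (fun z => hess (m z) theta0 k l) by exact: measurable_hess.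
pose B1 n := [set w | exists k, Lf k <= Num.sqrt (s n) * `|hts n (fun z => grad (m z) theta0 0 k) w|].
pose B2 n := [set w | exists k, exists l, dl <= `|hts n (fun z => hess (m z) theta0 k l) w - H k l|].
pose B3 n := [set w | 1 <= `|hts n (fun z => `|psi z|) w - Psi|].
have mhts n (f : E -> R) : measurable_fun [set: E] f -> measurable_fun [set: T] (hts n f).
  by move=> mf; exact: measurable_ht_sum.
have mB1 n k : measurable [set w | Lf k <= Num.sqrt (s n) * `|hts n (fun z => grad (m z) theta0 0 k) w|].
  apply: measurable_set_le => //; apply: measurable_funM => //.
  by apply: measurableT_comp => //; exact: mhts.
have mB2 n k l : measurable [set w | dl <= `|hts n (fun z => hess (m z) theta0 k l) w - H k l|].
  apply: measurable_set_le => //; apply: measurableT_comp => //.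
  by apply: measurable_funB => //; exact: mhts.
have mB3 n : measurable (B3 n).
  apply: measurable_set_le => //; apply: measurableT_comp => //.
  by apply: measurable_funB => //; exact: mhts.
have hB1 : \forall n \near \oo, pr P (B1 n) <= eta / 3.
  have K : \forall n \near \oo, forall k, pr P [set w | Lf k <= Num.sqrt (s n) *
     `|hts n (fun z => grad (m z) theta0 0 k) w|] <= eta / 3 / d.+1%:R.
    by apply: filter_forall => k; have [_] := LfP k.
  apply: filterS K => n hk; apply: le_trans (pr_bigcup_ord P (mB1 n)) _.
  apply: (@le_trans _ _ (\sum_(i < d) eta / 3 / d.+1%:R)).
    by apply: ler_sum => k _; exact: hk.
  rewrite sum_ord_cst mulrCA -[leRHS]mulr1 ler_wpM2l ?(ltW eta30) //.
  by rewrite ler_pdivrMr // mul1r ler_nat.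
have hB2 : \forall n \near \oo, pr P (B2 n) <= eta / 3.
  apply: (near_small_union (A := fun n k => [set w | exists l, dl <= `|hts n (fun z => hess (m z) theta0 k l) w - H k l|])) => //.
    by move=> n k; apply: measurable_exists_ord => l; exact: mB2.
  move=> k e e0.
  apply: (near_small_union (A := fun n l => [set w | dl <= `|hts n (fun z => hess (m z) theta0 k l) w - H k l|])) => //.
  move=> l e' e'0; rewrite [H]HE mxE.
  by apply: (ht_sum_lln Z_law u_law Zu_indep p_meas s_range s_infty design weights_tight) => //; exact: hess_L2.
have hB3 : \forall n \near \oo, pr P (B3 n) <= eta / 3.
  exact: (ht_sum_lln Z_law u_law Zu_indep p_meas s_range s_infty design weights_tight).
near=> n.
have n1 : (1 < n)%N by near: n; exact: near_gt1.
have /andP[sp sl] := s_range n1.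
pose rs := Num.sqrt (s n); have rs0 : 0 < rs by rewrite sqrtr_gt0.
have rs2 : rs ^+ 2 = s n by rewrite sqr_sqrtr // ltW.
have rs_ge x : x ^+ 2 <= s n -> x <= rs.
  move=> xs; apply: le_trans (ler_norm x) _.
  by rewrite -(sqrtr_sqr x); exact: ler_wsqrtr.
(* the ball where the expansion is used lies inside the parameter set *)
have rs1 : D / r <= rs.
  by apply: rs_ge; near: n; move: s_infty => /cvgryPge; exact.
(* likewise for the cubic remainder *)
have rs3 : 16 * d%:R ^+ 3 * (Psi + 1) * D ^+ 3 / (c * eps ^+ 2) <= rs.
  by apply: rs_ge; near: n; move: s_infty => /cvgryPge; exact.
exists (B1 n `|` B2 n `|` B3 n).
  apply: measurableU => //; apply: measurableU; first exact: (measurable_exists_ord (mB1 n)).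
  by apply: measurable_exists_ord => k; apply: measurable_exists_ord => l; exact: mB2.
have mb1 : measurable (B1 n) by exact: (measurable_exists_ord (mB1 n)).
have mb2 : measurable (B2 n) by apply: measurable_exists_ord => k; apply: measurable_exists_ord => l; exact: mB2.
split.
  apply: le_trans (pr_leU _ _ _) _ => //; first exact: measurableU.
  rewrite (_ : eta = eta / 3 + eta / 3 + eta / 3); last by field.
  apply: lerD; last by near: n.
  by apply: le_trans (pr_leU _ _ _) _ => //; apply: lerD; near: n.
move=> w /not_orP[/not_orP[N1 N2] N3].
have sc k : rs * `|score n w 0 k| <= L0.
  rewrite mxE; apply: le_trans (LfL k); apply: ltW; rewrite ltNge; apply/negP => h.
  by apply: N1; exists k.
have he k l : `|hts n (fun z => hess (m z) theta0 k l) w - H k l| <= dl.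
  by apply: ltW; rewrite ltNge; apply/negP => h; apply: N2; exists k, l.
have hpsi : hts n (fun z => `|psi z|) w <= Psi + 1.
  rewrite -lerBlDl; apply: le_trans (ler_norm _) _.
  by apply: ltW; rewrite ltNge; apply/negP.
have linL : `|score n w *m invmx H| <= L / rs.
  rewrite /L mulrAC; apply: norm_mulmx_le => [|k]; first by rewrite divr_ge0 // ltW.
  by rewrite ler_pdivlMr // mulrC.
have wt0 i : 0 <= ht_weight Z (@u n) (s n) (@p n) i w.
  by apply: ht_weight_ge0 => // w'; exact: design.
have near_est : `|theta_tilde n w - (theta0 - score n w *m invmx H)| <= eps / rs.
  pose F t := hts n (m ^~ t) w.
  pose r' := D / rs.
  have r'0 : 0 < r' by exact: divr_gt0.
  have r'r : r' <= r by rewrite /r' ler_pdivrMr // mulrC -ler_pdivrMr.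
  pose eta' := d%:R ^+ 3 * (Psi + 1) * r' ^+ 3 + d%:R ^+ 2 * dl * r' ^+ 2 / 2.
  apply: (@concave_argmax_near _ _ F Theta theta0 _ _ H c eta' r') => //.
  - by apply: weighted_sum_concave.
  - by move=> t tr; apply: ball; exact: le_trans tr r'r.
  - move=> t tr; rewrite -[t in F t](subrKC theta0).
    have := @weighted_sum_taylor _ _ _ m n (fun i => Z i w) _ wt0 theta0 (t - theta0)
      (d%:R ^+ 3) psi H dl (fun x => taylor_ball m_diff hess_lip x r0 ball (le_trans tr r'r)) he.
    move=> /le_trans; apply; apply: lerD.
      apply: ler_pM => //.
      - by apply: mulr_ge0; [exact: exprn_ge0|apply: sumr_ge0 => i _; exact: mulr_ge0].
      - by apply: ler_wpM2l; [exact: exprn_ge0|exact: hpsi].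
      - by rewrite lerXn2r ?nnegrE // ltW.
    rewrite ler_wpM2r //; apply: ler_wpM2l; first by apply: mulr_ge0; [exact: sqr_ge0|exact: ltW].
    by rewrite lerXn2r ?nnegrE // ltW.
  - by move=> x; have := coer x; rewrite quadNmx; lra.
  - exact: divr_gt0.
  - by rewrite /r' /D mulrDl lerD2r.
  - have ce0 : 0 < c * eps ^+ 2 := mulr_gt0 c0 (exprn_gt0 2 eps0).
    have b1 : d%:R ^+ 3 * (Psi + 1) * r' ^+ 3 <= c * eps ^+ 2 / 16 / rs ^+ 2.
      rewrite /r' expr_div_n mulrA ler_pdivrMr ?exprn_gt0 //.
      rewrite (_ : c * eps ^+ 2 / 16 / rs ^+ 2 * rs ^+ 3 = c * eps ^+ 2 * rs / 16); last first.
        by field; rewrite gt_eqF.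
      rewrite ler_pdivlMr //; move: rs3; rewrite ler_pdivrMr // => h3.
      by apply: le_trans _ (le_trans h3 _); rewrite le_eqVlt; apply/orP; left; apply/eqP; ring.
    have b2 : d%:R ^+ 2 * dl * r' ^+ 2 / 2 <= c * eps ^+ 2 / 16 / rs ^+ 2.
      have dd0 : 0 < d%:R ^+ 2 + 1 :> R by rewrite ltr_wpDl // sqr_ge0.
      rewrite (_ : d%:R ^+ 2 * dl * r' ^+ 2 / 2 = c * eps ^+ 2 / 16 / rs ^+ 2 *
         (d%:R ^+ 2 / (d%:R ^+ 2 + 1))); last first.
        by rewrite /dl /r'; field; rewrite !gt_eqF.
      rewrite ler_piMr //; first by rewrite !divr_ge0 ?sqr_ge0 // ltW.
      by rewrite ler_pdivrMr // mul1r lerDl.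
    have x0 : 0 < c * eps ^+ 2 / 16 / rs ^+ 2.
      by apply: divr_gt0; [exact: divr_gt0|exact: exprn_gt0].
    rewrite expr_div_n (_ : c * (eps ^+ 2 / rs ^+ 2) / 2 = 8 * (c * eps ^+ 2 / 16 / rs ^+ 2)); last first.
      by field; rewrite gt_eqF.
    by rewrite /eta'; lra.
  - have [pp _ _] : subsampling_distribution (s n) (fun i => @p n i (data_tuple n Z w)) by exact: design.
    apply: argmax_scale _ _ (theta_tilde_max n w).
      2: by move=> t; exact: (poisson_objective_weights m _ _ _ sp pp).
    by rewrite divr_ge0 // ltW.
rewrite /linearization -/rs; split; last first.
  rewrite normrN normrZ (gtr0_norm rs0) mulrC -ler_pdivlMr //.
rewrite -scalerN -scalerBr normrZ (gtr0_norm rs0) mulrC -ler_pdivlMr //.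
by move: near_est; rewrite opprB addrA addrAC opprK.
Unshelve. all: by end_near. Qed.

Let V := invmx H *m Lambda_pi *m invmx H.

(** The sandwich form is the covariance of the image of a vector with covariance
    [Lambda_pi] under the symmetric matrix [invmx H]. *)
Lemma sandwich_quad a : quad V a = quad Lambda_pi (a *m invmx H).
Proof. by rewrite /quad /V trmx_mul iHsym !mulmxA. Qed.

Lemma sandwich_psd : psd V.
Proof.
split; first by rewrite /V !trmx_mul iHsym Lambda_pi_psd.1 mulmxA.
by move=> a; rewrite sandwich_quad; exact: Lambda_pi_psd.2.
Qed.

Section Projection.
Variable b : 'rV[R]_d.
Let f z := dot b (grad (m z) theta0).

Let dot_sqr (x : 'rV[R]_d) : dot b x ^+ 2 = quad (outer x) b.
Proof.
rewrite quad_entries expr2 {1}dotE mulr_suml; apply: eq_bigr => k _.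
rewrite dotE mulr_sumr; apply: eq_bigr => l _; rewrite outerE; ring.
Qed.

Let mf : measurable_fun [set: E] f.
Proof.
rewrite (_ : f = fun z => \sum_k b 0 k * grad (m z) theta0 0 k); last first.
  by apply/funext => z; rewrite /f dotE.
by apply: measurable_sum => k; apply: measurable_funM => //; exact: measurable_grad.
Qed.

Let if2 : integ Q (fun z => f z ^+ 2).
Proof.
rewrite (_ : (fun z => _) = fun z => \sum_k \sum_l b 0 k * b 0 l * outer (grad (m z) theta0) k l).
  by apply: integ_sum => k; apply: integ_sum => l; apply: integZ; exact: grad_L2.
by apply/funext => z; rewrite /f dot_sqr quad_entries.
Qed.

Let Ef : \int[Q]_z f z = 0.
Proof.
rewrite (_ : f = fun z => \sum_k b 0 k * grad (m z) theta0 0 k); last first.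
  by apply/funext => z; rewrite /f dotE.
have ig k : integ Q (fun z => grad (m z) theta0 0 k).
  exact: (integ_grad m_meas m_diff grad_L2 k theta0_in).
rewrite ERsum => [|k]; last exact: integZ.
rewrite big1 // => k _; rewrite ERZ //.
by rewrite (mean_grad_eq0 m_meas m_diff m_L2 hess_L2 psi_meas psi_L2 hess_lip grad_L2) ?mulr0.
Qed.

Let score_proj n w : dot b (score n w) = hts n f w.
Proof.
rewrite dotE /ht_sum; under eq_bigr do rewrite mxE mulr_sumr.
rewrite exchange_big /=; apply: eq_bigr => i _.
by rewrite /f dotE mulr_sumr; apply: eq_bigr => k _; rewrite mulrCA.
Qed.

Let Lam n w := Lambda_nR m (fun i : 'I_n => Z i w)
  (fun i => @p n i (data_tuple n Z w)) theta0.

Let LamE n w : Lam n w = \matrix_(k, l) \sum_(i < n)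
  (n%:R ^+ 2 * @p n i (data_tuple n Z w))^-1 * outer (grad (m (Z i w)) theta0) k l.
Proof.
apply/matrixP => k l; rewrite /Lam /Lambda_nR mxE summxE mxE mulr_sumr.
by apply: eq_bigr => i _; rewrite (invfM (n%:R ^+ 2)) -(mulrA (n%:R ^- 2)) mxE.
Qed.

Let square_sumE n w : ht_square_sum Z p f n w = quad (Lam n w) b.
Proof.
rewrite LamE quad_weighted_sum; apply: eq_bigr => i _.
by rewrite /f dot_sqr mulrC.
Qed.

Let mLam n k l : measurable_fun [set: T] (fun w => Lam n w k l).
Proof.
rewrite (_ : (fun w => _) = fun w => \sum_(i < n)
  (n%:R ^+ 2 * @p n i (data_tuple n Z w))^-1 *
    (grad (m (Z i w)) theta0 0 k * grad (m (Z i w)) theta0 0 l)); last first.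
  apply/funext => w; rewrite LamE mxE; apply: eq_bigr => i _; by rewrite outerE.
have mgZ i j : measurable_fun [set: T] (fun w => grad (m (Z i w)) theta0 0 j).
  exact: (measurableT_comp (measurable_grad m_meas m_diff theta0 j) (Z_law i).1).
apply: measurable_sum => i; apply: measurable_funM; last exact: measurable_funM.
apply: (measurableT_comp (@measurable_invr R)); apply: measurable_funM => //.
apply: (measurableT_comp (p_meas i)).
by apply: measurable_data_tuple => j; exact: (Z_law j).1.
Qed.

Let square_sum_cvg (e eta : R) : 0 < e -> 0 < eta -> \forall n \near \oo,
  pr P [set w | e <= `|ht_square_sum Z p f n w - quad Lambda_pi b|] <= eta.
Proof.
move=> e0 eta0.
pose C := 1 + \sum_k \sum_l `|b 0 k * b 0 l|.
have C0 : 0 < C.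
  by rewrite ltr_pwDl // sumr_ge0 // => k _; exact: sumr_ge0.
have eC0 : 0 < e / C by rewrite divr_gt0.
pose A n k l := [set w | e / C <= `|Lam n w k l - Lambda_pi k l|].
have mA n k l : measurable (A n k l).
  apply: measurable_set_le => //; apply: measurableT_comp => //.
  exact: measurable_funB.
have H1 : \forall n \near \oo, pr P [set w | exists k, exists l, A n k l w] <= eta.
  apply: (near_small_union (A := fun n k => [set w | exists l, A n k l w])) => //.
    by move=> n k; apply: measurable_exists_ord.
  move=> k x x0; apply: (near_small_union (A := fun n l => A n k l)) => // l y y0.
  exact: (cvg_in_prob_pr (@Lambda_nR_cvg k l)).
apply: filterS H1 => n; apply: le_trans; apply: pr_le.
- apply: measurable_set_le => //; apply: measurableT_comp => //.
  by apply: measurable_funB => //; exact: measurable_ht_square_sum.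
- by apply: measurable_exists_ord => k; exact: measurable_exists_ord.
move=> w /=; rewrite square_sumE => h; apply: contrapT => nA; move: h; apply/negP.
rewrite -ltNge !quad_entries -sumrB.
apply: (@le_lt_trans _ _ ((\sum_k \sum_l `|b 0 k * b 0 l|) * (e / C))).
  rewrite mulr_suml; apply: le_trans (ler_norm_sum _ _ _) _; apply: ler_sum => k _.
  rewrite -sumrB mulr_suml; apply: le_trans (ler_norm_sum _ _ _) _; apply: ler_sum => l _.
  rewrite -mulrBr normrM ler_wpM2l //; apply: ltW; rewrite ltNge; apply/negP => h.
  by apply: nA; exists k, l.
rewrite mulrCA -[ltRHS]mulr1 ltr_pM2l // ltr_pdivrMr // mul1r /C; lra.
Qed.

(** The projections of the score are Horvitz-Thompson sums of real functions, to
    which the central limit theorem applies; this is the device of Cramer and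
    Wold. *)
Lemma score_cos c : \int[P]_w cos (c + Num.sqrt (s n) * dot b (score n w)) @[n --> \oo] -->
  expR (- (quad Lambda_pi b / 2)) * cos c.
Proof.
under eq_fun do under eq_Rintegral do rewrite score_proj.
exact: (ht_sum_clt Z_law u_law Zu_indep p_meas s_range s_infty design weights_tight
  mf if2 Ef (Lambda_pi_psd.2 b) square_sum_cvg).
Qed.

End Projection.

Lemma linearization_cos a c :
  \int[P]_w cos (c + dot a (linearization n w)) @[n --> \oo] -->
  expR (- (quad V a / 2)) * cos c.
Proof.
have E1 n w : dot a (linearization n w) =
    Num.sqrt (s n) * dot (- (a *m invmx H)) (score n w).
  rewrite /linearization -scalerN dotZr; congr (_ * _).
  rewrite -[- (a *m _)]scaleN1r -[- (score n w *m _)]scaleN1r dotZr dotZl.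
  by congr (_ * _); rewrite dotC; apply: dot_mul_sym.
under eq_fun do under eq_Rintegral do rewrite E1.
rewrite sandwich_quad -quadN; exact: score_cos.
Qed.

Lemma measurable_linearization n : random_vector (linearization n).
Proof.
have mg k : measurable_fun [set: E] (fun z => grad (m z) theta0 0 k) by exact: measurable_grad.
move=> l; rewrite (_ : (fun w => _) = fun w => - (Num.sqrt (s n) * \sum_k score n w 0 k * invmx H k l)); last first.
  by apply/funext => w; rewrite !mxE.
apply: measurableT_comp => //; apply: measurable_funM => //; apply: measurable_sum => k.
apply: measurable_funM => //.
rewrite (_ : (fun w => _) = hts n (fun z => grad (m z) theta0 0 k)); last first.
  by apply/funext => w; rewrite mxE.
by have := mg k; move: (fun z => _) => f mf; exact: measurable_ht_sum.
Qed.

Let X n w := Num.sqrt (s n) *: (theta_tilde n w - theta0).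

Let rvX n : random_vector (X n).
Proof.
move=> k; rewrite (_ : (fun w => _) = fun w => Num.sqrt (s n) * (theta_tilde n w 0 k - theta0 0 k)).
  by apply: measurable_funM => //; apply: measurable_funB => //; exact: theta_tilde_rv.
by apply/funext => w; rewrite /X !mxE.
Qed.

Lemma estimator_tight k : bounded_in_prob P (fun n w => X n w 0 k).
Proof.
move=> e e0; have [L HL] := estimator_linearization ltr01 e0.
exists (1 + L); apply: filterS HL => n [N mN [PN HN]].
have mS : measurable [set w | 1 + L < `|X n w 0 k|].
  by apply: measurable_set_lt => //; apply: measurableT_comp => //; exact: rvX.
rewrite -prE // lee_fin; apply: le_trans PN; apply: pr_le => //.
move=> w /= h; apply: contrapT => nN; move: h; apply/negP; rewrite -leNgt.
have [h1 h2] := HN w nN.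
apply: le_trans (coord_le_norm _ _) _.
rewrite -[X n w](subrK (linearization n w)); apply: le_trans (ler_normD _ _) _.
exact: lerD.
Qed.

(** The cosine is Lipschitz, so that an error that is small off an event of small
    probability does not change the limit of the cosine transform. *)
Lemma estimator_cos a c : \int[P]_w cos (c + dot a (X n w)) @[n --> \oo] -->
  expR (- (quad V a / 2)) * cos c.
Proof.
set l := expR _ * _; apply/cvgrPdist_le => /= e e0.
(* [+ 1] in case [a = 0] *)
pose eps := e / 4 / (d%:R * `|a| + 1).
have da0 : 0 <= d%:R * `|a| by exact: mulr_ge0.
have da1 : 0 < d%:R * `|a| + 1 by rewrite ltr_wpDl.
have eps0 : 0 < eps by rewrite !divr_gt0.
have e80 : 0 < e / 8 by rewrite divr_gt0.
have e20 : 0 < e / 2 by rewrite divr_gt0.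
have [L HL] := estimator_linearization eps0 e80.
have /cvgrPdist_le/(_ _ e20) HC := @linearization_cos a c.
near=> n.
have [N mN [PN HN]] : exists2 N, measurable N & pr P N <= e / 8 /\
    forall w, ~ N w -> `|X n w - linearization n w| <= eps /\
      `|linearization n w| <= L by near: n.
have h1 : `|l - \int[P]_w cos (c + dot a (linearization n w))| <= e / 2 by near: n.
have mX := measurable_cos_dot (rvX n) a c.
have mY := measurable_cos_dot (@measurable_linearization n) a c.
have iX : integ P (fun w => cos (c + dot a (X n w))).
  by apply: (@integ_bounded _ _ _ P _ 1) => // w; exact: cos_max.
have iY : integ P (fun w => cos (c + dot a (linearization n w))).
  by apply: (@integ_bounded _ _ _ P _ 1) => // w; exact: cos_max.
have h2 : `|\int[P]_w (cos (c + dot a (linearization n w)) - cos (c + dot a (X n w)))| <=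
    e / 4 + 2 * pr P N.
  apply: ERsmall => //; first exact: measurable_funB.
  - by move=> w; apply: le_trans (ler_normB _ _) _; rewrite -[leRHS]/(1 + 1) lerD ?cos_max.
  - move=> w /HN[h _]; apply: le_trans (cos_lip _ _) _.
    rewrite distrC opprD addrACA subrr add0r -dotBr.
    apply: le_trans (norm_dot_le _ _) _.
    apply: (@le_trans _ _ ((d%:R * `|a| + 1) * eps)); last first.
      by rewrite /eps mulrC divfK // gt_eqF.
    by apply: ler_pM => //; rewrite lerDl.
  - by rewrite divr_ge0 // ltW.
rewrite ERB // in h2.
move: h1 h2; rewrite !ler_norml => /andP[? ?] /andP[? ?]; apply/andP; split; lra.
Unshelve. all: by end_near. Qed.

Lemma estimator_asymptotically_normal : cvg_in_dist_normal P X V.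
Proof.
have [dT' [T' [P' [G [nG cfG]]]]] := gaussian_vector_exists sandwich_psd.
exists dT', T', P', G; split=> //; apply: levy_continuity => //.
- exact: nG.1.
- exact: estimator_tight.
- by move=> a c; rewrite cfG; exact: estimator_cos.
Qed.

End PoissonSubsamplingEstimator.

Theorem theorem2 (R : realType) (d : nat)
  (* the law Q of Z, the criterion m, the parameter set and theta_0 *)
  (dE : measure_display) (E : measurableType dE) (Q : probability E R)
  (m : E -> 'rV[R]_d -> R)
  (m_meas : forall t, measurable_fun [set: E] (m ^~ t))
  (m_diff : forall z, twice_differentiable (m z))
  (Theta : set 'rV[R]_d) (theta0 : 'rV[R]_d)
  (M := fun t => \int[Q]_z m z t)
  (theta0_max : is_argmax Theta M theta0)
  (theta0_int : interior Theta theta0)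
  (* observations Z_i i.i.d. with law Q; for each sample size n, uniform
     variables u_(n,i), independent of each other and of the data *)
  (dT : measure_display) (T : measurableType dT) (P : probability T R)
  (Z : nat -> T -> E) (u : forall n, 'I_n -> T -> R)
  (Z_law : forall i, has_law P (Z i) Q)
  (u_law : forall n (i : 'I_n), has_law P (u n i) (uniform_prob (@ltr01 R)))
  (Zu_indep : forall n,
     data_uniforms_independent P (fun i : 'I_n => Z i) (u n))
  (* expected subsample sizes s_n, and subsampling probabilities pi_(n,i),
     measurable functions of the data Z_0, ..., Z_(n-1) *)
  (s : nat -> R)
  (s_range : forall n, (1 < n)%N -> 0 < s n < n%:R)
  (s_infty : s n @[n --> \oo] --> +oo)
  (p : forall n, 'I_n -> n.-tuple E -> R)
  (p_meas : forall n (i : 'I_n), measurable_fun [set: n.-tuple E] (p n i))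
  (pi := fun n (i : 'I_n) (w : T) => p n i [tuple Z j w | j < n])
  (pi_distr : forall n w, (1 < n)%N ->
     subsampling_distribution (s n) (fun i : 'I_n => pi n i w))
  (* full data estimator and Poisson subsampling estimator *)
  (theta_hat theta_tilde : nat -> T -> 'rV[R]_d)
  (theta_hat_rv : forall n, random_vector (theta_hat n))
  (theta_hat_max : forall n w,
     is_argmax Theta (full_objective m (fun i : 'I_n => Z i w))
       (theta_hat n w))
  (theta_tilde_rv : forall n, random_vector (theta_tilde n))
  (theta_tilde_max : forall n w,
     is_argmax Theta
       (poisson_objective m (s n) (fun i : 'I_n => Z i w)
          (fun i => pi n i w) (fun i => u n i w))
       (theta_tilde n w))
  (* (i) *)
  (Theta_compact : compact Theta)
  (* (ii) *)
  (m_concave : forall z, concave (m z))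
  (m_max : forall z, exists! t, is_argmax Theta (m z) t)
  (m_L2 : forall t, Theta t ->
     Q.-integrable [set: E] (fun z => (m z t ^+ 2)%:E))
  (* (iii) *)
  (hess_posdef : forall t, Theta t ->
     posdefmx (- \matrix_(k < d, l < d) \int[Q]_z hess (m z) t k l))
  (hess_L2 : forall t k l, Theta t ->
     Q.-integrable [set: E] (fun z => (hess (m z) t k l ^+ 2)%:E))
  (hess_lip : exists psi : E -> R,
     [/\ measurable_fun [set: E] psi,
         Q.-integrable [set: E] (fun z => (psi z ^+ 2)%:E) &
         forall z t1 t2 k l, Theta t1 -> Theta t2 ->
           `|hess (m z) t1 k l - hess (m z) t2 k l|
             <= psi z * enorm (t1 - t2)])
  (* (iv) *)
  (grad_L2 : forall t k l, Theta t ->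
     Q.-integrable [set: E] (fun z => (outer (grad (m z) t) k l)%:E))
  (Lambda_posdef : forall t, Theta t ->
     posdefmx (\matrix_(k < d, l < d) \int[Q]_z outer (grad (m z) t) k l))
  (grad_L4 : exists2 delta : R, 0 < delta &
     forall t, Theta t ->
       bounded_in_prob P (fun n w =>
         if enorm (t - theta_hat n w) < delta
         then n%:R^-1 * \sum_(i < n) enorm (grad (m (Z i w)) t) ^+ 4
         else 0))
  (* (v) *)
  (pi_lower : bounded_in_prob P (fun n w =>
     \big[Num.max/0]_(i < n) (n%:R * pi n i w)^-1))
  (* Lambda_(n,R)(theta_0) -> Lambda_pi(theta_0) in probability *)
  (Lambda_pi : 'M[R]_d)
  (Lambda_pi_posdef : posdefmx Lambda_pi)
  (Lambda_nR_cvg : forall k l, cvg_in_prob P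
     (fun n w => Lambda_nR m (fun i : 'I_n => Z i w) (fun i => pi n i w)
                   theta0 k l)
     (Lambda_pi k l)) :
  cvg_in_dist_normal P
    (fun n w => Num.sqrt (s n) *: (theta_tilde n w - theta0))
    (invmx (hess M theta0) *m Lambda_pi *m invmx (hess M theta0)).
Proof.
have [psi [mpsi ipsi2 hlip]] := hess_lip.
apply: (@estimator_asymptotically_normal _ _ _ _ _ _ P Q m Theta theta0 psi _ _ _ _ _ _ _ _ _ _ _ _
  Z u s p) => //.
- by apply: hess_posdef; exact: theta0_max.1.
- exact: posdef_psd.
Qed.
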